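(* For every integer $n\geq 4$, $\pi_3(CW_n)=\left\lfloor\frac{6n-9}{4}\right\rfloor$.
   Context: Let $S_n$ be the symmetric group on $[n]=\{1,\dots,n\}$, with product $(gs)(x)=g(s(x))$. For a group $X$ with identity $e$ and an inverse-closed subset $S\subseteq X\setminus\{e\}$, the Cayley graph $Cay(X,S)$ is the simple undirected graph with vertex set $X$ and edge set $\{(g,gs)\mid g\in X, s\in S\}$. The Cayley graph generated by the $n$-vertex wheel graph is $CW_n=Cay(S_n,S_2)$, where $S_2$ is the set of transpositions $\{(1~j)\mid 2\le j\le n\}\cup\{(j~j{+}1)\mid 2\le j\le n-1\}\cup\{(2~n)\}$. Let $G$ be a simple connected graph and $\Omega\subseteq V(G)$ with $|\Omega|\geq 2$. An $\Omega$-path in $G$ is a path in $G$ that contains all vertices of $\Omega$. Two $\Omega$-paths $P_i,P_j$ are internally disjoint if $V(P_i)\cap V(P_j)=\Omega$ and $E(P_i)\cap E(P_j)=\emptyset$. Let $\pi_G(\Omega)$ be the maximum number of (pairwise) internally disjoint $\Omega$-paths in $G$. For an integer $k\ge 2$, the $k$-path-connectivity of $G$ is $\pi_k(G)=\min\{\pi_G(\Omega)\mid \Omega\subseteq V(G),\ |\Omega|=k\}$. *)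

(* Defs.v *)
From mathcomp Require Import all_boot all_fingroup.
Set Implicit Arguments.
Unset Strict Implicit.
Unset Printing Implicit Defensive.

(* A simple graph is a symmetric irreflexive relation [e] on a finite type;
   for [CW n] see [CW_sym] and [CW_irr]. *)
Section PathConnectivity.

Variables (T : finType) (e : rel T).

Definition gpath (p : seq T) : bool := sorted e p && uniq p.

Definition pverts (p : seq T) : {set T} := [set x in p].

(* Edges are unordered pairs, so a path and its reversal have the same edges. *)
Definition pedges (p : seq T) : {set {set T}} :=
  [set [set xy.1; xy.2] | xy in zip p (behead p)].

Definition omega_path (Om : {set T}) (p : seq T) : bool :=
  gpath p && (Om \subset pverts p).

Definition int_disjoint (Om : {set T}) (p q : seq T) : bool :=
  (pverts p :&: pverts q == Om) && [disjoint pedges p & pedges q].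

(* A duplicate-free sequence has at most #|T| items, so all paths of the graph
   live in the finite type of sequences of length at most #|T|. *)
Definition omega_family (Om : {set T}) (F : {set #|T|.-bseq T}) : bool :=
  [forall p in F, omega_path Om p] &&
  [forall p in F, forall q in F, (p != q) ==> int_disjoint Om p q].

Definition pi_omega (Om : {set T}) : nat :=
  \max_(F : {set #|T|.-bseq T} | omega_family Om F) #|F|.

(* The neutral value of the minimum is an upper bound of every [pi_omega Om],
   hence it is harmless as soon as [k <= #|T|]; see [pi_connP]. *)
Definition pi_conn (k : nat) : nat :=
  \big[minn/#|{: #|T|.-bseq T}|]_(Om : {set T} | #|Om| == k) pi_omega Om.

Lemma pi_omega_bound Om : pi_omega Om <= #|{: #|T|.-bseq T}|.
Proof. by apply/bigmax_leqP => F _; apply: max_card. Qed.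

Lemma pi_connP k m : k <= #|T| ->
  pi_conn k = m <->
  (exists2 Om : {set T}, #|Om| = k & pi_omega Om = m) /\
  (forall Om : {set T}, #|Om| = k -> m <= pi_omega Om).
Proof.
move=> le_k.
have lb (Om : {set T}) : #|Om| = k -> pi_conn k <= pi_omega Om.
  move=> /eqP kOm; rewrite /pi_conn.
  have : Om \in index_enum {set T} by rewrite mem_index_enum.
  elim: (index_enum _) => // A s IHs; rewrite inE big_cons => /orP[/eqP <-|/IHs le].
    by rewrite kOm geq_minl.
  by case: ifP => // _; apply: leq_trans (geq_minr _ _) le.
have [Om0 kOm0] : exists Om : {set T}, #|Om| = k.
  exists [set x in take k (enum T)].
  rewrite cardsE (card_uniqP _) ?take_uniq ?enum_uniq // size_take -cardE.
  by case: ltngtP le_k.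
have att : exists2 Om : {set T}, #|Om| = k & pi_omega Om = pi_conn k.
  have : pi_conn k = #|{: #|T|.-bseq T}| \/
         exists2 Om : {set T}, #|Om| = k & pi_omega Om = pi_conn k.
    rewrite /pi_conn; elim/big_ind: _ => [|x y|Om /eqP]; first by left.
    - by rewrite /minn; case: ifP.
    - by right; exists Om.
  case=> // Ek; exists Om0 => //.
  by apply/eqP; rewrite eqn_leq lb // Ek pi_omega_bound.
split=> [<- // | [[Om kOm <-] lbm]].
case: att => Om1 kOm1 E1; apply/eqP; rewrite eqn_leq lb //= -E1.
exact: lbm.
Qed.

End PathConnectivity.

(* The product of permutations in MathComp applies the left factor first;
   [pmul g s] is the product for which [(gs)(x) = g(s(x))]. *)
Definition pmul (T : finType) (g s : {perm T}) : {perm T} := (s * g)%g.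

Lemma pmulE (T : finType) (g s : {perm T}) x : pmul g s x = g (s x).
Proof. exact: permM. Qed.

Definition cayley (T : finType) (S : {set {perm T}}) : rel {perm T} :=
  fun g h => [exists s in S, h == pmul g s].

Lemma cayley_sym (T : finType) (S : {set {perm T}}) :
  {in S, forall s, s^-1%g \in S} -> symmetric (cayley S).
Proof.
move=> SV; suff imp g h : cayley S g h -> cayley S h g.
  by move=> g h; apply/idP/idP; apply: imp.
case/existsP=> s /andP[Ss /eqP->]; apply/existsP; exists s^-1%g.
by rewrite SV //= /pmul mulKg.
Qed.

Lemma cayley_irr (T : finType) (S : {set {perm T}}) :
  1%g \notin S -> irreflexive (cayley S).
Proof.
move=> S1 g; apply/existsP=> -[s /andP[Ss]].
by rewrite /pmul -{1}(mul1g g) => /eqP/mulIg s1; rewrite s1 Ss in S1.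
Qed.

(* The ordinal [i : 'I_n] stands for the point [i.+1] of {1, ..., n}.  The
   three disjuncts are (1 j), (j j+1) with j >= 2, and (2 n). *)
Definition wheel_pair (n : nat) (a b : nat) : bool :=
  [|| (a == 1) && (2 <= b), (2 <= a) && (b == a.+1) | (a == 2) && (b == n)].

Definition wheel_gens (n : nat) : {set 'S_n} :=
  [set tperm ij.1 ij.2 | ij : 'I_n * 'I_n & wheel_pair n ij.1.+1 ij.2.+1].

Definition CW (n : nat) : rel 'S_n := cayley (wheel_gens n).
Arguments CW n : clear implicits.

Lemma CW_sym n : symmetric (CW n).
Proof. by apply: cayley_sym => s /imsetP[ij ij_in ->]; rewrite tpermV; apply/imsetP; exists ij. Qed.

Lemma CW_irr n : 3 <= n -> irreflexive (CW n).
Proof.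
move=> n3; apply: cayley_irr; apply/imsetP=> -[[i j]]; rewrite inE /= => w E.
have ij : i = j by rewrite -(tpermL i j) -E perm1.
move: w; rewrite ij /wheel_pair !eqSS.
by case: (nat_of_ord j) => [|[|m]] //=; rewrite ?orbF ?(gtn_eqF (ltnSn _)) //= ltn_eqF.
Qed.

(* Main.v *)
(* Write d = n - 1.  The vertices g with a given value g(hub) form a copy, on
   which the rim transpositions induce a d-regular graph; this graph is connected
   and arc-transitive, hence d-connected by Watkins' theorem.  Swapping two values
   is an isomorphism between two copies, and it matches every vertex with its
   unique neighbour in the other copy.

   Lower bound.  Given terminals x, y, z, it suffices to find internally disjoint
   paths, each joining two of them, in suitable numbers for the three pairs
   (3d - 2 paths in all, or 6 when d = 3): such paths are then glued in pairs at
   a middle terminal.  A copy without terminals contains one neighbour of each of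
   x, y, z and one neighbour of a rim neighbour s of x, say; since the copy is
   2-connected it carries two disjoint paths from the two entries of x to the
   entries of y and z.  What remains depends on where the terminals lie.
   - x, y in one copy, z outside: Menger gives d paths from x to y in that copy,
     and z uses its rim neighbours to enter the other copies.
   - three copies: the copies of x and y form a prism with d + 1 paths from x to
     y, the copy of z provides one or two links, the other copies serve z.
   - one copy: d paths fan out from y to the rim neighbours of x and z, and the
     rim neighbours of x and z that the fan misses lead to the other copies.

   Upper bound.  The even permutations of three positions forming a triangle of
   the wheel have three common neighbours.  An Omega-path uses at least four of
   the 6d edge ends at Omega, and each common neighbour wastes one. *)

(* With d = n - 1 the target is floor((6d - 3)/4). As 6d - 3 is odd, this equals floor((3d - 2)/2),
   which is what 3d - 2 links glued in pairs can give. Two links glue only if they join different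
   pairs of terminals, so their distribution matters too: any two of the three pairs must together
   have at least as many links as there are Omega-paths wanted.

   Two obstacles shape the case analysis. A copy without terminals carries two links only if the
   entries where they end are distinct. Terminals of one copy have distinct entries, but x and y in
   different copies may share one; this happens in at most one copy, and a second link inside the
   copy of z makes up for it. Next, when all terminals lie in one copy, a rim neighbour shared by x
   and z serves only one of them. For d > 3 at most two are shared, which leaves 3d - 2 links; for d
   = 3 the rim is a triangle, three may be shared, and 2d = 6 links suffice for the three
   Omega-paths needed.

   From section [Wheel] on, d is called [n] and the graph is [CW n.+1]. *)
Require Import Defs.
From mathcomp Require Import all_boot all_fingroup.
From mathcomp Require Import zify.

Set Implicit Arguments.
Unset Strict Implicit.
Unset Printing Implicit Defensive.

(** * Menger's theorem *)

Section Flatten.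

Variable V : eqType.
Implicit Types (F : seq (seq V)) (p q : seq V).

Lemma uniq_flatten_mem F p : uniq (flatten F) -> p \in F -> uniq p.
Proof.
elim: F => //= q F IH; rewrite cat_uniq inE => /and3P[uq _ uF] /predU1P[-> //|].
exact: IH.
Qed.

Lemma uniq_flatten_inj F p q v : uniq (flatten F) ->
  p \in F -> q \in F -> v \in p -> v \in q -> p = q.
Proof.
elim: F => //= r F IH; rewrite cat_uniq !inE => /and3P[_ /hasPn dF uF].
have out t : t \in F -> v \in t -> v \notin r.
  by move=> tF vt; apply: dF; apply/flattenP; exists t.
case/predU1P=> [->|pF] /predU1P[->|qF] vp vq //.
- by have := out _ qF vq; rewrite vp.
- by have := out _ pF vp; rewrite vq.
- exact: IH.
Qed.

Lemma uniq_flatten_map (I : eqType) (f : I -> seq V) (l : seq I) :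
  uniq l -> {in l, forall s, uniq (f s)} ->
  (forall s t v, s \in l -> t \in l -> v \in f s -> v \in f t -> s = t) ->
  uniq (flatten [seq f s | s <- l]).
Proof.
elim: l => //= s l IH /andP[sl ul] uf inj; rewrite cat_uniq uf ?mem_head //=.
rewrite IH ?andbT //; last first.
- by move=> a b v al bl; apply: inj; rewrite inE ?al ?bl orbT.
- by move=> t tl; apply: uf; rewrite inE tl orbT.
apply/hasPn=> v /flattenP[q /mapP[t tl ->] vt]; apply/negP=> vs.
by move: sl; rewrite (inj s t v) ?tl // inE ?eqxx ?tl ?orbT.
Qed.

Lemma uniq_nonempty F : uniq (flatten F) -> {in F, forall p, ~~ nilp p} -> uniq F.
Proof.
elim: F => //= p F IH; rewrite cat_uniq => /and3P[_ /hasPn dp uF] ne.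
rewrite IH ?andbT // => [|q qF]; last by rewrite ne // inE qF orbT.
apply/negP=> pF; case: p ne pF dp => [/(_ _ (mem_head _ _))//|a p _ pF dp].
have /dp : a \in flatten F by apply/flattenP; exists (a :: p); rewrite ?mem_head.
by rewrite mem_head.
Qed.

End Flatten.

Section Menger.

Variable V : finType.
Implicit Types (E : rel V) (A B K S : {set V}).

Definition arcs (D : {set V * V}) : rel V := fun u v => (u, v) \in D.

Definition abpath E A B (p : seq V) : bool :=
  if p is a :: q then [&& a \in A, path E a q & last a q \in B] else false.

Definition separates E A B K : Prop :=
  forall p, abpath E A B p -> has (mem K) p.

Lemma first_hit S a q : has (mem S) (a :: q) ->
  exists q1 q2 : seq V,
    [/\ q = q1 ++ q2, last a q1 \in S & {in belast a q1, forall v, v \notin S}].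
Proof.
elim: q a => [|b q IH] a /=.
  by rewrite orbF => aS; exists [::], [::].
case: (boolP (a \in S)) => [aS _|aS /=]; first by exists [::], (b :: q).
case/IH=> q1 [q2 [-> lS nS]]; exists (b :: q1), q2; split=> // v.
by rewrite /= inE => /predU1P[-> //|/nS].
Qed.

Lemma last_hit S a q : has (mem S) (a :: q) ->
  exists (b : V) (q1 q2 : seq V),
    [/\ a :: q = q1 ++ b :: q2, b \in S & {in q2, forall v, v \notin S}].
Proof.
elim: q a => [|c q IH] a.
  by rewrite /= orbF => aS; exists a, [::], [::].
case: (boolP (has (mem S) (c :: q))) => [/IH[b [q1 [q2 [-> bS nS]]]] _|nh].
  by exists b, (a :: q1), q2.
rewrite [has _ (a :: _)]/= -/(has (mem S) (c :: q)) (negbTE nh) orbF => aS.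
by exists a, [::], (c :: q); split=> // v vq; apply: (hasPn nh).
Qed.

(** To use the arc (x, y) a path must both leave x and enter y, so excluding either is enough. *)
Lemma arcsD1_path D x y a q : path (arcs D) a q ->
  {in belast a q, forall v, v != x} \/ {in q, forall v, v != y} ->
  path (arcs (D :\ (x, y))) a q.
Proof.
elim: q a => //= b q IH a /andP[ab bq] H; apply/andP; split; last first.
  apply: IH => //; case: H => H; [left|right] => v vq; apply: H;
    by rewrite inE vq orbT.
rewrite /arcs !inE xpair_eqE; apply/andP; split=> //.
case: H => [/(_ a (mem_head _ _)) /negbTE -> //|].
by move=> /(_ b (mem_head _ _)) /negbTE ->; rewrite andbF.
Qed.

Lemma sep_arc D A B S x y z :
  separates (arcs (D :\ (x, y))) A B S -> z \in [:: x; y] ->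
  separates (arcs D) A B (z |: S).
Proof.
move=> sS zxy [|a q] //= /and3P[aA aq lB].
case: (boolP (z \in a :: q)) => [zq|nz].
  suff: has (mem (z |: S)) (a :: q) by [].
  by apply/hasP; exists z => //=; rewrite !inE eqxx.
have /sS : abpath (arcs (D :\ (x, y))) A B (a :: q).
  rewrite /= aA lB andbT /=; apply: arcsD1_path => //.
  move: zxy; rewrite !inE => /orP[]/eqP <-; [left|right] => v vq.
  - by apply: contraNneq nz => <-; apply: mem_belast.
  - by apply: contraNneq nz => <-; rewrite inE vq orbT.
case/hasP=> v vq vS; suff: has (mem (z |: S)) (a :: q) by [].
by apply/hasP; exists v => //; apply: setU1r.
Qed.

Definition linked E A B k : Prop :=
  exists F : seq (seq V), [/\ size F = k, uniq (flatten F) & all (abpath E A B) F].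

(** Disjoint members have distinct representatives, so by counting f is a bijection from F onto C,
    with inverse P. This indexes a linkage by the vertices of the separator at which its paths end
    or start. *)
Lemma reps_onto (F : seq (seq V)) (C : {set V}) (f : seq V -> V) :
  uniq (flatten F) -> {in F, forall p, f p \in p} ->
  {in F, forall p, f p \in C} -> size F = #|C| ->
  exists P : V -> seq V, {in C, forall s, P s \in F /\ f (P s) = s}.
Proof.
move=> uF fp fC sF.
have finj : {in F &, injective f}.
  move=> p q pF qF Ef; apply: (uniq_flatten_inj uF pF qF (v := f p)).
    exact: fp.
  by rewrite Ef fp.
have uFF : uniq F by apply: uniq_nonempty => // p /fp; case: p.
have [] := uniq_min_size (s1 := map f F) (s2 := enum C).
- by rewrite map_inj_in_uniq.
- by move=> o /mapP[p /fC tC ->]; rewrite mem_enum.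
- by rewrite size_map sF -cardE.
move=> _ E1; exists (fun s => nth [::] F (index s (map f F))) => s sC.
have sfF : s \in map f F by rewrite E1 mem_enum.
have iF : index s (map f F) < size F by rewrite -(size_map f) index_mem.
by split; [apply: mem_nth | rewrite -(nth_map _ s) // nth_index].
Qed.

(** Before its first hit of S + x the path does not leave x, so it does not use the deleted arc.
    Hence whatever separates A from S + x without that arc also separates A from B with it. *)
Lemma abpath_prefix D x y A B S a q : a \in A ->
  path (arcs D) a q -> has (mem (x |: S)) (a :: q) ->
  exists2 q1, {subset a :: q1 <= a :: q} &
    abpath (arcs (D :\ (x, y))) A (x |: S) (a :: q1).
Proof.
move=> aA aq /first_hit[q1 [q2 [Eq lS nS]]]; exists q1.
  by move=> v; rewrite Eq !inE mem_cat => /orP[->|->] //; rewrite orbT.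
rewrite /= aA lS andbT /=; apply: arcsD1_path.
  by move: aq; rewrite Eq cat_path => /andP[].
by left=> v /nS; apply: contraNneq => ->; rewrite !inE eqxx.
Qed.

(** The mirror image: after its last hit of S + y the path never enters y. *)
Lemma abpath_suffix D x y B S a q : last a q \in B ->
  path (arcs D) a q -> has (mem (y |: S)) (a :: q) ->
  exists2 p, {subset p <= a :: q} & abpath (arcs (D :\ (x, y))) (y |: S) B p.
Proof.
move=> lB aq /last_hit[b [q1 [q2 [Eq bS nS]]]]; exists (b :: q2).
  by move=> v vq; rewrite Eq mem_cat vq orbT.
have [bq lb] : path (arcs D) b q2 /\ last b q2 = last a q.
  case: q1 Eq => [|c q1] /= [ca qE]; first by rewrite ca qE in aq *.
  move: aq; rewrite qE cat_path last_cat /= => /and3P[_ _ ->].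
  by split.
rewrite /= bS lb lB andbT /=; apply: arcsD1_path => //.
by right=> v /nS; apply: contraNneq => ->; rewrite !inE eqxx.
Qed.

(* Goering's induction on arcs: if deleting the arc (x, y) creates a separator
   S of size k - 1, then S + x and S + y are minimum separators, A is linked
   onto the first one, the second one is linked onto B, and the two linkages
   can only meet in S. *)
Theorem menger_arcs D A B k :
  (exists2 K : {set V}, #|K| < k & separates (arcs D) A B K) \/
  linked (arcs D) A B k.
Proof.
have [m] := ubnP #|D|; elim: m => // m IH in D A B k *; rewrite ltnS => Dm.
case: (set_0Vmem D) => [D0|[[x y] xyD]].
  case: (ltnP #|A :&: B| k) => [lt|ge]; [left|right].
    exists (A :&: B) => // -[|a [|b q]] //= => [/andP[aA aB]|/and3P[_]].
      by rewrite orbF; apply/setIP.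
    by rewrite /arcs D0 inE.
  exists [seq [:: a] | a <- take k (enum (A :&: B))]; split.
  - by rewrite size_map size_take -cardE; case: ltngtP ge.
  - by rewrite flatten_map1 map_id take_uniq // enum_uniq.
  - apply/allP=> p /mapP[a /mem_take]; rewrite mem_enum inE => /andP[aA aB ->].
    by rewrite /= aA.
set D' := D :\ (x, y).
have D'm : #|D'| < m by apply: leq_trans Dm; rewrite (cardsD1 (x, y) D) xyD.
have mono A' B' p : abpath (arcs D') A' B' p -> abpath (arcs D) A' B' p.
  case: p => //= a q /and3P[-> aq ->]; rewrite andbT /=.
  by apply: sub_path aq => u v; rewrite /arcs inE => /andP[].
case: (IH D' A B k D'm) => [[S Sk sS]|[F [sF uF /allP aF]]]; last first.
  by right; exists F; split=> //; apply/allP=> p /aF /mono.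
have sX : separates (arcs D) A B (x |: S).
  by apply: (sep_arc sS); rewrite inE eqxx.
have sY : separates (arcs D) A B (y |: S).
  by apply: (sep_arc sS); rewrite !inE eqxx orbT.
case: (ltnP #|x |: S| k) => [lt|geX]; first by left; exists (x |: S).
case: (ltnP #|y |: S| k) => [lt|geY]; first by left; exists (y |: S).
have [xS yS] : x \notin S /\ y \notin S.
  split; [move: geX|move: geY]; rewrite cardsU1; case: (_ \in S) => //=;
    by rewrite leqNgt Sk.
have [kX kY] : #|x |: S| = k /\ #|y |: S| = k.
  by move: geX geY; rewrite !cardsU1 xS yS; lia.
case: (IH D' A (x |: S) k D'm) => [[K Kk sK]|].
  left; exists K => // -[|a q] //= /and3P[aA aq lB].
  have /sX hit : abpath (arcs D) A B (a :: q) by rewrite /= aA aq.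
  have [q1 sub ab] := abpath_prefix y B aA aq hit.
  have [v vq vK] := hasP (sK _ ab).
  suff: has (mem K) (a :: q) by [].
  by apply/hasP; exists v; rewrite ?sub.
case=> FX [sX1 uX /allP aX].
case: (IH D' (y |: S) B k D'm) => [[K Kk sK]|].
  left; exists K => // -[|a q] //= /and3P[aA aq lB].
  have /sY hit : abpath (arcs D) A B (a :: q) by rewrite /= aA aq.
  have [p sub ab] := abpath_suffix x lB aq hit.
  have [v vq vK] := hasP (sK _ ab).
  suff: has (mem K) (a :: q) by [].
  by apply/hasP; exists v; rewrite ?sub.
case=> FY [sY1 uY /allP aY].
have [P PP] : exists P, {in x |: S, forall s, P s \in FX /\ last x (P s) = s}.
  apply: (reps_onto uX); last by rewrite sX1 kX.
  - by move=> [|a q] /aX //= _; apply: mem_last.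
  - by move=> [|a q] /aX //= /and3P[].
have [Q QQ] : exists Q, {in y |: S, forall s, Q s \in FY /\ head y (Q s) = s}.
  apply: (reps_onto uY); last by rewrite sY1 kY.
  - by move=> [|a q] /aY //= _; apply: mem_head.
  - by move=> [|a q] /aY //= /and3P[].
have P_inj s t v : s \in x |: S -> t \in x |: S -> v \in P s -> v \in P t -> s = t.
  move=> /PP[sF es] /PP[tF et] vs vt.
  by rewrite -es -et (uniq_flatten_inj uX sF tF vs vt).
have Q_inj s t v : s \in y |: S -> t \in y |: S -> v \in Q s -> v \in Q t -> s = t.
  move=> /QQ[sF es] /QQ[tF et] vs vt.
  by rewrite -es -et (uniq_flatten_inj uY sF tF vs vt).
have memP s : s \in x |: S -> s \in P s.
  by move=> /PP[/aX]; case: (P s) => //= a q _ <-; apply: mem_last.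
have memQ s : s \in y |: S -> s \in Q s.
  by move=> /QQ[/aY]; case: (Q s) => //= a q _ <-; apply: mem_head.
have SX s : s \in S -> s \in x |: S by apply: setU1r.
have SY s : s \in S -> s \in y |: S by apply: setU1r.
(* Following [P s] up to v and then [Q t] gives a path from A to B without the arc (x, y), so it
   meets S. But [P s] meets S only at its end and [Q t] only at its start, which forces v itself
   into S. *)
have PQ s t v : s \in x |: S -> t \in y |: S -> v \in P s -> v \in Q t ->
    [/\ s = v, t = v & v \in S].
  move=> sX' tY vP vQ; suff vS : v \in S.
    have [vX vY] : v \in x |: S /\ v \in y |: S by rewrite SX ?SY.
    by split=> //; [apply: (P_inj s v v ) => //; apply: memP | apply: (Q_inj t v v) => //; apply: memQ].
  apply/negPn/negP => nvS.
  have [/aX aP lP] := PP s sX'; have [/aY aQ hQ] := QQ t tY.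
  have [uP uQ] : uniq (P s) /\ uniq (Q t).
    by split; [apply: (uniq_flatten_mem uX); case: (PP s sX')
              |apply: (uniq_flatten_mem uY); case: (QQ t tY)].
  have PS w : w \in P s -> w \in S -> w = s.
    by move=> wq wS; apply: (P_inj w s w) => //; rewrite ?memP ?SX.
  have QS w : w \in Q t -> w \in S -> w = t.
    by move=> wq wS; apply: (Q_inj w t w) => //; rewrite ?memQ ?SY.
  case: (P s) vP aP lP uP PS => // a q vP /and3P[aA aq _] lP uP PS.
  case: (Q t) vQ aQ hQ uQ QS => // b r vQ /and3P[_ br rB] /= hQ uQ QS.
  case/splitPl: vP aq lP uP PS => q1 q2 lq1; rewrite cat_path /= last_cat lq1.
  case/andP=> aq1 _ lP uP PS.
  have [r1 [r2 [Er vr lr]]] : exists r1 r2,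
      [/\ b :: r = r1 ++ v :: r2, path (arcs D') v r2 & last v r2 \in B].
    case/predU1P: vQ => [->|vr]; first by exists [::], r.
    case/splitPr: vr br rB {uQ QS} => r1 r2; rewrite cat_path last_cat /=.
    by move=> /and3P[_ _ br] rB; exists (b :: r1), r2.
  have /sS : abpath (arcs D') A B (a :: q1 ++ r2).
    by rewrite /= aA cat_path aq1 last_cat lq1 vr.
  case/hasP=> w; rewrite -cat_cons mem_cat => wqr wS'; have {wS'} wS : w \in S := wS'.
  case/orP: wqr => [wq|wr].
    have ws : w = s.
      apply: PS wS; move: wq; rewrite !inE mem_cat.
      by case/orP=> ->; rewrite ?orbT.
    have : uniq ((a :: q1) ++ q2) by []; rewrite cat_uniq => /and3P[_ /hasPn dq _].
    case/lastP: q2 dq lP {PS uP} => [_ vs|q2 s']; first by move: nvS; rewrite (vs : v = s) -ws wS.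
    rewrite last_rcons => /(_ s') + s's; rewrite mem_rcons mem_head s's -ws wq.
    by move/(_ isT).
  have wt : w = t by apply: QS => //; rewrite Er mem_cat inE wr !orbT.
  have : uniq (b :: r) by []; rewrite Er cat_uniq => /and3P[_ /hasPn dr _].
  case: r1 Er dr => [[bv _] _|c r1 [bc _] dr]; first by move: nvS; rewrite -bv hQ -wt wS.
  by move: (dr w); rewrite inE wr orbT wt -hQ bc mem_head => /(_ isT).
(* The path ending at x continues through the arc (x, y); the others are glued at their common
   vertex s of S. *)
right; pose f s := if s == x then P x ++ Q y else P s ++ behead (Q s).
have fE s v : s \in x |: S -> v \in f s ->
    v \in P s \/ v \in Q (if s == x then y else s).
  rewrite /f; case: eqP => [->|_] _; rewrite mem_cat => /orP[|vQ]; auto.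
  by right; case: (Q s) vQ => // a q; apply: mem_behead.
have Y s : s \in x |: S -> (if s == x then y else s) \in y |: S.
  by case/setU1P=> [->|sS']; [rewrite eqxx setU11 | case: eqP => _; rewrite ?setU11 ?SY].
exists [seq f s | s <- enum (x |: S)]; split.
- by rewrite size_map -cardE.
- apply: uniq_flatten_map; first exact: enum_uniq.
    move=> s; rewrite mem_enum => sX'; rewrite /f.
    have uP t : t \in x |: S -> uniq (P t).
      by move=> tX; apply: (uniq_flatten_mem uX); case: (PP t tX).
    have uQ t : t \in y |: S -> uniq (Q t).
      by move=> tX; apply: (uniq_flatten_mem uY); case: (QQ t tX).
    case: eqP => [_|/eqP sx]; rewrite cat_uniq uP ?setU11 //=.
      rewrite uQ ?setU11 // andbT; apply/hasPn=> v vQ; apply/negP=> vP.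
      have [xv _ vS] := PQ x y v (setU11 _ _) (setU11 _ _) vP vQ.
      by rewrite xv vS in xS.
    have sS' : s \in S by case/setU1P: sX' sx => [->|//]; rewrite eqxx.
    have [hQ uQs] : head y (Q s) = s /\ uniq (Q s).
      by split; [case: (QQ s (SY s sS')) | apply/uQ/SY].
    move: (PQ s s) hQ uQs; case: (Q s) => [|b r] //= PQs hb /andP[bq ->].
    rewrite andbT; apply/hasPn=> v vr; apply/negP=> vP.
    have [] := PQs v sX' (SY s sS') vP; first by rewrite inE vr orbT.
    by move=> sv; rewrite -hb in sv; rewrite sv vr in bq.
- move=> s t v; rewrite !mem_enum => sX' tX' /(fE _ _ sX') vs /(fE _ _ tX') vt.
  have S' u w : u \in S -> (if w == x then y else w) = u -> w = u.
    by case: eqP => // _ uS yu; rewrite yu uS in yS.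
  case: vs vt => [vs|vs] [vt|vt].
  + exact: P_inj vs vt.
  + have [-> tv vS] := PQ _ _ _ sX' (Y _ tX') vs vt.
    by rewrite (S' _ _ vS tv).
  + have [-> tv vS] := PQ _ _ _ tX' (Y _ sX') vt vs.
    by rewrite (S' _ _ vS tv).
  + have := Q_inj _ _ _ (Y _ sX') (Y _ tX') vs vt.
    case: eqP => [->|_]; case: eqP => [->|_] // Est.
      by case/setU1P: tX' => // tS; rewrite Est tS in yS.
    by case/setU1P: sX' => // sS'; rewrite -Est sS' in yS.
- apply/allP=> p /mapP[s]; rewrite mem_enum => sX' ->; rewrite /f.
  have [/aX aP lP] := PP s sX'.
  case: eqP => [sx|/eqP sx].
    have [/aY aQ hQ] := QQ y (setU11 _ _); rewrite sx in aP lP.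
    case: (P x) aP lP => // a q /and3P[aA aq _] /= lq.
    case: (Q y) aQ hQ => // b r /and3P[_ br lB] /= hb.
    have sub : subrel (arcs D') (arcs D) by move=> u v; rewrite /arcs inE => /andP[].
    rewrite aA cat_path last_cat /= lB lq hb (sub_path sub aq) -hb (sub_path sub br).
    by rewrite hb andbT /= andbT.
  have sS' : s \in S by case/setU1P: sX' sx => [->|//]; rewrite eqxx.
  have [/aY aQ hQ] := QQ s (SY s sS'); apply: mono.
  case: (P s) aP lP => // a q /and3P[aA aq _] /= lq.
  case: (Q s) aQ hQ => // b r /and3P[_ br lB] /= hb.
  by rewrite aA cat_path last_cat aq lq -hb br lB.
Qed.

Definition avoid E K : rel V := fun u v => [&& E u v, u \notin K & v \notin K].

(** A path along these arcs can meet A only at its first vertex and B only at its last. *)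
Definition trim_rel E A B : rel V :=
  fun u v => [&& E u v, u \notin B & v \notin A].

(** Restart the path at its last vertex in A and stop it at the first vertex in B from there. *)
Lemma trim_exists E A B a q : a \in A -> path E a q -> last a q \in B ->
  exists2 p, {subset p <= a :: q} & abpath (trim_rel E A B) A B p.
Proof.
have [m] := ubnP (size q); elim: m => // m IH in a q *; rewrite ltnS => qm aA aq lB.
case: (boolP (has (mem A) q)) => [/hasP[v vq vA]|/hasPn nA].
  case/splitPr: vq aq lB qm => q1 q2; rewrite cat_path last_cat size_cat /=.
  move=> /and3P[_ _ vq] lB qm; have [|p sub ab] := IH v q2 _ vA vq lB; first by lia.
  by exists p => // w /sub; rewrite !inE mem_cat inE => ->; rewrite !orbT.
have [q1 [q2 [Eq lS nB]]] : exists q1 q2 : seq V,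
    [/\ q = q1 ++ q2, last a q1 \in B & {in belast a q1, forall v, v \notin B}].
  by apply: first_hit; apply/hasP; exists (last a q) => //; apply: mem_last.
exists (a :: q1).
  by move=> v; rewrite Eq !inE mem_cat => /orP[->|->] //; rewrite orbT.
rewrite /= aA lS andbT /=; move: aq nA; rewrite Eq cat_path => /andP[aq _].
have: {in q1, forall v, v \in q1 ++ q2} by move=> v vq; rewrite mem_cat vq.
move: (q1 ++ q2) => q' sub nA; have {nA sub q'} : {in q1, forall v, v \notin A}.
  by move=> v /sub; apply: nA.
elim: q1 a aq nB {lS aA lB Eq} => //= b q1 IHq a /andP[ab bq] nB nA.
rewrite {1}/trim_rel ab nB ?mem_head // nA ?mem_head //=; apply: IHq => // v vq.
  by apply: nB; rewrite inE vq orbT.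
by apply: nA; rewrite inE vq orbT.
Qed.

Lemma avoid_path E K a q : path (avoid E K) a q ->
  path E a q /\ {in q, forall v, v \notin K}.
Proof.
elim: q a => //= b q IH a /andP[/and3P[ab _ nb] /IH[bq nK]].
by rewrite ab bq; split=> // v /predU1P[->|/nK].
Qed.

(** [menger_arcs] is applied to the arcs of [trim_rel]: by [trim_exists] a separator for them still
    meets every path from A to B, and the linkage obtained touches A and B only at the ends of its
    paths. *)
Theorem menger E A B k :
  (forall K : {set V}, #|K| < k -> exists a b,
     [/\ a \in A, b \in B, a \notin K & connect (avoid E K) a b]) ->
  exists F : seq (seq V), [/\ size F = k, uniq (flatten F) &
    forall p, p \in F -> exists a q,
      [/\ p = a :: q, a \in A, path E a q, last a q \in B &
          {in q, forall v, v \notin A} /\ {in belast a q, forall v, v \notin B}]].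
Proof.
move=> conn; pose D := [set uv | trim_rel E A B uv.1 uv.2].
have DE : arcs D =2 trim_rel E A B by move=> u v; rewrite /arcs inE.
case: (menger_arcs D A B k) => [[K /conn[a [b [aA bB aK /connectP[q aq lq]]]] sK]|].
  have [aq' nK] := avoid_path aq.
  have lB : last a q \in B by rewrite -lq.
  have [p sub ab] := trim_exists aA aq' lB.
  have /sK : abpath (arcs D) A B p.
    by case: p ab {sub} => //= c p; rewrite (eq_path DE).
  case/hasP=> v /sub vq vK; suff /negP[] : v \notin K by [].
  by move: vq; rewrite inE => /predU1P[->|/nK].
case=> F [sF uF /allP aF]; exists F; split=> // p /aF.
case: p => //= a q /and3P[aA]; rewrite (eq_path DE) => aq lB; exists a, q.
have [aq1 aq2 aq3] : [/\ path E a q, {in q, forall v, v \notin A} &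
    {in belast a q, forall v, v \notin B}].
  elim: q a aq {lB aA} => //= b q IH a /andP[/and3P[ab na nb] /IH[-> nA nB]].
  rewrite ab; split=> // v; rewrite inE; first by case/predU1P=> [->|/nA].
  by case/predU1P=> [->|/nB].
by split.
Qed.

End Menger.

(** * Connectivity of arc-transitive graphs *)

Section Atoms.

Variables (V : finType) (e : rel V) (W : {set V}) (d : nat).
Hypothesis e_sym : symmetric e.
Hypothesis W_closed : forall u v, u \in W -> e u v -> v \in W.
Hypothesis W_connected : {in W &, forall u v, connect e u v}.
Hypothesis W_degree : {in W, forall u, d <= #|[set v | e u v]|}.
Hypothesis W_arc_transitive : forall u v u' v', u \in W -> u' \in W ->
  e u v -> e u' v' -> exists phi : V -> V,
    [/\ injective phi, {in W, forall w, phi w \in W},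
        forall a b, e (phi a) (phi b) = e a b, phi u = u' & phi v = v'].

Implicit Types (A F X Y : {set V}).

Definition nbhd X : {set V} := [set v | (v \notin X) && [exists u in X, e u v]].

Definition far X : {set V} := W :\: (X :|: nbhd X).

(** [nbhd X] is then a vertex cut of W between X and [far X]; minimality of the cut is imposed only
    in [atom]. *)
Definition fragment X : bool :=
  [&& X \subset W, X != set0 & far X != set0].

Lemma nbhdP X v : reflect (v \notin X /\ exists2 u, u \in X & e u v) (v \in nbhd X).
Proof.
rewrite inE; apply: (iffP andP) => [[vX /existsP[u /andP[uX uv]]]|[vX [u uX uv]]].
  by split=> //; exists u.
by split=> //; apply/existsP; exists u; rewrite uX.
Qed.

Lemma in_far X v : (v \in far X) = [&& v \notin X, v \notin nbhd X & v \in W].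
Proof. by rewrite in_setD in_setU negb_or andbA. Qed.

Lemma nbhd_sub X : X \subset W -> nbhd X \subset W.
Proof.
by move=> XW; apply/subsetP=> v /nbhdP[_ [u /(subsetP XW) uW /(W_closed uW)]].
Qed.

Lemma nbhd_far X : X \subset W -> nbhd (far X) \subset nbhd X.
Proof.
move=> XW; apply/subsetP=> v /nbhdP[vF [u + uv]]; rewrite in_far => /and3P[uX uN uW].
move: vF; rewrite in_far (W_closed uW uv) andbT negb_and !negbK => /orP[vX|//].
by case/nbhdP: uN; split=> //; exists v; rewrite // e_sym.
Qed.

Lemma fragment_far X : fragment X -> fragment (far X).
Proof.
move=> /and3P[XW X0 F0]; rewrite /fragment F0 subsetDl /=.
case/set0Pn: X0 => x xX; apply/set0Pn; exists x.
rewrite in_far (subsetP XW) // andbT in_far xX /=.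
by apply: contraL xX => /(subsetP (nbhd_far XW)) /nbhdP[].
Qed.

Definition atom A :=
  [/\ fragment A, forall X, fragment X -> #|nbhd A| <= #|nbhd X| &
      forall X, fragment X -> #|nbhd X| = #|nbhd A| -> #|A| <= #|X|].

Lemma fragment_subset X Y : fragment X -> Y \subset X -> Y != set0 -> fragment Y.
Proof.
move=> /and3P[XW _ /set0Pn[f]]; rewrite in_far => /and3P[fX fN fW] YX Y0.
rewrite /fragment Y0 (subset_trans YX XW) /=; apply/set0Pn; exists f.
rewrite in_far fW andbT; apply/andP; split.
  by apply: contra fX => /(subsetP YX).
apply: contra fN => /nbhdP[_ [u uY uf]]; apply/nbhdP; split=> //.
by exists u => //; apply: (subsetP YX).
Qed.

(* The size of nbhd is submodular, and the far side of a fragment is at least as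
   large as an atom. *)
Lemma atom_meet A F : atom A -> atom F -> A :&: F != set0 -> A \subset F.
Proof.
move=> [fA minA smallA] [fF minF smallF] I0; apply/negPn/negP => nAF.
have NAF : #|nbhd F| = #|nbhd A| by apply/eqP; rewrite eqn_leq minF ?minA.
have fI : fragment (A :&: F) by apply: fragment_subset fA _ I0; apply: subsetIl.
(* The meet is a fragment strictly smaller than the atom A, so its boundary cannot be minimum. *)
have NI : #|nbhd A| < #|nbhd (A :&: F)|.
  rewrite ltn_neqAle minA // andbT; apply/eqP => /esym/smallA.
  move=> /(_ fI); rewrite leqNgt => /negP[]; apply: proper_card.
  by rewrite properE subsetIl subsetI subxx.
have fF' := fragment_far fF.
have farF : #|A| <= #|far F|.
  apply: smallA => //; apply/eqP; rewrite eqn_leq minA // andbT -NAF.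
  by apply: subset_leq_card; apply: nbhd_far; case/and3P: fF.
have [AW FW] : A \subset W /\ F \subset W by case/and3P: fA; case/and3P: fF.
have [NAW NFW] := (nbhd_sub AW, nbhd_sub FW).
have part X Y : X \subset W -> Y \subset W ->
    #|X| = #|X :&: Y| + #|X :&: nbhd Y| + #|X :&: far Y|.
  move=> XW YW; rewrite -(cardsID Y X) -(cardsID (nbhd Y) (X :\: Y)) addnA.
  congr (_ + _ + _); apply: eq_card => v.
    by rewrite !inE; case: (v \in Y); rewrite /= ?andbF.
  rewrite in_setD in_setD in_setI in_far.
  have := subsetP XW v; case: (v \in X) => [-> //|_]; last by rewrite !andbF.
  by rewrite !andbT andbC.
have NIsub : nbhd (A :&: F) \subset
    (A :&: nbhd F) :|: (nbhd A :&: nbhd F) :|: (nbhd A :&: F).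
  apply/subsetP=> v /nbhdP[vI [u uI uv]]; case/setIP: uI => uA uF.
  have nA : (v \in A) || (v \in nbhd A).
    by case: (boolP (v \in A)) => //= vA; apply/nbhdP; split=> //; exists u.
  have nF : (v \in F) || (v \in nbhd F).
    by case: (boolP (v \in F)) => //= vF; apply/nbhdP; split=> //; exists u.
  move: vI nA nF; rewrite !in_setU !in_setI.
  by case: (v \in A); case: (v \in F) => //= _; do 2!case: (_ \in nbhd _).
have {}NIsub : #|nbhd (A :&: F)| <=
    #|A :&: nbhd F| + #|nbhd A :&: nbhd F| + #|nbhd A :&: F|.
  apply: leq_trans (subset_leq_card NIsub) _.
  by rewrite (leq_trans (leq_card_setU _ _)) // leq_add2r leq_card_setU.
have NA := part _ _ NAW FW; have NF := part _ _ NFW AW.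
have CA := part _ _ AW FW; have CF := part _ _ (subsetDl W (F :|: nbhd F)) AW.
rewrite (setIC (nbhd F)) [nbhd F :&: nbhd A]setIC in NF.
have A_F : A :&: far F = far F :&: A by rewrite setIC.
(* If the two far sides are disjoint, [far F] lies in A and its boundary, and [NI] makes it smaller
   than A. Otherwise the union of A and F is a fragment, and submodularity with [NI] pushes its
   boundary below the minimum. *)
case: (set_0Vmem (far A :&: far F)) => [D0|[w wD]].
  rewrite -/(far F) (setIC (far F) (far A)) D0 cards0 in CF.
  rewrite [far F :&: nbhd A]setIC in CF; rewrite A_F in CA.
  have I1 : 0 < #|A :&: F| by rewrite card_gt0.
  by move: NI NIsub NA CA CF farF I1; clear; lia.
have fU : fragment (A :|: F).
  rewrite /fragment subUset AW FW /=; apply/andP; split.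
    case/set0Pn: I0 => v /setIP[vA _]; apply/set0Pn; exists v.
    by rewrite inE vA.
  apply/set0Pn; exists w; move: wD; rewrite in_setI !in_far.
  case/andP=> /and3P[wA nA wW] /and3P[wF nF _].
  rewrite wW andbT in_setU negb_or wA wF /=; apply/nbhdP=> -[_ [u /setUP[uX|uX] uw]].
    by case/nbhdP: nA; split=> //; exists u.
  by case/nbhdP: nF; split=> //; exists u.
have NUsub : nbhd (A :|: F) \subset
    (nbhd A :&: nbhd F) :|: (nbhd A :&: far F) :|: (nbhd F :&: far A).
  apply/subsetP=> v vU; have vW : v \in W.
    by apply: (subsetP (nbhd_sub _)) vU; rewrite subUset AW.
  case/nbhdP: vU => vU [u uU uv].
  have {vU} [vA vF] : v \notin A /\ v \notin F.
    by move: vU; rewrite inE negb_or => /andP.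
  have N : (v \in nbhd A) || (v \in nbhd F).
    by case/setUP: uU => uX; apply/orP; [left|right]; apply/nbhdP; split=> //; exists u.
  rewrite !in_setU !in_setI !in_far vA vF vW !andbT /=.
  by move: N; case: (v \in nbhd A); case: (v \in nbhd F).
have {}NUsub : #|nbhd (A :|: F)| <= #|nbhd A :&: nbhd F| +
    #|nbhd A :&: far F| + #|nbhd F :&: far A|.
  apply: leq_trans (subset_leq_card NUsub) _.
  by rewrite (leq_trans (leq_card_setU _ _)) // leq_add2r leq_card_setU.
by move: (minA _ fU) NUsub NI NIsub NA NF NAF; clear; lia.
Qed.

Lemma nbhd_image (phi : V -> V) X : injective phi ->
  {in W, forall w, phi w \in W} -> (forall a b, e (phi a) (phi b) = e a b) ->
  X \subset W -> nbhd (phi @: X) = phi @: nbhd X.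
Proof.
move=> inj phiW phie XW.
have onto w : w \in W -> exists2 v, v \in W & phi v = w.
  have E : phi @: W = W.
    apply/eqP; rewrite eqEcard card_imset // leqnn andbT.
    by apply/subsetP=> _ /imsetP[w' w'W ->]; apply: phiW.
  by rewrite -{1}E => /imsetP[v vW ->]; exists v.
apply/setP=> v; apply/nbhdP/imsetP=> [[vX [_ /imsetP[u uX ->] uv]]|[w /nbhdP[wX [u uX uw]] ->]].
  have [|w wW wv] := onto v; first by apply: W_closed uv; apply/phiW/(subsetP XW).
  exists w => //; apply/nbhdP; split; last by exists u; rewrite // -phie wv.
  by apply: contra vX => wX; rewrite -wv imset_f.
split; first by rewrite mem_imset.
by exists (phi u); rewrite ?imset_f // phie.
Qed.

Lemma atom_image (phi : V -> V) A : injective phi ->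
  {in W, forall w, phi w \in W} -> (forall a b, e (phi a) (phi b) = e a b) ->
  atom A -> atom (phi @: A).
Proof.
move=> inj phiW phie [fA minA smallA].
have AW : A \subset W by case/and3P: fA.
have NE := nbhd_image inj phiW phie AW.
have NC : #|nbhd (phi @: A)| = #|nbhd A| by rewrite NE card_imset.
split; last 2 first.
- by move=> X /minA; rewrite NC.
- by move=> X fX; rewrite NC card_imset //; apply: smallA.
case/and3P: fA => _ /set0Pn[a aA] /set0Pn[b]; rewrite in_far => /and3P[bA bN bW].
apply/and3P; split.
- by apply/subsetP=> _ /imsetP[w /(subsetP AW) wW ->]; apply: phiW.
- by apply/set0Pn; exists (phi a); rewrite imset_f.
- by apply/set0Pn; exists (phi b); rewrite in_far NE !mem_imset // bA bN phiW.
Qed.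

(** If the minimum boundary had fewer than d vertices, a vertex of an atom would have a neighbour
    inside the atom. This inner arc is then moved by symmetries until the atom swallows all of W. *)
Lemma fragment_nbhd X : fragment X -> d <= #|nbhd X|.
Proof.
move=> fX; rewrite leqNgt; apply/negP=> Xd.
case: (arg_minnP (fun X => #|nbhd X|) fX) => X1 fX1 min1.
have {}Xd : #|nbhd X1| < d by apply: leq_ltn_trans (min1 _ fX) Xd.
pose min_frag X := fragment X && (#|nbhd X| == #|nbhd X1|).
have P1 : min_frag X1 by rewrite /min_frag fX1 /=.
case: (arg_minnP (fun X => #|X|) P1) => A /andP[fA /eqP NA] min2.
have aA : atom A.
  split=> //; first by move=> Y /min1; rewrite NA.
  by move=> Y fY NY; apply: min2; rewrite /min_frag fY NY NA /=.
have [AW /set0Pn[u uA] /set0Pn[b]] := and3P fA.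
rewrite in_far => /and3P[bA bN bW]; have uW := subsetP AW u uA.
have [v vA uv] : exists2 v, v \in A & e u v.
  case: (boolP [exists v in A, e u v]) => [/existsP[v /andP[]]|nv]; first by exists v.
  suff: d <= #|nbhd A| by rewrite leqNgt NA Xd.
  apply: leq_trans (W_degree uW) (subset_leq_card _).
  apply/subsetP=> v; rewrite inE => uv; apply/nbhdP; split; last by exists u.
  by apply: contra nv => vA; apply/existsP; exists v; rewrite vA.
(* The symmetry taking the inner arc (u, v) to (w, w') maps A to an atom that contains w, so this
   image lies in A by [atom_meet], and w' with it. *)
have A_closed w w' : w \in A -> e w w' -> w' \in A.
  move=> wA ww'; have wW := subsetP AW w wA.
  have [phi [inj phiW phie Eu Ev]] := W_arc_transitive uW wW uv ww'.
  have aF := atom_image inj phiW phie aA.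
  have : phi @: A \subset A.
    apply: atom_meet => //; apply/set0Pn; exists w.
    by rewrite inE wA -Eu imset_f.
  by move/subsetP; apply; rewrite -Ev imset_f.
case/negP: bA {bN}.
have /connectP[p up ->] := W_connected uW bW.
elim: p u uA up {uW uv bW} => //= c p IH u uA /andP[uc cp].
exact: IH (A_closed _ _ uA uc) cp.
Qed.

(* Watkins: the images of an atom are disjoint or equal, so an arc inside an atom
   would make the atom closed under adjacency. *)
Theorem arc_transitive_connect (K : {set V}) g h : #|K| < d ->
  g \in W -> h \in W -> g \notin K -> h \notin K -> connect (avoid e K) g h.
Proof.
move=> Kd gW hW gK hK; pose X := [set v | connect (avoid e K) g v].
have XP v : v \in X -> v \in W /\ v \notin K.
  rewrite inE => /connectP[p gp ->]; have [ep nK] := avoid_path gp.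
  split; last by have := mem_last g p; rewrite inE => /predU1P[->|/nK].
  by elim: p g gW ep {gK gp nK X} => //= c p IH u uW /andP[/(W_closed uW) cW /(IH c cW)].
have NX : nbhd X \subset K.
  apply/subsetP=> v /nbhdP[vX [u uX uv]]; apply: contraR vX => vK.
  have [_ uK] := XP u uX; move: uX; rewrite !inE => gu.
  by apply: connect_trans gu (connect1 _); rewrite /avoid uv uK.
have gX : g \in X by rewrite inE connect0.
have : ~~ fragment X.
  by apply/negP=> /fragment_nbhd; rewrite leqNgt (leq_ltn_trans (subset_leq_card NX) Kd).
rewrite /fragment negb_and negb_and !negbK => /or3P[/negP[]|/eqP X0|/eqP X0].
- by apply/subsetP=> v /XP[].
- by rewrite X0 inE in gX.
have := in_set0 h; rewrite -X0 in_setD in_setU hW andbT => /negbT.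
by rewrite negbK => /orP[|/(subsetP NX)]; rewrite ?(negbTE hK) // inE.
Qed.

End Atoms.

(** * Rim graph, copies and crossings *)

Section Wheel.

Variable n : nat.
Hypothesis n3 : 2 < n.

Implicit Types (g h x y z : 'S_n.+1) (i j k : 'I_n.+1).

(* ord0 is the hub; rho rotates the rim 1, ..., n. *)
Definition rho i : 'I_n.+1 :=
  if i == ord0 then ord0 else if i == n :> nat then inord 1 else inord i.+1.

Lemma rhoE i : rho i = (if i == 0 :> nat then 0 else if i == n :> nat then 1 else i.+1) :> nat.
Proof.
rewrite /rho -val_eqE /=; case: eqP => //= i0; case: eqP => iN.
  by rewrite inordK // ltnS ltnW // ltnW.
by rewrite inordK //; have := ltn_ord i; lia.
Qed.

Lemma rho_inj : injective rho.
Proof.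
move=> i j E; apply: ord_inj; have := congr1 (@nat_of_ord _) E; rewrite !rhoE.
have := ltn_ord i; have := ltn_ord j; do !case: eqP; lia.
Qed.

Lemma rho0 : rho ord0 = ord0.
Proof. by rewrite /rho eqxx. Qed.

Lemma rho_eq0 i : (rho i == ord0) = (i == ord0).
Proof. by rewrite -{1}rho0 (inj_eq rho_inj). Qed.

Lemma ord_neq0 i : (i != ord0) = (0 < i).
Proof. by rewrite -val_eqE lt0n. Qed.

Lemma rho_neq i : i != ord0 -> rho i != i.
Proof.
by rewrite ord_neq0 -(inj_eq val_inj) /= rhoE; have := ltn_ord i; do !case: eqP; lia.
Qed.

Lemma rho2_neq i : i != ord0 -> rho (rho i) != i.
Proof.
by rewrite ord_neq0 -(inj_eq val_inj) /= !rhoE; have := ltn_ord i; do !case: eqP; lia.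
Qed.

Lemma rho3_neq i : 3 < n -> i != ord0 -> rho (rho (rho i)) != i.
Proof.
by move=> n4; rewrite ord_neq0 -(inj_eq val_inj) /= !rhoE; have := ltn_ord i; do !case: eqP; lia.
Qed.

Lemma iter_rho i k : i != ord0 -> k != ord0 -> exists m, iter m rho i = k.
Proof.
have to1 l : l != ord0 -> exists m, iter m rho l = inord 1.
  rewrite ord_neq0; have [m] := ubnP (n - l); elim: m => // m IH in l *.
  rewrite ltnS => lm l0; have ln := ltn_ord l.
  have [lN|lN] := eqVneq (val l) n.
    exists 1%N; apply: val_inj; rewrite /= rhoE lN eqxx inordK; last by lia.
    by case: eqP => //; lia.
  have rl : rho l = l.+1 :> nat by rewrite rhoE (negbTE lN); case: eqP => //; lia.
  case: (IH (rho l)); rewrite ?rl //; first by move: lN => /= /eqP; lia.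
  by move=> m' E; exists m'.+1; rewrite iterSr.
have from1 l : l != ord0 -> exists m, iter m rho (inord 1) = l.
  rewrite ord_neq0; have [m] := ubnP l; elim: m => // m IH in l *.
  rewrite ltnS => lm l0; have ln := ltn_ord l.
  case: (ltnP 1 l) => [l1|l1]; last first.
    by exists 0; apply: val_inj; rewrite /= inordK //; lia.
  have pl : (inord l.-1 : 'I_n.+1) = l.-1 :> nat by rewrite inordK //; lia.
  case: (IH (inord l.-1)); rewrite ?pl //; try by lia.
  move=> m' E; exists m'.+1; apply: val_inj; rewrite /= E rhoE pl.
  by case: eqP => [|_]; [lia | case: eqP => [|_]; lia].
case/to1=> m Em /from1[m' Em']; exists (m' + m)%N.
by rewrite iterD Em.
Qed.

(** The transposition is on the left because MathComp applies the left factor first: it exchanges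
    the values of g at two adjacent rim positions. *)
Definition rim g h : bool :=
  [exists i, (i != ord0) && (h == tperm i (rho i) * g)%g].

Lemma rimP g h : reflect (exists2 i, i != ord0 & h = (tperm i (rho i) * g)%g) (rim g h).
Proof.
apply: (iffP existsP) => [[i /andP[i0 /eqP->]]|[i i0 ->]]; first by exists i.
by exists i; rewrite i0 eqxx.
Qed.

Lemma rim_sym : symmetric rim.
Proof.
suff imp g h : rim g h -> rim h g by move=> g h; apply/idP/idP; apply: imp.
by case/rimP=> i i0 ->; apply/rimP; exists i; rewrite // mulgA tperm2 mul1g.
Qed.

Lemma rim_copy g h : rim g h -> h ord0 = g ord0.
Proof.
by case/rimP=> i i0 ->; rewrite permM tpermD // rho_eq0.
Qed.

(** Parity makes the rim graph bipartite, hence triangle-free: among three terminals in one copy two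
    are not adjacent. *)
Lemma rim_odd g h : rim g h -> odd_perm h = ~~ odd_perm g.
Proof.
by case/rimP=> i i0 ->; rewrite odd_permM odd_tperm eq_sym rho_neq.
Qed.

Lemma rim_irr : irreflexive rim.
Proof. by move=> g; case E: (rim g g) => //; move/rim_odd: E; case: (odd_perm g). Qed.

Lemma rim_mulr g h (t : 'S_n.+1) : rim (g * t)%g (h * t)%g = rim g h.
Proof.
apply/rimP/rimP=> -[i i0 E]; exists i => //; last by rewrite E mulgA.
by apply: (mulIg t); rewrite -mulgA.
Qed.

(** Otherwise rho would exchange i and k, but it has no orbit of length two on the rim. *)
Lemma tperm_rho_inj i k : i != ord0 -> k != ord0 ->
  tperm i (rho i) = tperm k (rho k) -> i = k.
Proof.
move=> i0 k0 E; have := congr1 (fun s : 'S_n.+1 => s i) E; rewrite tpermL.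
case: tpermP => [//|-> E2|_ _ E2].
  by have := rho2_neq k0; rewrite E2 eqxx.
by have := rho_neq i0; rewrite E2 eqxx.
Qed.

Lemma rim_degree g : #|[set h | rim g h]| = n.
Proof.
have -> : [set h | rim g h] = [set (tperm i (rho i) * g)%g | i in [set~ ord0]].
  apply/setP=> h; rewrite inE; apply/rimP/imsetP=> -[i i0 ->]; exists i => //.
    by rewrite !inE.
  by rewrite !inE in i0.
rewrite card_in_imset; last first.
  by move=> i k; rewrite !inE => i0 k0 /mulIg; apply: tperm_rho_inj.
by rewrite cardsC1 card_ord.
Qed.

(* Conjugation by a power of rho permutes the rim generators transitively. *)
Lemma rim_arc_transitive g h g' h' : rim g h -> rim g' h' ->
  exists phi : 'S_n.+1 -> 'S_n.+1,
    [/\ injective phi, forall w : 'S_n.+1, w ord0 = g ord0 -> phi w ord0 = g' ord0,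
        forall a b, rim (phi a) (phi b) = rim a b, phi g = g' & phi h = h'].
Proof.
case/rimP=> i i0 ->; case/rimP=> k k0 ->.
have [m Em] := iter_rho k0 i0; pose r := (perm rho_inj ^+ m)%g.
have r0 : r ord0 = ord0.
  by rewrite permX; elim: (m) => //= p ->; rewrite permE rho0.
have rE l : r l = iter m rho l.
  by rewrite permX; elim: (m) => //= p ->; rewrite permE.
have rrho l : r (rho l) = rho (r l) by rewrite !rE -iterS -iterSr.
have conj l : (tperm l (rho l) ^ r)%g = tperm (r l) (rho (r l)).
  by rewrite tpermJ rrho.
have rim_r a b : rim a b -> rim (r * a)%g (r * b)%g.
  case/rimP=> l l0 ->; have [l' El] : exists l', r l' = l.
    by exists ((r^-1)%g l); rewrite permKV.
  apply/rimP; exists l'; first by apply: contra_neq l0 => l'0; rewrite -El l'0 r0.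
  by rewrite -El -conj /conjg !mulgA mulgV mul1g.
have rim_rV a b : rim (r * a)%g (r * b)%g -> rim a b.
  case/rimP=> l l0 E; apply/rimP; exists (r l).
    by rewrite -r0 (inj_eq perm_inj).
  by apply: (mulgI r); rewrite E -conj /conjg !mulgA mulgV mul1g.
(* The left factor turns the edge i of the rim into the edge k. The right factor relabels values,
   which preserves [rim], and is chosen so that g goes to g'. *)
exists (fun w => r * w * (g^-1 * r^-1 * g'))%g; split.
- by move=> a b /mulIg/mulgI.
- move=> w w0; rewrite !permM r0 w0 permK.
  by rewrite -[X in ((r^-1)%g X)]r0 permK.
- by move=> a b; rewrite rim_mulr; apply/idP/idP; [apply: rim_rV | apply: rim_r].
- by rewrite !mulgA mulgK mulgV mul1g.
- rewrite -Em -rE -conj /conjg !mulgA mulgV mul1g mulgK.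
  by rewrite -!mulgA mulKVg.
Qed.

(** Two members of a copy differ by a left factor that fixes the hub, and the rim transpositions
    generate all such permutations: conjugation along the rim yields every transposition of rim
    positions, and these reduce the number of moved points one by one. *)
Lemma rim_connected g h : g ord0 = h ord0 -> connect rim g h.
Proof.
pose C (s : 'S_n.+1) := forall g : 'S_n.+1, connect rim g (s * g)%g.
have CM s t : C s -> C t -> C (s * t)%g.
  by move=> Cs Ct g'; rewrite -mulgA; apply: connect_trans (Ct g') (Cs _).
have C1 : C 1%g by move=> g'; rewrite mul1g.
have Crho i : i != ord0 -> C (tperm i (rho i)).
  by move=> i0 g'; apply: connect1; apply/rimP; exists i.
have Ctperm i k : i != ord0 -> k != ord0 -> C (tperm i k).
  move=> i0 k0; have [m <-] := iter_rho i0 k0; elim: m {k k0} => [|m IH].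
    by rewrite tperm1.
  have k0 : iter m rho i != ord0 by elim: (m) => //= p; rewrite rho_eq0.
  rewrite iterS; move: (iter m rho i) k0 IH => k k0 IH.
  have [->|ki] := eqVneq (rho k) i; first by rewrite tperm1.
  have [->|ki'] := eqVneq k i; first exact: Crho.
  have -> : tperm i (rho k) = (tperm k (rho k) * tperm i k * tperm k (rho k))%g.
    rewrite -{1}(tpermV k (rho k)) -mulgA -/(tperm i k ^ tperm k (rho k))%g tpermJ.
    by rewrite tpermL tpermD.
  by apply: (CM); [apply: CM IH | ]; apply: Crho.
have Cfix (s : 'S_n.+1) : s ord0 = ord0 -> C s.
  have [m] := ubnP #|[pred x : 'I_n.+1 | s x != x]|; elim: m s => // m IH s /ltnSE-sm s0.
  case: (pickP (fun x : 'I_n.+1 => s x != x)) => [x s_x | s_id]; last first.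
    suff -> : s = 1%g by [].
    by apply/permP=> x; apply/eqP/idPn; rewrite perm1 s_id.
  have x0 : x != ord0 by apply: contraNneq s_x => ->; rewrite s0.
  have Ex : s ((s^-1)%g x) = x by rewrite permKV.
  move: ((s^-1)%g x) Ex => u Eu.
  have u0 : u != ord0 by apply: contraNneq x0 => u0; rewrite -Eu u0 s0.
  rewrite -[s](mulKg (tperm x u)) tpermV; apply: CM; first exact: Ctperm.
  apply: IH; last by rewrite permM tpermD.
  rewrite (cardD1 x) !inE s_x in sm; apply: leq_trans sm.
  rewrite ltnS; apply: subset_leq_card; apply/subsetP=> y.
  rewrite !inE permM /=; case: tpermP => [->|->|/eqP yx _ sy].
  - by rewrite Eu eqxx.
  - move=> sxu; have [ux|ux] := eqVneq u x; first by rewrite -{1}ux Eu eqxx in s_x.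
    by rewrite Eu eq_sym.
  - by rewrite sy yx.
move=> gh; have := Cfix (h * g^-1)%g _ g; rewrite mulgKV; apply.
by rewrite permM -gh permK.
Qed.

Lemma CW_rim g h : rim g h -> CW n.+1 g h.
Proof.
case/rimP=> i i0 ->; apply/existsP; exists (tperm i (rho i)); rewrite eqxx andbT.
have w : wheel_pair n.+1 i.+1 (rho i).+1 || wheel_pair n.+1 (rho i).+1 i.+1.
  rewrite /wheel_pair rhoE; move: i0; rewrite ord_neq0.
  by have := ltn_ord i; do !case: eqP; lia.
case/orP: w => w; apply/imsetP; first by exists (i, rho i); rewrite ?inE.
by exists (rho i, i); rewrite ?inE // tpermC.
Qed.

(* cross j g exchanges the values j and g(hub): it is the only neighbour of g in
   the copy j (and g itself when g already lies there). *)
Definition cross j g : 'S_n.+1 := (g * tperm (g ord0) j)%g.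

Lemma cross_copy j g : cross j g ord0 = j.
Proof. by rewrite permM tpermL. Qed.

(** Conjugation by g turns the exchange of the positions hub and i into the exchange of their
    values. *)
Lemma spokeE i g : cross (g i) g = (tperm ord0 i * g)%g.
Proof. by rewrite /cross -tpermJ /conjg !mulgA mulgV mul1g. Qed.

Lemma CW_cross j g : j != g ord0 -> CW n.+1 g (cross j g).
Proof.
move=> jg; have -> : j = g ((g^-1)%g j) by rewrite permKV.
rewrite spokeE; set i := (g^-1)%g j; apply/existsP; exists (tperm ord0 i).
rewrite eqxx andbT; apply/imsetP; exists (ord0, i) => //.
rewrite inE /wheel_pair /=.
have : i != ord0 by apply: contraNneq jg => <-; rewrite permKV.
by rewrite ord_neq0; lia.
Qed.

Lemma CW_inv g h : CW n.+1 g h ->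
  rim g h \/ exists2 i, i != ord0 & h = (tperm ord0 i * g)%g.
Proof.
case/existsP=> s /andP[/imsetP[[i j]]]; rewrite inE /wheel_pair /= => w -> /eqP ->.
rewrite /pmul; have [i0|i0] := posnP i.
  right; exists j; first by rewrite ord_neq0; move: w; rewrite i0; lia.
  by congr (tperm _ _ * _)%g; apply: ord_inj.
left; have [j0 E] : j != ord0 /\ (j = rho i \/ i = rho j).
  rewrite ord_neq0; split; first by move: w; lia.
  have := ltn_ord i; have := ltn_ord j; move=> jn iN.
  case/or3P: w => [|/andP[_ /eqP[ji]]|/andP[/eqP[i1] /eqP[jN]]]; first by lia.
    by left; apply: ord_inj; rewrite rhoE; do !case: eqP; lia.
  by right; apply: ord_inj; rewrite rhoE; do !case: eqP; lia.
have i0' : i != ord0 by rewrite ord_neq0.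
by case: E => ->; apply/rimP; [exists i | exists j; rewrite // tpermC].
Qed.

Lemma cross_inj j g h : g ord0 = h ord0 -> cross j g = cross j h -> g = h.
Proof. by rewrite /cross => ->; apply: mulIg. Qed.

Lemma cross_rim j g h : rim g h -> rim (cross j g) (cross j h).
Proof. by move=> gh; rewrite /cross (rim_copy gh) rim_mulr. Qed.

Lemma crossK j g : cross (g ord0) (cross j g) = g.
Proof. by rewrite {1}/cross cross_copy /cross tpermC -mulgA tperm2 mulg1. Qed.

Definition copy j : {set 'S_n.+1} := [set g : 'S_n.+1 | g ord0 == j].

Lemma rim_connect j (K : {set 'S_n.+1}) g h : #|K| < n ->
  g \in copy j -> h \in copy j -> g \notin K -> h \notin K ->
  connect (avoid rim K) g h.
Proof.
apply: arc_transitive_connect.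
- exact: rim_sym.
- by move=> u v; rewrite !inE => /eqP <- /rim_copy ->.
- by move=> u v; rewrite !inE => /eqP <- /eqP uv; apply: rim_connected.
- by move=> u _; rewrite rim_degree.
move=> u v u' v'; rewrite !inE => /eqP uj /eqP u'j uv uv'.
have [phi [inj phi0 phie Eu Ev]] := rim_arc_transitive uv uv'.
by exists phi; split=> // w; rewrite !inE => /eqP wj; rewrite phi0 ?u'j ?uj.
Qed.

End Wheel.

Lemma card_notin (T : finType) (A K : {set T}) :
  #|K| < #|A| -> exists2 a, a \in A & a \notin K.
Proof.
move=> KA; have /subsetPn[a aA aK] : ~~ (A \subset K); last by exists a.
by apply: contraL KA => /subset_leq_card; rewrite -leqNgt.
Qed.

(** * Disjoint paths and fans inside one copy *)

Section Links.

Variable n : nat.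
Hypothesis n3 : 2 < n.

Implicit Types (g h x y z : 'S_n.+1) (i j k : 'I_n.+1).
Implicit Types (A B K Z X S : {set 'S_n.+1}).

Definition rimN g : {set 'S_n.+1} := [set h | rim g h].

Lemma in_rimN g h : (h \in rimN g) = rim g h.
Proof. exact: in_set. Qed.

Lemma rim_path_copy j a q : a \in copy j -> path (@rim n) a q ->
  {subset a :: q <= copy j}.
Proof.
elim: q a => [|b q IH] a aj /= => [_ v|/andP[ab bq] v].
  by rewrite inE => /eqP->.
rewrite inE => /predU1P[->//|]; apply: IH bq _ => //.
by move: aj; rewrite !inE => /eqP <-; rewrite (rim_copy n3 ab).
Qed.

(** Removing Z costs at most [#|Z|] of the n-connectivity of the copy, so Menger's theorem still
    provides k paths. *)
Lemma link j Z A B (k : nat) : A \subset copy j -> B \subset copy j ->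
  [disjoint A & Z] -> [disjoint B & Z] -> k <= #|A| -> k <= #|B| ->
  k + #|Z| <= n ->
  exists F : seq (seq 'S_n.+1), [/\ size F = k, uniq (flatten F) &
    forall p, p \in F -> exists a q,
      [/\ p = a :: q, a \in A, path (@rim n) a q, last a q \in B &
      [/\ {in q, forall v, v \notin A}, {in belast a q, forall v, v \notin B} &
          {in p, forall v, (v \in copy j) && (v \notin Z)}]]].
Proof.
move=> /subsetP Aj /subsetP Bj AZ BZ kA kB kZ.
have [K Kk|F [sF uF FP]] := @menger _ (avoid (@rim n) Z) A B k.
  have [a aA aK] := card_notin (leq_trans Kk kA).
  have [b bB bK] := card_notin (leq_trans Kk kB).
  exists a, b; split=> //.
  have KZ : #|K :|: Z| < n.
    by apply: leq_ltn_trans (leq_card_setU _ _) _; apply: leq_trans kZ; rewrite ltn_add2r.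
  have := rim_connect n3 KZ (Aj a aA) (Bj b bB).
  rewrite !inE (negbTE aK) (negbTE bK) /= (disjointFr AZ aA) (disjointFr BZ bB).
  move=> /(_ isT isT); apply: connect_sub => u v /and3P[uv].
  rewrite !inE !negb_or => /andP[uK uZ] /andP[vK vZ].
  by apply: connect1; rewrite /avoid uv uK uZ vK vZ.
exists F; split=> // p /FP[a [q [Ep aA aq lB [nA nB]]]].
have [rq nZ] := avoid_path aq; exists a, q; split=> //; split=> //.
rewrite Ep => v vq; rewrite (rim_path_copy (Aj a aA) rq vq).
by move: vq; rewrite inE => /predU1P[->|/nZ ->//]; rewrite (disjointFr AZ).
Qed.

(** The fan stops next to X and not in X, because a terminal in X is the end of several of its
    paths. *)
Definition fan_target y X : {set 'S_n.+1} :=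
  [set v | [exists x in X, rim x v]] :\: (y |: X).

Lemma fan_targetP y X v :
  reflect (v \notin y |: X /\ exists2 x, x \in X & rim x v) (v \in fan_target y X).
Proof.
rewrite in_setD [v \in [set _ | _]]inE; apply: (iffP andP) => -[vX].
  by case/existsP=> x /andP[xX xv]; split=> //; exists x.
by case=> x xX xv; split=> //; apply/existsP; exists x; rewrite xX.
Qed.

(** Of the n neighbours of y, those in X cannot start a path of the fan; they correspond to direct
    edges, which account for the subtraction. *)
Lemma fan j y X : y \in copy j -> X \subset copy j -> y \notin X -> X != set0 ->
  {in X &, forall u v, ~~ rim u v} ->
  exists F : seq (seq 'S_n.+1),
  [/\ size F = n - #|rimN y :&: X|, uniq (flatten F) &
    forall p, p \in F -> exists a q,
      [/\ p = a :: q, rim y a, path (@rim n) a q, last a q \in fan_target y X &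
      {in belast a q, forall v, v \notin fan_target y X} /\
          {in p, forall v, (v \in copy j) && (v \notin y |: X)}]].
Proof.
move=> yj /subsetP Xj yX X0 indX; set k := n - _.
have [K Kk|F [sF uF FP]] :=
  @menger _ (avoid (@rim n) (y |: X)) (rimN y :\: X) (fan_target y X) k; last first.
  exists F; split=> // p /FP[a [q [Ep aA aq lB [_ nB]]]].
  move: aA; rewrite inE => /andP[aX]; rewrite inE => ya.
  have [rq nZ] := avoid_path aq; exists a, q; split=> //; split=> //.
  have aj : a \in copy j by move: yj; rewrite !inE => /eqP <-; rewrite (rim_copy n3 ya).
  rewrite Ep => v vq; rewrite (rim_path_copy aj rq vq) /=.
  move: vq; rewrite inE => /predU1P[->|/nZ ->//].
  rewrite !inE negb_or aX andbT; apply: contraTneq ya => ->.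
  by rewrite (rim_irr n3).
(* Besides K, the edges from y to X are blocked, by deleting their ends in X. The subtraction in k
   leaves room for this below n. *)
pose K' := (K :\: (y |: X)) :|: (rimN y :&: X).
have K'n : #|K'| < n.
  apply: leq_ltn_trans (leq_card_setU _ _) _.
  move: Kk; rewrite /k ltn_subRL addnC; apply: leq_ltn_trans.
  by rewrite leq_add2r subset_leq_card ?subsetDl.
have yK' : y \notin K' by rewrite !inE eqxx (negbTE yX) !andbF.
suff [a [q [ya aq lq nX]]] : exists a q, [/\ rim y a, path (avoid (@rim n) K') a q,
    last a q \in fan_target y X & {in a :: q, forall v, v \notin K' /\ v \notin y |: X}].
  have nK v : v \in a :: q -> v \notin K.
    by move=> /nX[]; rewrite in_setU in_setD => + vX; rewrite vX negb_or => /andP[].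
  exists a, (last a q); split=> //.
  - rewrite inE [a \in rimN y]inE ya andbT.
    by have [_] := nX a (mem_head _ _); rewrite inE negb_or => /andP[].
  - by apply: nK; rewrite mem_head.
  apply/connectP; exists q => //; pose P := [pred v | (v \notin K) && (v \notin y |: X)].
  apply: (@sub_in_path _ P (avoid (@rim n) K')) aq.
    move=> u v /andP[uK uX] /andP[vK vX] /and3P[uv _ _].
    by rewrite /avoid uv uK uX vK vX.
  by apply/allP=> v vq; rewrite /= nK // ; case: (nX v vq).
(* If all of X is adjacent to y, then X is deleted altogether and the walk aims at a neighbour s of
   X outside K, found by counting degrees. *)
case: (boolP (X \subset rimN y)) => [Xy|/subsetPn[x xX xy]].
  have EX : rimN y :&: X = X by apply/setIidPr.
  have [x xX] := set0Pn _ X0.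
  have [s sS sK] : exists2 s, s \in fan_target y X & s \notin K.
    apply: card_notin; apply: leq_trans Kk _; rewrite /k EX.
    apply: (@leq_trans #|rimN x :\ y|).
      have dx : #|rimN x| = n by apply: rim_degree.
      have X1 : 0 < #|X| by rewrite card_gt0.
      have := cardsD1 y (rimN x); rewrite dx; move: X1.
      by move: #|X| #|rimN x :\ y| => c1 c2; case: (y \in _) => /=; lia.
    apply: subset_leq_card; apply/subsetP=> v.
    rewrite in_setD1 [v \in rimN x]inE => /andP[vy xv].
    apply/fan_targetP; split; last by exists x.
    rewrite !inE negb_or vy /=.
    by apply: contraL xv => vX; apply: indX.
  have sj : s \in copy j.
    case/fan_targetP: sS => _ [x' /Xj].
    by rewrite !inE => /eqP <- /(rim_copy n3) ->.
  have sX : s \notin y |: X by case/fan_targetP: sS.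
  have sK' : s \notin K'.
    rewrite in_setU in_setD (negbTE sK) andbF EX /=.
    by move: sX; rewrite inE negb_or => /andP[].
  have /connectP[p0 yp0 ls0] := rim_connect n3 K'n yj sj yK' sK'.
  case/shortenP: yp0 ls0 => p yp up _ lp {p0}.
  case: p yp up lp => [_ _ sy|a q /= /andP[/and3P[ya _ aK'] aq] /andP[yq _] lq].
    by rewrite sy !inE eqxx in sX.
  exists a, q; split=> //; first by rewrite -lq.
  have [rq nK'] := avoid_path aq.
  move=> v vq; have vK' : v \notin K' by move: vq; rewrite inE => /predU1P[->|/nK'].
  split=> //; rewrite inE negb_or inE; apply/andP; split.
    by apply: contraNneq yq => <-.
  by apply: contra vK' => vX; rewrite in_setU EX vX orbT.
(* Otherwise walk from y to an x of X not adjacent to y and stop just before the first vertex in X.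
   That vertex is not the first one after y, since those neighbours of y are deleted. *)
have xK' : x \notin K' by rewrite !inE xX orbT /= (negbTE (_ : ~~ rim y x)) //; move: xy; rewrite inE.
have /connectP[p0 yp0 ls0] := rim_connect n3 K'n yj (Xj x xX) yK' xK'.
case/shortenP: yp0 ls0 => p yp up _ lp {p0}.
have [p1 [p2 [Ep lX nX]]] : exists p1 p2,
    [/\ p = p1 ++ p2, last y p1 \in X & {in belast y p1, forall v, v \notin X}].
  by apply: first_hit; apply/hasP; exists x => //; rewrite lp mem_last.
move: yp up; rewrite Ep cat_path => /andP[yp1 _] /= /andP[yp _].
have {yp} yp1' : y \notin p1 by move: yp; rewrite mem_cat negb_or => /andP[].
case/lastP: p1 lX nX yp1 yp1' {Ep} => [/= yX'|p1 x' lX nX yp1 yp1'].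
  by rewrite yX' in yX.
rewrite last_rcons in lX; rewrite belast_rcons in nX.
case: p1 nX yp1 yp1' => [_ /= /andP[/and3P[yx' _ x'K'] _] _|a q nX].
  by case/negP: x'K'; rewrite in_setU in_setI lX [_ \in rimN y]inE yx' orbT.
rewrite rcons_path /= => /andP[/andP[/and3P[ya _ aK'] aq] /and3P[bx bK' x'K']] yp1.
have [rq nK'] := avoid_path aq; exists a, q.
have nXq : {in a :: q, forall v, v \notin K' /\ v \notin y |: X}.
  move=> v vq; split; first by move: vq; rewrite inE => /predU1P[->|/nK'].
  rewrite inE negb_or inE nX ?andbT; last by rewrite inE vq orbT.
  by apply: contraNneq yp1 => <-; rewrite -rcons_cons mem_rcons inE vq orbT.
split=> //; apply/fan_targetP; have [_ bX] := nXq _ (mem_last a q).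
by split=> //; exists x'; rewrite // rim_sym.
Qed.

End Links.

(** * From systems of paths to Omega-paths *)

Section Systems.

Variables (V : finType) (e : rel V).
Hypothesis e_sym : symmetric e.

Implicit Types (I P Q T : seq V) (E Om R : {set V}).
Implicit Types (L : seq (V * seq V)).

Lemma pi_omega_ge Om (F : seq (seq V)) : uniq F -> all (omega_path e Om) F ->
  {in F &, forall P Q, P != Q -> int_disjoint Om P Q} -> size F <= pi_omega e Om.
Proof.
move=> uF /allP oF dF; pose ib (P : seq V) : #|V|.-bseq V := insub_bseq #|V| P.
have bE P : P \in F -> ib P = P :> seq V.
  move=> /oF /andP[/andP[_ uP] _].
  have sP : size P <= #|V| by rewrite -(card_uniqP uP) max_card.
  by rewrite /ib /insub_bseq insubdK.
have inj : {in F &, injective ib}.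
  by move=> P Q PF QF /(congr1 (@bseqval _ _)); rewrite !bE.
pose G := [set b in map ib F].
have GF b : b \in G -> (b : seq V) \in F.
  by rewrite inE => /mapP[P PF ->]; rewrite bE.
have -> : size F = #|G|.
  rewrite cardsE -(size_map ib); apply/esym/card_uniqP.
  by rewrite map_inj_in_uniq.
apply: leq_bigmax_cond; apply/andP; split.
  by apply/forallP=> b; apply/implyP=> /GF/oF.
apply/forallP=> b; apply/implyP=> /GF bF; apply/forallP=> c; apply/implyP=> /GF cF.
by apply/implyP=> bc; apply: dF.
Qed.

Lemma pedges_cons (u v : V) s E :
  (E \in pedges (u :: v :: s)) = (E == [set u; v]) || (E \in pedges (v :: s)).
Proof.
apply/imsetP/orP=> [[[a b]]|].
  rewrite /= inE => /predU1P[[-> ->] ->|ab ->]; first by left.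
  by right; apply/imsetP; exists (a, b).
case=> [/eqP->|/imsetP[ab abs ->]]; first by exists (u, v); rewrite //= mem_head.
by exists ab; rewrite //= inE abs orbT.
Qed.

Lemma pedges_sub E P : E \in pedges P -> E \subset pverts P.
Proof.
case: P => [|u s]; first by case/imsetP.
elim: s u => [|v s IH] u; first by case/imsetP.
rewrite pedges_cons => /predU1P[->|/IH sub].
  by apply/subsetP=> w; rewrite !inE => /orP[]/eqP->; rewrite eqxx ?orbT.
apply: subset_trans sub _; apply/subsetP=> w; rewrite !inE => ->.
by rewrite orbT.
Qed.

Lemma pedges_interior Om I (w : V) s E : {in I, forall v, v \notin Om} -> E \subset Om ->
  E \in pedges (I ++ w :: s) -> E \in pedges (w :: s).
Proof.
move=> IO EO; elim: I IO => //= u I IH IO.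
have uE : u \notin E by apply: contra (IO u (mem_head _ _)) => /(subsetP EO).
have {}IH := IH (fun v vI => IO v (mem_behead (s := u :: I) vI)).
case: I IH {IO} => [|v I] IH /=; rewrite pedges_cons => /predU1P[EE|/IH //];
  by rewrite EE !inE eqxx in uE.
Qed.

(** An edge inside Om avoids the interior vertices, so the segment from u to w has such an edge only
    when its interior is empty. *)
Lemma pedges_link Om (u : V) I w s E : {in I, forall v, v \notin Om} -> E \subset Om ->
  E \in pedges (u :: I ++ w :: s) -> (I = [::] /\ E = [set u; w]) \/ E \in pedges (w :: s).
Proof.
case: I => [|v I] IO EO /=; rewrite pedges_cons => /predU1P[EE|]; auto.
  have vE : v \in E by rewrite EE !inE eqxx orbT.
  by have := IO v (mem_head _ _); rewrite (subsetP EO).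
by move=> H; right; apply: (@pedges_interior Om (v :: I)).
Qed.

Lemma path_rev a I b : path e a (rcons I b) -> path e b (rcons (rev I) a).
Proof.
have := rev_path e a (rcons I b); rewrite last_rcons belast_rcons rev_cons => ->.
by rewrite (eq_path (e' := e)) // => u v; apply: e_sym.
Qed.

(* An item (c, I) stands for a path with interior I between the two terminals
   other than c.  The footprint of a direct edge is the third terminal c, so that
   disjoint footprints also make the edges disjoint. *)
Definition footprint (it : V * seq V) : seq V := if nilp it.2 then [:: it.1] else it.2.

Definition is_item T (it : V * seq V) : Prop := exists a b,
  [/\ perm_eq [:: it.1; a; b] T, path e a (rcons it.2 b) &
      {in it.2, forall v, v \notin T}].

Definition count_type c (L : seq (V * seq V)) : nat := count (fun it => it.1 == c) L.

(** R is any region containing the footprints; systems over disjoint regions can be concatenated. *)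
Definition tsystem T (R : {set V}) (L : seq (V * seq V)) : Prop :=
  [/\ {in L, forall it, is_item T it}, uniq (flatten (map footprint L)) &
      {subset flatten (map footprint L) <= R}].

Lemma tsystem_cat T (R1 R2 : {set V}) L1 L2 : [disjoint R1 & R2] ->
  tsystem T R1 L1 -> tsystem T R2 L2 -> tsystem T (R1 :|: R2) (L1 ++ L2).
Proof.
move=> dR [i1 u1 s1] [i2 u2 s2]; split.
- by move=> it; rewrite mem_cat => /orP[/i1|/i2].
- rewrite map_cat flatten_cat cat_uniq u1 u2 andbT; apply/hasPn=> v /s2 v2.
  by apply/negP=> /s1; rewrite (disjointFl dR).
- move=> v; rewrite map_cat flatten_cat mem_cat inE => /orP[/s1|/s2] ->//.
  by rewrite orbT.
Qed.

Lemma count_type_cat c L1 L2 :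
  count_type c (L1 ++ L2) = count_type c L1 + count_type c L2.
Proof. exact: count_cat. Qed.

Lemma take_item c (L : seq (V * seq V)) : 0 < count_type c L ->
  exists I L', perm_eq L ((c, I) :: L').
Proof.
rewrite -has_count => /hasP[[c' I] itL /= /eqP cE]; rewrite cE in itL.
by exists I, (rem (c, I) L); apply: perm_to_rem.
Qed.

(** The second component covers what the path uses up: its vertices outside T and, for each edge
    inside T, the terminal opposite to that edge. *)
Definition omega_item T (PS : seq V * seq V) : Prop :=
  [/\ omega_path e [set v in T] PS.1, 1 < size PS.1,
      {in PS.1, forall v, v \notin T -> v \in PS.2} &
      forall E, E \in pedges PS.1 -> E \subset [set v in T] ->
        exists2 t, t \in PS.2 & t \in T /\ E = [set v in T] :\ t].

Lemma item_ends T c I m c2 : uniq T -> perm_eq [:: c; m; c2] T ->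
  is_item T (c, I) -> exists2 J, path e m (rcons J c2) &
    J =i I /\ (uniq I -> uniq J) /\ nilp I = nilp J.
Proof.
move=> uT pT [a [b [/= pab abI _]]].
have : perm_eq [:: a; b] [:: m; c2].
  by rewrite -(perm_cons c) (perm_trans pab) // perm_sym.
have uab : uniq [:: a; b] by move: uT; rewrite -(perm_uniq pab) /= => /andP[].
move=> H; have : (a == m) && (b == c2) || (a == c2) && (b == m).
  have := perm_mem H a; have := perm_mem H b; move: uab.
  rewrite /= !inE !eqxx orbT andbT /= => ab /esym/orP[]/eqP Eb /esym/orP[]/eqP Ea.
  - by rewrite Ea Eb eqxx in ab.
  - by rewrite Ea Eb !eqxx orbT.
  - by rewrite Ea Eb !eqxx.
  - by rewrite Ea Eb eqxx in ab.
case/orP=> /andP[/eqP<- /eqP<-]; first by exists I.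
exists (rev I); first exact: path_rev.
split; first by move=> v; rewrite mem_rev.
by rewrite rev_uniq /nilp size_rev.
Qed.

(** With m the remaining terminal, an item of type c1 joins m to c2 and an item of type c2 joins m
    to c1; the two are glued at m. *)
Lemma omega_pair T c1 I1 c2 I2 : uniq T -> size T = 3 -> c1 != c2 ->
  is_item T (c1, I1) -> is_item T (c2, I2) ->
  uniq (footprint (c1, I1) ++ footprint (c2, I2)) ->
  exists P, omega_item T (P, footprint (c1, I1) ++ footprint (c2, I2)).
Proof.
move=> uT sT c12 it1 it2 uS.
have [c1T c2T] : c1 \in T /\ c2 \in T.
  case: it1 it2 => [a [b [/= p1 _ _]]] [a' [b' [/= p2 _ _]]].
  by rewrite -(perm_mem p1) -(perm_mem p2) !mem_head.
have [m pT] : exists m, perm_eq [:: c1; m; c2] T.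
  case: it1 => a [b [/= p1 _ _]]; have := c2T.
  rewrite -(perm_mem p1) !inE eq_sym (negbTE c12) /= => /orP[]/eqP->.
    exists b; rewrite (perm_trans _ p1) // perm_cons -[[:: b; a]]/([:: b] ++ [:: a]).
    by rewrite perm_catC.
  by exists a.
have [O1 O2] : {in I1, forall v, v \notin T} /\ {in I2, forall v, v \notin T}.
  by case: it1 it2 => [? [? [_ _ o1]]] [? [? [_ _ o2]]].
have pT' : perm_eq [:: c2; c1; m] T.
  by rewrite (perm_trans _ pT) // -[[:: c2; _; _]]/([:: c2] ++ _) perm_catC.
have [J2 pJ2 [JI2 [uJ2 nJ2]]] := item_ends uT pT' it2.
have [J1 pJ1 [JI1 [uJ1 nJ1]]] := item_ends uT pT it1.
have supI c I v : v \in I -> v \in footprint (c, I) by rewrite /footprint /=; case: I.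
have [u1 u2 d12] : [/\ uniq I1, uniq I2 & {in I1, forall v, v \notin I2}].
  move: uS; rewrite cat_uniq => /and3P[s1 /hasPn d s2]; split.
  - by move: s1; rewrite /footprint /=; case: (I1).
  - by move: s2; rewrite /footprint /=; case: (I2).
  - by move=> v /(supI c1) v1; apply/negP=> /(supI c2) /d; rewrite v1.
have uTT : uniq [:: c1; m; c2] by rewrite (perm_uniq pT).
have [c1m _ mc2] : [/\ c1 != m, c1 != c2 & m != c2].
  by move: uTT; rewrite /= !inE negb_or andbT => /andP[/andP[-> ->] ->].
have memT v : (v \in T) = (v \in [:: c1; m; c2]) by rewrite (perm_mem pT).
pose P := c1 :: J2 ++ m :: rcons J1 c2; exists P; split=> /=.
- apply/andP; split; last first.
    by apply/subsetP=> v; rewrite !inE memT !inE mem_cat inE mem_rcons inE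
      => /or3P[]->; rewrite ?orbT.
  apply/andP; split.
    by rewrite /= -cat_rcons cat_path pJ2 last_rcons.
  have pP : perm_eq P ([:: c1; m; c2] ++ J2 ++ J1).
    rewrite /= perm_cons -cat1s perm_catCA /= perm_cons -cats1 catA.
    by rewrite perm_catC.
  rewrite (perm_uniq pP) cat_uniq uTT /= cat_uniq uJ2 ?uJ1 //= andbT.
  apply/andP; split; apply/hasPn=> v.
    rewrite mem_cat JI1 JI2 => /orP[/O2|/O1]; by rewrite memT.
  by rewrite JI1 /= JI2 => /d12.
- by rewrite size_cat /= size_rcons !addnS.
- move=> v; rewrite inE mem_cat inE mem_rcons inE mem_cat memT !inE JI1 JI2.
  case/or3P=> [->//|/(supI c2)->|]; first by rewrite orbT.
  by case/or3P=> [->|->|/(supI c1)->]; rewrite ?orbT.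
move=> E; set Om := [set v in T] => EP EO.
have [oJ1 oJ2] : {in J1, forall v, v \notin Om} /\ {in J2, forall v, v \notin Om}.
  by split=> v; rewrite ?JI1 ?JI2 inE; [apply: O1 | apply: O2].
case: (pedges_link oJ2 EO EP) => [[J20 ->]|].
  exists c2; first by rewrite mem_cat /footprint /= nJ2 J20 mem_head orbT.
  split=> //; apply/setP=> v; rewrite !inE memT !inE.
  have [->|_] := eqVneq v c2; last by rewrite orbF.
  by rewrite ![c2 == _]eq_sym (negbTE c12) (negbTE mc2).
rewrite -cats1 => /(pedges_link oJ1 EO)[[J10 ->]|/imsetP[]//].
exists c1; first by rewrite mem_cat /footprint /= nJ1 J10 mem_head.
split=> //; apply/setP=> v; rewrite !inE memT !inE.
have [->|_] := eqVneq v c1; last by [].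
by rewrite (negbTE c12) (negbTE c1m).
Qed.

(** A shared edge would join two shared vertices, hence two terminals, and the terminal opposite to
    it would lie in both S and S'. *)
Lemma omega_disjoint T P S P' S' : omega_item T (P, S) -> omega_item T (P', S') ->
  {in S, forall v, v \notin S'} -> int_disjoint [set v in T] P P'.
Proof.
move=> [/= /andP[_ oP] _ iP eP] [/= /andP[_ oP'] _ iP' eP'] dS.
have EV : pverts P :&: pverts P' = [set v in T].
  apply/eqP; rewrite eqEsubset subsetI oP oP' !andbT.
  apply/subsetP=> v; rewrite !inE => /andP[vP vP']; apply/negPn/negP=> vT.
  by have /dS/negP[] := iP v vP vT; apply: iP'.
rewrite /int_disjoint EV eqxx /= disjoint_subset; apply/subsetP=> E EP.
apply/negP=> EP'; have EO : E \subset [set v in T].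
  by rewrite -EV subsetI !pedges_sub.
have [t tS [tT Et]] := eP E EP EO; have [t' tS' [tT' Et']] := eP' E EP' EO.
suff tt' : t = t' by have := dS t tS; rewrite tt' tS'.
apply/eqP/negPn/negP=> tt'; have : t \in [set v in T] :\ t' by rewrite !inE tt' tT.
by rewrite -Et' Et !inE eqxx.
Qed.

Definition omega_items T L k : Prop := exists PS : seq (seq V * seq V),
  [/\ size PS = k, {in PS, forall ps, omega_item T ps},
      uniq (flatten (map snd PS)) &
      {subset flatten (map snd PS) <= flatten (map footprint L)}].

Lemma omega_items_step T L c1 c2 k : uniq T -> size T = 3 -> c1 != c2 ->
  {in L, forall it, is_item T it} -> uniq (flatten (map footprint L)) ->
  0 < count_type c1 L -> 0 < count_type c2 L ->
  (forall L', {in L', forall it, is_item T it} -> uniq (flatten (map footprint L')) ->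
    (forall c, count_type c L = (c1 == c) + (c2 == c) + count_type c L') ->
    omega_items T L' k) ->
  omega_items T L k.+1.
Proof.
move=> uT sT c12 iL uL n1 n2 IH.
have [I1 [L1 p1]] := take_item n1.
have n2' : 0 < count_type c2 L1.
  move: n2; rewrite /count_type (seq.permP p1) /= (negbTE c12); exact.
have [I2 [L2 p2]] := take_item n2'.
have pL : perm_eq L ((c1, I1) :: (c2, I2) :: L2) by rewrite (perm_trans p1) ?perm_cons.
have pS := perm_flatten (perm_map footprint pL).
have iL' it : it \in (c1, I1) :: (c2, I2) :: L2 -> is_item T it.
  by rewrite -(perm_mem pL); apply: iL.
have : uniq (flatten (map footprint ((c1, I1) :: (c2, I2) :: L2))) by rewrite -(perm_uniq pS).
rewrite /= catA cat_uniq => /and3P[u12 /hasPn d12 u2].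
have [] := IH L2 _ u2.
- by move=> it itL; apply: iL'; rewrite !inE itL !orbT.
- by move=> c; rewrite /count_type (seq.permP pL) /= addnA.
move=> PS [sPS iPS uPS subPS].
have [P oP] : exists P, omega_item T (P, footprint (c1, I1) ++ footprint (c2, I2)).
  by apply: omega_pair => //; apply: iL'; rewrite !inE eqxx ?orbT.
exists ((P, footprint (c1, I1) ++ footprint (c2, I2)) :: PS); split=> /=.
- by rewrite sPS.
- by move=> ps; rewrite inE => /predU1P[->|/iPS].
- rewrite cat_uniq u12 uPS andbT; apply/hasPn=> v /subPS; exact: d12.
- move=> v; rewrite (perm_mem pS) /= catA mem_cat [in X in _ -> X]mem_cat.
  by case/orP=> [->|/subPS->]; rewrite ?orbT.
Qed.

(* a, b, c count the Omega-paths whose middle terminal is x, y, z. *)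
Lemma omega_itemsE x y z a b c L : uniq [:: x; y; z] ->
  {in L, forall it, is_item [:: x; y; z] it} -> uniq (flatten (map footprint L)) ->
  a + b <= count_type z L -> a + c <= count_type y L -> b + c <= count_type x L ->
  omega_items [:: x; y; z] L (a + b + c).
Proof.
move=> uT; have [xy xz yz] : [/\ x != y, x != z & y != z].
  by move: uT; rewrite /= !inE negb_or andbT => /andP[/andP[-> ->] ->].
have [yx zx zy] : [/\ y != x, z != x & z != y] by split; rewrite eq_sym.
have neq := (negbTE xy, negbTE xz, negbTE yz, negbTE yx, negbTE zx, negbTE zy).
elim: a L => [|a IHa] L iL uL; last first.
  move=> nz ny nx; rewrite 2!addSn; apply: (omega_items_step (c1 := z) (c2 := y)) => //.
  - by apply: leq_trans nz.
  - by apply: leq_trans ny.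
  move=> L' iL' uL' cE; move: nz ny nx; rewrite !cE !eqxx !neq => nz ny nx.
  by apply: IHa => //; lia.
rewrite !add0n; elim: b L iL uL => [|b IHb] L iL uL; last first.
  move=> nz ny nx; rewrite addSn; apply: (omega_items_step (c1 := z) (c2 := x)) => //.
  - by apply: leq_trans nz.
  - by apply: leq_trans nx.
  move=> L' iL' uL' cE; move: nz ny nx; rewrite !cE !eqxx !neq => nz ny nx.
  by apply: IHb => //; lia.
rewrite add0n; elim: c L iL uL => [|c IHc] L iL uL; last first.
  move=> nz ny nx; apply: (omega_items_step (c1 := y) (c2 := x)) => //.
  - by apply: leq_trans ny.
  - by apply: leq_trans nx.
  move=> L' iL' uL' cE; move: nz ny nx; rewrite !cE !eqxx !neq => nz ny nx.
  by apply: IHc => //; lia.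
by move=> _ _ _; exists [::].
Qed.

(** Every Omega-path consumes two items of different types, so no type is consumed more than m
    times. The four inequalities say that 2m items remain when each type is capped at m. *)
Theorem tsystem_pi_omega x y z R L m : uniq [:: x; y; z] ->
  tsystem [:: x; y; z] R L ->
  2 * m <= count_type x L + count_type y L + count_type z L ->
  m <= count_type x L + count_type y L -> m <= count_type x L + count_type z L ->
  m <= count_type y L + count_type z L -> m <= pi_omega e [set x; y; z].
Proof.
move=> uT [iL uL _] H1 H2 H3 H4.
(* An Omega-path with middle terminal y is the only kind that uses no item of type y, so at least
   [m - count_type y L] paths are of this kind. Both b and c take their least values and a takes the
   rest. *)
pose b := m - count_type y L; pose c := m - count_type z L; pose a := m - b - c.
have [] := @omega_itemsE x y z a b c L uT iL uL; try by rewrite /a /b /c; lia.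
move=> PS [sPS iPS uPS _].
have -> : m = size (map fst PS) by rewrite size_map sPS /a /b /c; lia.
have -> : [set x; y; z] = [set v in [:: x; y; z]].
  by apply/setP=> v; rewrite !inE orbA.
have [uP dP] : uniq (map fst PS) /\ {in map fst PS &, forall P Q, P != Q ->
    int_disjoint [set v in [:: x; y; z]] P Q}.
  elim: PS iPS uPS {sPS} => //= -[P S] PS IH iPS.
  rewrite cat_uniq => /and3P[_ /hasPn dS uPS].
  have iPS' : {in PS, forall ps, omega_item [:: x; y; z] ps}.
    by move=> ps psPS; apply: iPS; rewrite inE psPS orbT.
  have [uP dP] := IH iPS' uPS.
  have iP : omega_item [:: x; y; z] (P, S) by apply: iPS; rewrite mem_head.
  have dPQ Q : Q \in map fst PS -> int_disjoint [set v in [:: x; y; z]] P Q.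
    case/mapP=> -[Q' S'] QS ->; apply: omega_disjoint iP (iPS' _ QS) _ => v vS.
    apply: contraL vS => vS'; apply: dS; apply/flattenP; exists S' => //.
    by apply/mapP; exists (Q', S').
  split.
    (* P has at least one edge, so it is not edge-disjoint from itself and cannot occur twice. *)
    rewrite uP andbT; apply/negP=> /dPQ; rewrite /int_disjoint => /andP[_].
    case: iP => _ /= sP _ _; case: P sP {dPQ iPS dS} => [|u [|v s]] // _.
    rewrite disjoint_subset => /subsetP/(_ [set u; v]).
    by rewrite pedges_cons eqxx => /(_ isT)/negP; apply; rewrite pedges_cons eqxx.
  move=> P1 P2; rewrite !inE => /predU1P[->|PP1] /predU1P[->|PP2].
  - by rewrite eqxx.
  - by move=> _; apply: dPQ.
  - by move=> _; rewrite /int_disjoint setIC disjoint_sym; apply: dPQ.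
  - exact: dP.
apply: pi_omega_ge => //.
by apply/allP=> P /mapP[ps /iPS[op _ _ _] ->].
Qed.

End Systems.

Section SystemLists.

Variables (V : finType) (e : rel V).
Implicit Types (T : seq V) (R : {set V}) (L : seq (V * seq V)).

Lemma tsystem_nil T : tsystem e T set0 [::].
Proof. by split. Qed.

Lemma tsystem_sub T R R' L : R \subset R' -> tsystem e T R L -> tsystem e T R' L.
Proof. by move=> /subsetP sR [iL uL sL]; split=> // v /sL/sR. Qed.

Lemma tsystem1 T R it : is_item e T it -> uniq (footprint it) ->
  {subset footprint it <= R} -> tsystem e T R [:: it].
Proof.
move=> iit uit sit; split; rewrite /= ?cats0 //.
by move=> it'; rewrite inE => /eqP->.
Qed.

End SystemLists.

(** * Lower bound *)

Section CopyLinks.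

Variable n : nat.
Hypothesis n3 : 2 < n.

Implicit Types (g h s t x y z : 'S_n.+1) (i j k : 'I_n.+1).
Implicit Types (T : seq 'S_n.+1).

Local Notation e := (CW n.+1).

Lemma rim_path_CW a q : path (@rim n) a q -> path e a q.
Proof. by apply: sub_path => u v; apply: CW_rim. Qed.

Lemma cross_path j t t' a q : j != t ord0 -> j != t' ord0 ->
  path (@rim n) a q -> a = cross j t -> last a q = cross j t' ->
  path e t (rcons (a :: q) t').
Proof.
move=> jt jt' aq at_ lt'; rewrite /= rcons_path rim_path_CW // lt' at_ CW_cross //=.
by rewrite CW_sym CW_cross.
Qed.

Lemma exit_path j t s t' a q : rim t s -> j != t ord0 -> j != t' ord0 ->
  path (@rim n) a q -> a = cross j s -> last a q = cross j t' ->
  path e t (rcons (s :: a :: q) t').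
Proof.
move=> ts jt jt' aq as_ lt'; rewrite rcons_cons [path _ _ _]/= CW_rim //.
have js : j != s ord0 by rewrite (rim_copy n3 ts).
exact: (cross_path js jt' aq as_ lt').
Qed.

Lemma copy_notin j t t' t'' T v : perm_eq [:: t; t'; t''] T ->
  j != t ord0 -> j != t' ord0 -> j != t'' ord0 -> v \in copy j -> v \notin T.
Proof.
move=> pT jt jt' jt''; rewrite inE => /eqP vj; rewrite -(perm_mem pT) !inE -vj in jt jt' jt'' *.
by apply/negP=> /or3P[]/eqP E; rewrite E eqxx in jt jt' jt''.
Qed.

Lemma link_through_copy T t t' t'' j : uniq T -> perm_eq [:: t; t'; t''] T ->
  j != t ord0 -> j != t' ord0 -> j != t'' ord0 ->
  exists L, tsystem e T (copy j) L /\ forall c, count_type c L = (t'' == c).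
Proof.
move=> uT pT jt jt' jt''.
have cj u : cross j u \in copy j by rewrite inE cross_copy.
have [|||||||F [sF uF FP]] := @link n n3 j set0 [set cross j t] [set cross j t'] 1.
- by apply/subsetP=> v /set1P ->; apply: cj.
- by apply/subsetP=> v /set1P ->; apply: cj.
- by rewrite -setI_eq0 setI0.
- by rewrite -setI_eq0 setI0.
- by rewrite cards1.
- by rewrite cards1.
- by rewrite cards0 addn0; lia.
case: F sF uF FP => [|p [|p' F]] //= _; rewrite cats0 => uF /(_ _ (mem_head _ _)).
case=> a [q [Ep /set1P aA aq /set1P lB [_ _ pj]]]; subst p.
exists [:: (t'', a :: q)]; split; last by move=> c; rewrite /count_type /= addn0.
apply: tsystem1; rewrite /footprint //=; last by move=> v /pj/andP[].
exists t, t'; split=> /=.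
- by rewrite (perm_trans _ pT) // -[[:: t''; _; _]]/([:: t''] ++ _) perm_catC.
- exact: (cross_path jt jt' aq aA lB).
- by move=> v /pj/andP[vj _]; exact: (copy_notin pT jt jt' jt'' vj).
Qed.

(* The rim neighbour s gives t a second entry into the copy j. *)
Lemma two_links_through_copy T t t' t'' s j : uniq T -> perm_eq [:: t; t'; t''] T ->
  j != t ord0 -> j != t' ord0 -> j != t'' ord0 -> rim t s -> s \notin T ->
  cross j t' != cross j t'' ->
  exists L, tsystem e T (s |: copy j) L /\
    forall c, count_type c L = (t' == c) + (t'' == c).
Proof.
move=> uT pT jt jt' jt'' ts sT d'.
have cj u : cross j u \in copy j by rewrite inE cross_copy.
have dts : cross j t != cross j s.
  apply/eqP=> /cross_inj; rewrite (rim_copy n3 ts) => /(_ erefl) E.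
  by move: ts; rewrite -E (rim_irr n3).
have [|||||||F [sF uF FP]] :=
  @link n n3 j set0 [set cross j t; cross j s] [set cross j t'; cross j t''] 2.
- by apply/subsetP=> v /set2P[] ->; apply: cj.
- by apply/subsetP=> v /set2P[] ->; apply: cj.
- by rewrite -setI_eq0 setI0.
- by rewrite -setI_eq0 setI0.
- by rewrite cards2 dts.
- by rewrite cards2 d'.
- by rewrite cards0 addn0; lia.
case: F sF uF FP => [|p1 [|p2 [|p3 F]]] //= _; rewrite cats0 => uF FP.
have sj : s \notin copy j by rewrite inE (rim_copy n3 ts) eq_sym.
have [a1 [q1 [E1 aA1 aq1 lB1 [_ _ pj1]]]] := FP p1 (mem_head _ _).
have [|a2 [q2 [E2 aA2 aq2 lB2 [_ _ pj2]]]] := FP p2; first by rewrite !inE eqxx orbT.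
have d12 v : v \in p1 -> v \in p2 -> False.
  move: uF; rewrite cat_uniq => /and3P[_ /hasPn d _] v1 /d; by rewrite /= v1.
have aa : a1 != a2.
  by apply/eqP=> a12; apply: (d12 a1); rewrite ?E1 ?E2 ?mem_head // a12 mem_head.
have ll : last a1 q1 != last a2 q2.
  by apply/eqP=> l12; apply: (d12 (last a1 q1)); [rewrite E1 | rewrite E2 l12]; exact: mem_last.
(* The linkage may match the two sources with the two sinks either way. *)
have [u' [u'' [a [q [b [r [pU uab sub [Ea Eb la lb] [aq br]]]]]]]] :
  exists u' u'' a q b r, [/\ perm_eq [:: u'; u''] [:: t'; t''],
    uniq ((a :: q) ++ (b :: r)), {subset (a :: q) ++ (b :: r) <= copy j},
    [/\ a = cross j t, b = cross j s, last a q = cross j u' & last b r = cross j u''] &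
    path (@rim n) a q /\ path (@rim n) b r].
  have [w' [w'' [pW l1 l2]]] : exists w' w'', [/\ perm_eq [:: w'; w''] [:: t'; t''],
      last a1 q1 = cross j w' & last a2 q2 = cross j w''].
    case/set2P: lB1 lB2 ll => -> /set2P[]->; rewrite ?eqxx // => _.
      by exists t', t''.
    by exists t'', t'; split=> //; rewrite -[[:: _; t']]/([:: t''] ++ [:: t']) perm_catC.
  have u21 : uniq (p2 ++ p1) by rewrite uniq_catC.
  have s1 : {subset p1 ++ p2 <= copy j}.
    by move=> v; rewrite mem_cat => /orP[/pj1|/pj2] /andP[].
  have s2 : {subset p2 ++ p1 <= copy j}.
    by move=> v; rewrite mem_cat orbC -mem_cat; apply: s1.
  case/set2P: aA1 aA2 aa => [Ea1|Ea1] /set2P[Ea2|Ea2]; rewrite Ea1 Ea2 ?eqxx // => _.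
    by exists w', w'', a1, q1, a2, q2; rewrite -E1 -E2 -Ea1 -Ea2.
  exists w'', w', a2, q2, a1, q1; rewrite -E1 -E2 -Ea1 -Ea2; split=> //.
  by rewrite (perm_trans _ pW) // -[[:: _; w']]/([:: w''] ++ [:: w']) perm_catC.
have [ju' ju''] : j != u' ord0 /\ j != u'' ord0.
  by split; [have := perm_mem pU u' | have := perm_mem pU u''];
     rewrite !inE eqxx ?orbT => /esym/orP[]/eqP->.
have pT' : perm_eq [:: t; u'; u''] T by rewrite (perm_trans _ pT) // perm_cons.
have notT v : v \in copy j -> v \notin T by apply: copy_notin pT jt jt' jt''.
exists [:: (u'', a :: q); (u', s :: b :: r)]; split; last first.
  move=> c; rewrite /count_type /= addn0 addnC.
  by have := seq.permP pU (pred1 c); rewrite /= !addn0.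
split=> /=.
- move=> it; rewrite !inE => /orP[]/eqP->.
    exists t, u'; split=> /=.
    + by rewrite (perm_trans _ pT') // -[[:: u''; _; _]]/([:: u''] ++ _) perm_catC.
    + exact: (cross_path jt ju' aq Ea la).
    + by move=> v vq; apply/notT/sub; rewrite mem_cat vq.
  exists t, u''; split.
  + by apply: perm_trans pT'; have /permPl := perm_catCA [:: u'] [:: t] [:: u''].
  + exact: (exit_path ts jt ju'' br Eb lb).
  + move=> v; rewrite inE => /predU1P[->//|vr]; apply/notT/sub.
    by rewrite mem_cat vr orbT.
- rewrite cats0 -[_ && _]/(uniq ((a :: q) ++ s :: b :: r)).
  rewrite uniq_catC cat_cons /= -[_ && uniq _]/(uniq ((b :: r) ++ a :: q)).
  rewrite uniq_catC uab andbT; apply: contra sj => sq; apply: sub.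
  by move: sq; rewrite -cat_cons !mem_cat orbC.
- move=> v; rewrite cats0 -[v \in _]/(v \in (a :: q) ++ s :: b :: r).
  rewrite mem_cat [v \in s :: _]inE in_setU1 orbCA => /predU1P[->|].
    by rewrite eqxx.
  by rewrite -mem_cat => /sub ->; rewrite orbT.
Qed.

End CopyLinks.

Section ManyCopies.

Variable n : nat.
Hypothesis n3 : 2 < n.

Implicit Types (g h s t x y z : 'S_n.+1) (i j k : 'I_n.+1).
Implicit Types (T : seq 'S_n.+1) (js : seq 'I_n.+1).

Local Notation e := (CW n.+1).

Definition copies js : {set 'S_n.+1} := [set g : 'S_n.+1 | g ord0 \in js].

Definition fresh js T := forall j t, j \in js -> t \in T -> j != t ord0.

Lemma fresh_cons j js T : fresh (j :: js) T -> (forall t, t \in T -> j != t ord0) /\ fresh js T.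
Proof.
move=> H; split=> [t tT|j' t j'js tT]; first by apply: H; rewrite // mem_head.
by apply: H; rewrite // inE j'js orbT.
Qed.

Lemma disjoint_copy j js : j \notin js -> [disjoint copy j & copies js].
Proof.
move=> jjs; rewrite disjoint_subset; apply/subsetP=> g; rewrite inE => /eqP gj.
by rewrite !inE gj.
Qed.

Lemma copies_cons j js : copies (j :: js) = copy j :|: copies js.
Proof. by apply/setP=> g; rewrite !inE. Qed.

Lemma links_through_copies x y z js : uniq [:: x; y; z] -> uniq js -> fresh js [:: x; y; z] ->
  exists L, tsystem e [:: x; y; z] (copies js) L /\
    forall c, count_type c L = (y == c) * size js.
Proof.
move=> uT; elim: js => [|j js IH] /=.
  move=> _ _; exists [::]; split; last by move=> c; rewrite muln0.
  by apply: tsystem_sub (tsystem_nil _ _); apply: sub0set.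
move=> /andP[jjs ujs] /fresh_cons[jT fjs]; have [L [sL cL]] := IH ujs fjs.
have pT : perm_eq [:: x; z; y] [:: x; y; z].
  by rewrite perm_cons -[[:: z; y]]/([:: z] ++ [:: y]) perm_catC.
have [||| L1 [sL1 cL1]] := link_through_copy n3 (j := j) uT pT.
- by apply: jT; rewrite !inE eqxx.
- by apply: jT; rewrite !inE eqxx !orbT.
- by apply: jT; rewrite !inE eqxx orbT.
exists (L1 ++ L); split; last by move=> c; rewrite count_type_cat cL1 cL mulnS.
by rewrite copies_cons; apply: tsystem_cat (disjoint_copy jjs) sL1 sL.
Qed.

(** Each copy is entered by one exit s. An exit next to x gives links x-y and x-z, an exit next to z
    gives z-x and z-y, so every copy yields one item of type y. An exit next to both counts for
    x. *)
Lemma exits_through_copies x y z es js : uniq [:: x; y; z] -> uniq js -> fresh js [:: x; y; z] ->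
  uniq es -> size es = size js ->
  (forall s, s \in es -> s \notin [:: x; y; z] /\ (rim x s || rim z s)) ->
  (forall s j, s \in es -> j \in js -> rim x s -> cross j y != cross j z) ->
  (forall s j, s \in es -> j \in js -> rim z s -> cross j x != cross j y) ->
  exists L, tsystem e [:: x; y; z] ([set s in es] :|: copies js) L /\
    forall c, count_type c L = (z == c) * count (rim x) es +
      (x == c) * count (predC (rim x)) es + (y == c) * size js.
Proof.
move=> uT; elim: js es => [|j js IH] [|s es] //=.
  move=> _ _ _ _ _ _ _; exists [::]; split; last by move=> c; rewrite !muln0.
  by apply: tsystem_sub (tsystem_nil _ _); apply: sub0set.
move=> /andP[jjs ujs] fjjs /andP[ses ues] [ss] eP yz xy.
have /fresh_cons[jT fjs] := fjjs.
have [] := IH es ujs fjs ues ss.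
- by move=> s' s'es; apply: eP; rewrite inE s'es orbT.
- by move=> s' j' s'es j'js; apply: yz; rewrite inE ?s'es ?j'js orbT.
- by move=> s' j' s'es j'js; apply: xy; rewrite inE ?s'es ?j'js orbT.
move=> L [sL cL].
have e0 s' : s' \in s :: es -> s' ord0 \notin j :: js.
  move=> /eP[_ /orP[]/(rim_copy n3) ->]; apply/negP => H.
    by have := fjjs _ x H (mem_head _ _); rewrite eqxx.
  have zT : z \in [:: x; y; z] by rewrite !inE eqxx !orbT.
  by have := fjjs _ z H zT; rewrite eqxx.
have [jx jy jz] : [/\ j != x ord0, j != y ord0 & j != z ord0].
  by split; apply: jT; rewrite !inE eqxx ?orbT.
have [sT sxz] := eP s (mem_head _ _).
suff [L1 [sL1 cL1]] : exists L1, tsystem e [:: x; y; z] (s |: copy j) L1 /\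
    forall c, count_type c L1 = (z == c) * rim x s + (x == c) * ~~ rim x s + (y == c).
  exists (L1 ++ L); split; last first.
    by move=> c; rewrite count_type_cat cL1 cL mulnS !mulnDr addnACA; congr (_ + _); rewrite addnACA.
  apply: (@tsystem_sub _ _ _ ((s |: copy j) :|: ([set s in es] :|: copies js))).
    rewrite copies_cons; apply/subsetP=> v; rewrite !inE.
    by rewrite -!orbA; case: (v == s); case: (v ord0 == j) => //=; rewrite ?orbT.
  apply: tsystem_cat sL1 sL; rewrite disjoint_subset; apply/subsetP=> v.
  case/setU1P=> [->|vj]; rewrite inE in_setU negb_or inE.
    by rewrite ses /=; have := e0 s (mem_head _ _); rewrite !inE negb_or => /andP[].
  rewrite (disjointFr (disjoint_copy jjs) vj) andbT; apply/negP=> ves.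
  have := e0 v; rewrite inE ves orbT => /(_ isT); rewrite inE negb_or.
  by move: vj; rewrite inE => ->.
case: (boolP (rim x s)) => [xs|nxs].
  have [|L1 [sL1 cL1]] := two_links_through_copy n3 uT (perm_refl _) jx jy jz xs sT.
    by apply: (yz s j); rewrite ?mem_head.
  by exists L1; split=> // c; rewrite cL1 muln1 muln0 addn0 addnC.
have zs : rim z s by move: sxz; rewrite (negbTE nxs).
have pT : perm_eq [:: z; x; y] [:: x; y; z].
  by rewrite -[[:: z; _; _]]/([:: z] ++ [:: x; y]) perm_catC.
have [|L1 [sL1 cL1]] := two_links_through_copy n3 uT pT jz jx jy zs sT.
  by apply: (xy s j); rewrite ?mem_head.
by exists L1; split=> // c; rewrite cL1 muln1 muln0.
Qed.

End ManyCopies.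

Lemma tsystem_family (V : finType) (ee : rel V) (T : seq V) (c : seq V -> V) (F : seq (seq V)) :
  uniq (flatten F) -> (forall p, p \in F -> ~~ nilp p /\ is_item ee T (c p, p)) ->
  tsystem ee T [set v in flatten F] [seq (c p, p) | p <- F].
Proof.
move=> uF FP; have E : map (@footprint V) [seq (c p, p) | p <- F] = F.
  rewrite -map_comp -[RHS]map_id; apply/eq_in_map => p /FP[np _].
  by rewrite /= /footprint (negbTE np).
split; rewrite ?E //; first by move=> it /mapP[p /FP[_ ip] ->].
move=> v vF.
by rewrite inE.
Qed.

Lemma tsystem_edge (V : finType) (ee : rel V) (T : seq V) a b c :
  perm_eq [:: c; a; b] T -> ee a b -> tsystem ee T [set c] [:: (c, [::])].
Proof.
move=> pT ab; apply: tsystem1 => //; last by move=> v; rewrite !inE.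
by exists a, b; split=> //=; rewrite ab.
Qed.

Lemma size_enum_set (V : finType) (A : {set V}) : size (enum A) = #|A|.
Proof. by rewrite cardE. Qed.

Lemma count_enum (V : finType) (A : {set V}) (P : pred V) :
  count P (enum A) = #|[set v in A | P v]|.
Proof.
rewrite -size_filter cardE; apply/perm_size/uniq_perm.
- by rewrite filter_uniq ?enum_uniq.
- exact: enum_uniq.
by move=> v; rewrite mem_filter !mem_enum inE andbC.
Qed.

(** For terminals in one copy: p targets of the fan are next to x, q are next to z only, a and b
    tell whether y is adjacent to x and to z, and r targets are missed by the fan. There is thus
    another copy for each exit. *)
Lemma exits_bound (n p q a b r : nat) :
  p + a = n -> q + b <= n -> p + q = n - (a + b) + r -> r <= n.
Proof. lia. Qed.

(** * Three terminals in one copy *)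

Section OneCopy.

Variable n : nat.
Hypothesis n3 : 2 < n.

Implicit Types (g h s t x y z : 'S_n.+1) (i j k : 'I_n.+1).
Implicit Types (T : seq 'S_n.+1) (js : seq 'I_n.+1).

Local Notation e := (CW n.+1).

(* Every rim neighbour of x or z other than y either ends a path of the fan from y
   or is an exit towards another copy. *)
Lemma system_one_copy x y z : uniq [:: x; y; z] -> x ord0 = y ord0 -> z ord0 = y ord0 ->
  ~~ rim x z -> exists R L, [/\ tsystem e [:: x; y; z] R L,
    count_type z L = n, count_type y L = n &
    n - #|rimN x :&: rimN z| <= count_type x L].
Proof.
move=> uT xy0 zy0 nxz.
have [xy xz yz] : [/\ x != y, x != z & y != z].
  by move: uT; rewrite /= !inE negb_or andbT => /andP[/andP[-> ->] ->].
have [yx zx zy] : [/\ y != x, z != x & z != y] by split; rewrite eq_sym.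
have neq := (negbTE xy, negbTE xz, negbTE yz, negbTE yx, negbTE zx, negbTE zy).
have nzx : ~~ rim z x by rewrite rim_sym.
pose X := [set x; z]; pose S := fan_target y X.
have [|||||F [sF uF FP]] := @fan n n3 (y ord0) y X.
- by rewrite inE.
- by apply/subsetP=> v /set2P[]->; rewrite inE ?xy0 ?zy0.
- by rewrite !inE !neq.
- by apply/set0Pn; exists x; rewrite !inE eqxx.
- by move=> u v /set2P[]-> /set2P[]->; rewrite ?(rim_irr n3).
have SP v : v \in S -> [/\ v \notin [:: x; y; z], rim x v || rim z v & v ord0 = y ord0].
  case/fan_targetP=> vX [t /set2P tX tv]; split.
  - by move: vX; rewrite !inE !negb_or => /and3P[-> -> ->].
  - by case: tX tv => -> ->; rewrite ?orbT.
  - by rewrite (rim_copy n3 tv); case: tX => ->.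
have Fv v : v \in flatten F -> v ord0 = y ord0 /\ v \notin [:: x; y; z].
  case/flattenP=> p /FP[a [q [_ _ _ _ [_ pj]]]] /pj; rewrite !inE !negb_or.
  by case/andP=> /eqP-> /and3P[-> -> ->].
have lastF p : p \in F -> last y p \in p.
  by case/FP=> a [q [-> _ _ _ _]]; rewrite /= mem_last.
pose es := [seq s <- enum S | s \notin flatten F].
have pS : perm_eq (enum S) (map (last y) F ++ es).
  apply: uniq_perm; first exact: enum_uniq.
    rewrite cat_uniq filter_uniq ?enum_uniq // andbT; apply/andP; split.
      rewrite map_inj_in_uniq ?(uniq_nonempty uF) //.
        by move=> p /FP[a [q [-> _]]].
      move=> p q pF qF E; apply: (uniq_flatten_inj uF pF qF (v := last y p)).
        exact: lastF.
      by rewrite E lastF.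
    apply/hasPn=> v; rewrite mem_filter => /andP[vF _]; apply: contra vF.
    case/mapP=> p pF ->; apply/flattenP; exists p => //.
    exact: lastF.
  move=> v; rewrite mem_enum mem_cat mem_filter mem_enum.
  apply/idP/orP=> [vS|[/mapP[p /FP[a [q [-> _ _ lS _]]] ->] //|/andP[]//]].
  case: (boolP (v \in flatten F)) => [/flattenP[p pF vp]|]; last by right.
  left; apply/mapP; exists p => //; have [a [q [Ep _ _ _ [nS _]]]] := FP p pF.
  move: vp; rewrite Ep lastI mem_rcons inE last_rcons => /predU1P[-> //|/nS/negP[]].
  exact: vS.
(* A path of the fan is completed to x whenever possible, even if it could also reach z; reaching x
   gives type z. *)
pose c p := if rim x (last y p) then z else x.
have sysF : tsystem e [:: x; y; z] [set v in flatten F] [seq (c p, p) | p <- F].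
  apply: tsystem_family => // p pF; have [a [q [Ep ya aq lS [_ pj]]]] := FP p pF.
  split; first by rewrite Ep.
  have nT : {in p, forall v, v \notin [:: x; y; z]}.
    by move=> v vp; case: (Fv v) => //; apply/flattenP; exists p.
  have pe t : rim (last y p) t -> path e y (rcons p t).
    by move=> lt; apply: rim_path_CW => //; rewrite rcons_path lt Ep /= ya aq.
  rewrite /c; case: ifP => [xl|nxl].
    exists y, x; split=> //=; last by apply: pe; rewrite rim_sym.
    by rewrite -[[:: z; y; x]]/(rev [:: x; y; z]) perm_rev.
  have [|_ + _] := SP (last y p); first by rewrite Ep.
  by rewrite nxl /= => zl; exists y, z; split=> //=; apply: pe; rewrite rim_sym.
(* The direct edges from y, which the fan leaves out. *)
pose Lx := if rim y x then [:: (z, [::])] else [::] : seq ('S_n.+1 * seq 'S_n.+1).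
pose Lz := if rim y z then [:: (x, [::])] else [::] : seq ('S_n.+1 * seq 'S_n.+1).
have sysx : tsystem e [:: x; y; z] [set z] Lx.
  rewrite /Lx; case: ifP => [yx'|_]; last exact: tsystem_sub (sub0set _) (tsystem_nil _ _).
  apply: (tsystem_edge (a := y) (b := x)); last exact: CW_rim.
  by rewrite -[[:: z; y; x]]/(rev [:: x; y; z]) perm_rev.
have sysz : tsystem e [:: x; y; z] [set x] Lz.
  rewrite /Lz; case: ifP => [yz'|_]; last exact: tsystem_sub (sub0set _) (tsystem_nil _ _).
  by apply: (tsystem_edge (a := y) (b := z)); last exact: CW_rim.
pose js := enum [set~ y ord0].
have sjs : size js = n by rewrite size_enum_set cardsC1 card_ord.
have ujs : uniq js by apply: enum_uniq.
have yjs : y ord0 \notin js by rewrite mem_enum !inE eqxx.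
have fjs : fresh js [:: x; y; z].
  move=> j t; rewrite mem_enum !inE => jy /or3P[]/eqP->; by rewrite ?xy0 ?zy0.
have uN t : #|rimN t| = n by apply: rim_degree.
have ES : [set v in S | rim x v] = rimN x :\ y.
  apply/setP=> v; rewrite [LHS]in_set in_setD1 in_rimN.
  have [xv|] := boolP (rim x v); rewrite ?andbF // !andbT.
  apply/fan_targetP/idP=> [[]|vy]; first by rewrite !inE negb_or => /andP[].
  split; last by exists x; rewrite // !inE eqxx.
  rewrite !inE (negbTE vy) /= negb_or; apply/andP; split.
    by apply: contraTneq xv => ->; rewrite (rim_irr n3).
  by apply: contraTneq xv => ->.
have ESz : [set v in S | predC (rim x) v] = (rimN z :\: rimN x) :\ y.
  apply/setP=> v; rewrite [LHS]in_set in_setD1 [v \in rimN z :\: _]in_setD !in_rimN /=.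
  have [xv|nxv] := boolP (rim x v); rewrite ?andbF // andbT /=.
  apply/fan_targetP/andP=> [[vX [t /set2P[]-> tv]]|[vy zv]].
  - by rewrite tv in nxv.
  - by split=> //; move: vX; rewrite !inE negb_or => /andP[].
  split; last by exists z; rewrite // !inE eqxx orbT.
  rewrite !inE (negbTE vy) /= negb_or; apply/andP; split.
    by apply: contraTneq zv => ->.
  by apply: contraTneq zv => ->; rewrite (rim_irr n3).
have nX : #|rimN y :&: X| = rim y x + rim y z.
  rewrite setIUr ![rimN y :&: _]setIC.
  have one t : [set t] :&: rimN y = if rim y t then [set t] else set0.
    case: ifP => ryt; apply/setP=> v; rewrite in_setI in_set1 in_rimN ?in_set1 ?in_set0;
      by case: eqP => // ->; rewrite ryt.
  rewrite !one; case: (rim y x); case: (rim y z);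
    by rewrite ?set0U ?setU0 ?cards2 ?xz ?cards1 ?cards0.
have cS : #|S| = #|rimN x :\ y| + #|(rimN z :\: rimN x) :\ y|.
  rewrite -ES -ESz -!count_enum count_predC; exact: esym (size_enum_set _).
have cX : #|rimN x :\ y| + rim y x = n.
  by have := cardsD1 y (rimN x); rewrite uN in_rimN rim_sym addnC => <-.
have cZ : n - #|rimN x :&: rimN z| <= #|(rimN z :\: rimN x) :\ y| + rim y z.
  rewrite leq_subLR -[X in X <= _](uN z) -(cardsID (rimN x) (rimN z)) setIC leq_add2l.
  rewrite (cardsD1 y (rimN z :\: rimN x)) addnC leq_add2l in_setD !in_rimN.
  by rewrite [rim z y]rim_sym; case: (rim y z); rewrite ?andbF ?leq_b1.
have cZ' : #|(rimN z :\: rimN x) :\ y| + rim y z <= n.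
  rewrite -[X in _ <= X](uN z) (cardsD1 y (rimN z)) in_rimN [rim z y]rim_sym addnC.
  by rewrite leq_add2l subset_leq_card // setSD // subsetDl.
have ses : size es <= n.
  have := perm_size pS; rewrite size_enum_set size_cat size_map sF nX cS.
  exact: exits_bound cX cZ'.
pose js1 := take (size es) js; pose js2 := drop (size es) js.
have sub1 : {subset js1 <= js} by move=> j /mem_take.
have sub2 : {subset js2 <= js} by move=> j /mem_drop.
have ses1 : size es = size js1 by rewrite size_takel // sjs.
have esS s : s \in es -> s \in S by rewrite mem_filter mem_enum => /andP[].
have [||||||| L1 [sys1 c1]] := @exits_through_copies n n3 x y z es js1 uT.
- exact: take_uniq.
- by move=> j t /sub1; apply: fjs.
- by rewrite filter_uniq ?enum_uniq.
- exact: ses1.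
- by move=> s /esS/SP[].
- by move=> s j _ _ _; apply: contra yz => /eqP/cross_inj E; rewrite E.
- by move=> s j _ _ _; apply: contra xy => /eqP/cross_inj E; rewrite E.
have [||L2 [sys2 c2]] := @links_through_copies n n3 x y z js2 uT.
- exact: drop_uniq.
- by move=> j t /sub2; apply: fjs.
have d12 : [disjoint [set s in es] :|: copies js1 & copies js2].
  rewrite disjoint_subset; apply/subsetP=> v; rewrite !inE => /orP[/esS/SP[_ _ ->]|v1].
    by apply: contra yjs => /sub2.
  have := ujs; rewrite -(cat_take_drop (size es) js) cat_uniq => /and3P[_ /hasPn d _].
  by apply/negP=> /d; rewrite /= v1.
have sys12 := tsystem_cat d12 sys1 sys2.
have dF : [disjoint [set v in flatten F] & ([set s in es] :|: copies js1) :|: copies js2].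
  rewrite disjoint_subset; apply/subsetP=> v; rewrite !inE => vF.
  have [v0 _] := Fv v vF; rewrite !negb_or mem_filter vF /= v0.
  by apply/andP; split; apply: contra yjs; [apply: sub1 | apply: sub2].
have sysF12 := tsystem_cat dF sysF sys12.
have dxz : [disjoint [set z] & [set x]].
  by rewrite disjoint_subset; apply/subsetP=> v; rewrite !inE => /eqP->; rewrite zx.
have sysxz := tsystem_cat dxz sysx sysz.
eexists _, (Lx ++ Lz ++ [seq (c p, p) | p <- F] ++ L1 ++ L2).
have cF t : count_type t [seq (c p, p) | p <- F] =
    (z == t) * count (rim x) (map (last y) F) +
    (x == t) * count (predC (rim x)) (map (last y) F).
  rewrite /count_type !count_map; elim: (F) => [|p G IH] /=; first by rewrite !muln0.
  rewrite IH /c; case: (rim x (last y p)); rewrite add1n add0n mulnS.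
    by rewrite addnA.
  by rewrite addnCA.
have cLx t : count_type t Lx = (z == t) * rim y x.
  by rewrite /Lx; case: (rim y x); rewrite /count_type /= ?addn0 ?muln1 ?muln0.
have cLz t : count_type t Lz = (x == t) * rim y z.
  by rewrite /Lz; case: (rim y z); rewrite /count_type /= ?addn0 ?muln1 ?muln0.
(* Fan ends and exits together exhaust the targets. So each rim neighbour of x, including possibly
   y, accounts for one item of type z, each rim neighbour of z that is not next to x for one of type
   x, and each other copy for one of type y. *)
have cE P : count P (map (last y) F) + count P es = #|[set v in S | P v]|.
  by rewrite -count_enum (seq.permP pS) count_cat.
have sjs12 : size js1 + size js2 = n by rewrite -size_cat cat_take_drop.
split.
- rewrite catA; apply: tsystem_cat sysxz sysF12.
  rewrite disjoint_subset; apply/subsetP=> v vxz.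
  have vT : v \in [:: x; y; z] by move: vxz; rewrite !inE => /orP[]->; rewrite ?orbT.
  have v0 : v ord0 = y ord0 by move: vxz; rewrite !inE => /orP[]/eqP->.
  rewrite inE /= !inE !negb_or -!andbA; apply/and4P; split.
  + by apply/negP=> /Fv[_]; rewrite vT.
  + by apply/negP=> /esS/SP[]; rewrite vT.
  + by rewrite v0; apply: contra yjs => /sub1.
  + by rewrite v0; apply: contra yjs => /sub2.
- rewrite !count_type_cat cLx cLz cF c1 c2 !eqxx !neq !mul1n !mul0n !addn0.
  by rewrite cE ES addnC.
- by rewrite !count_type_cat cLx cLz cF c1 c2 !eqxx !neq !mul1n !mul0n !add0n.
- rewrite !count_type_cat cLx cLz cF c1 c2 !eqxx !neq !mul1n !mul0n !addn0 !add0n.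
  by rewrite cE ESz addnC.
Qed.

End OneCopy.

(** * Two terminals in one copy, the third outside *)

Section TwoCopies.

Variable n : nat.
Hypothesis n3 : 2 < n.

Implicit Types (g h s t x y z : 'S_n.+1) (i j k : 'I_n.+1).
Implicit Types (T : seq 'S_n.+1) (js : seq 'I_n.+1).

Local Notation e := (CW n.+1).

(** I is singled out among the n paths because it alone may be a direct edge, with empty
    interior. *)
Lemma fan_pair x y : x != y -> x ord0 = y ord0 ->
  exists I F, [/\ size F = n.-1, uniq (I ++ flatten F), path (@rim n) x (rcons I y),
    forall p, p \in F -> ~~ nilp p /\ path (@rim n) x (rcons p y) &
    {in I ++ flatten F, forall v, [/\ v \in copy (x ord0), v != x & v != y]}].
Proof.
move=> xy xy0.
have [|||||F [sF uF FP]] := @fan n n3 (x ord0) x [set y].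
- by rewrite inE.
- by apply/subsetP=> v /set1P->; rewrite inE xy0.
- by rewrite inE.
- by apply/set0Pn; exists y; rewrite inE.
- by move=> u v /set1P-> /set1P->; rewrite (rim_irr n3).
have FP' p : p \in F -> ~~ nilp p /\ path (@rim n) x (rcons p y).
  move=> /FP[a [q [-> xa aq /fan_targetP[_ [t /set1P-> tl]] _]]]; split=> //=.
  by rewrite xa rcons_path aq /= [rim _ y]rim_sym.
have Fv : {in flatten F, forall v, [/\ v \in copy (x ord0), v != x & v != y]}.
  move=> v /flattenP[p /FP[a [q [_ _ _ _ [_ pj]]]] /pj/andP[vj]].
  by rewrite in_setU1 in_set1 negb_or => /andP[vx vy]; split.
have E : rimN x :&: [set y] = if rim x y then [set y] else set0.
  apply/setP=> v; rewrite in_setI in_set1 in_rimN; case: ifP => xy';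
    by rewrite ?in_set1 ?in_set0; case: eqP => [->|_]; rewrite ?xy' ?andbF.
rewrite {}E in sF; move: sF; case: ifP => xy'; rewrite ?cards1 ?cards0 ?subn0 => sF.
  by exists [::], F; rewrite /= xy' sF subn1.
case: F sF uF FP' Fv {FP} => [|I F] sF uF FP' Fv; first by exfalso; have := n3; rewrite -sF.
exists I, F; split=> //; first by move: sF => /(congr1 predn).
- by case: (FP' I (mem_head _ _)).
- by move=> p pF; apply: FP'; rewrite inE pF orbT.
Qed.

Lemma item_rim_path T x y z I : perm_eq [:: x; y; z] T ->
  path e x (rcons I y) -> {in I, forall v, v \notin T} -> is_item e T (z, I).
Proof.
move=> pT xy nT; exists x, y; split=> //=.
by rewrite (perm_trans _ pT) // -[[:: z; x; y]]/([:: z] ++ [:: x; y]) perm_catC.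
Qed.

(** Of the n + 1 copies, n - 1 hold no terminal. Each is entered from its own rim neighbour of z and
    joins z once to x and once to y, whose entries differ because they share a copy. *)
Lemma system_two_copies x y z : uniq [:: x; y; z] -> x ord0 = y ord0 -> z ord0 != y ord0 ->
  exists R L, [/\ tsystem e [:: x; y; z] R L, count_type z L = n,
    count_type y L = n.-1 & count_type x L = n.-1].
Proof.
move=> uT xy0 zy0; have [xy xz yz] : [/\ x != y, x != z & y != z].
  by move: uT; rewrite /= !inE negb_or andbT => /andP[/andP[-> ->] ->].
have [yx zx zy] : [/\ y != x, z != x & z != y] by split; rewrite eq_sym.
have neq := (negbTE xy, negbTE xz, negbTE yz, negbTE yx, negbTE zx, negbTE zy).
have [I [F [sF uIF pI FP IF]]] := fan_pair xy xy0.
have nT v : v \in I ++ flatten F -> v \notin [:: x; y; z].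
  move=> /IF[+ vx vy]; rewrite !inE (negbTE vx) (negbTE vy) /=; apply: contraL => /eqP->.
  by rewrite xy0.
have [uI dIF uF] : [/\ uniq I, {in I, forall v, v \notin flatten F} & uniq (flatten F)].
  move: uIF; rewrite cat_uniq => /and3P[-> /hasPn d ->]; split=> // v vI.
  by apply/negP=> /d; rewrite /= vI.
have sysF : tsystem e [:: x; y; z] [set v in flatten F] [seq (z, p) | p <- F].
  apply: (tsystem_family (c := fun _ => z)) => // p pF; have [np pp] := FP p pF.
  split=> //; apply: item_rim_path (perm_refl _) (rim_path_CW n3 pp) _ => // v vp.
  by apply: nT; rewrite mem_cat; apply/orP; right; apply/flattenP; exists p.
have sysI : tsystem e [:: x; y; z] (z |: [set v in I]) [:: (z, I)].
  apply: tsystem1.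
  - apply: item_rim_path (perm_refl _) (rim_path_CW n3 pI) _ => // v vI.
    by apply: nT; rewrite mem_cat vI.
  - by rewrite /footprint /=; case: (I) uI.
  - move=> v; rewrite /footprint /=; case: (I) => [|i q]; rewrite !inE => -> //.
    by rewrite orbT.
pose es := take n.-1 (enum (rimN z)).
pose js := enum [set~ x ord0] .
have uN : #|rimN z| = n by apply: rim_degree.
have esP s : s \in es -> rim z s by move=> /mem_take; rewrite mem_enum in_rimN.
pose js' := rem (z ord0) js.
have ujs : uniq js by apply: enum_uniq.
have js'P j : j \in js' -> j != x ord0 /\ j != z ord0.
  by rewrite mem_rem_uniq // !inE mem_enum !inE => /andP[-> ->].
have ses : size es = n.-1 by rewrite size_takel // size_enum_set uN leq_pred.
have sjs' : size js' = n.-1.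
  rewrite size_rem ?size_enum_set ?cardsC1 ?card_ord // mem_enum !inE xy0.
  by [].
have e0 s : s \in es -> s ord0 = z ord0 by move=> /esP/(rim_copy n3).
have [||||||| L1 [sys1 c1]] := @exits_through_copies n n3 x y z es js' uT.
- exact: rem_uniq.
- move=> j t /js'P[jx jz]; rewrite !inE => /or3P[]/eqP-> //.
  by rewrite -xy0.
- by rewrite take_uniq ?enum_uniq.
- by rewrite ses sjs'.
- move=> s ses'; rewrite (esP s ses') orbT; split=> //; have s0 := e0 s ses'.
  rewrite !inE !negb_or; apply/and3P; split; apply/eqP=> E.
  + by move: zy0; rewrite -s0 E xy0 eqxx.
  + by move: zy0; rewrite -s0 E eqxx.
  + by have := esP s ses'; rewrite E (rim_irr n3).
- move=> s j /e0 s0 _ /(rim_copy n3); rewrite s0 xy0 => E.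
  by rewrite E eqxx in zy0.
- by move=> s j _ _ _; apply: contra xy => /eqP/cross_inj E; rewrite E.
have nx : count (rim x) es = 0.
  apply/eqP; rewrite -leqn0 leqNgt -has_count; apply/hasPn=> s /e0 s0.
  by apply/negP=> /(rim_copy n3); rewrite s0 xy0 => E; rewrite E eqxx in zy0.
have npx : count (predC (rim x)) es = n.-1.
  by rewrite -[RHS]ses -(count_predC (rim x) es) nx.
have dIF' : [disjoint z |: [set v in I] & [set v in flatten F]].
  rewrite disjoint_subset; apply/subsetP=> v; rewrite !inE => /predU1P[->|/dIF //].
  apply/negP=> zF; have := nT z; rewrite mem_cat zF orbT => /(_ isT).
  by rewrite !inE eqxx !orbT.
have sysA := tsystem_cat dIF' sysI sysF.
eexists _, (((z, I) :: [seq (z, p) | p <- F]) ++ L1).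
have cF t : count_type t [seq (z, p) | p <- F] = (z == t) * n.-1.
  by rewrite -sF /count_type count_map; elim: (F) => [|p G IH] /=; rewrite ?muln0 // IH mulnS.
split.
- apply: tsystem_cat sysA sys1; rewrite disjoint_subset; apply/subsetP=> v.
  rewrite !inE negb_or -orbA => vA; apply/andP; split; apply/negP.
    move=> ves; have v0 := e0 v ves; case/or3P: vA => [/eqP vz|vI|vF].
    + by have := esP v ves; rewrite vz (rim_irr n3).
    + have [] := IF v; first by rewrite mem_cat vI.
      by rewrite inE v0 xy0 (negbTE zy0).
    + have [] := IF v; first by rewrite mem_cat vF orbT.
      by rewrite inE v0 xy0 (negbTE zy0).
  move=> /js'P[vx vz]; case/or3P: vA => [/eqP vz'|vI|vF].
  + by rewrite vz' eqxx in vz.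
  + have [] := IF v; first by rewrite mem_cat vI.
    by rewrite inE (negbTE vx).
  + have [] := IF v; first by rewrite mem_cat vF orbT.
    by rewrite inE (negbTE vx).
- rewrite count_type_cat [count_type _ (_ :: _)]/= -/(count_type _ _) cF c1 nx !eqxx !neq.
  by rewrite !mul0n !muln0 mul1n !addn0 add1n prednK //; case: (n) n3.
- rewrite count_type_cat [count_type _ (_ :: _)]/= -/(count_type _ _) cF c1 sjs' !eqxx !neq.
  by rewrite !mul0n mul1n.
- rewrite count_type_cat [count_type _ (_ :: _)]/= -/(count_type _ _) cF c1 npx !eqxx !neq.
  by rewrite ?mul0n ?mul1n ?addn0 ?add0n.
Qed.

End TwoCopies.

Lemma count_family (V : finType) (F : seq (seq V)) (z c : V) :
  count_type c [seq (z, p) | p <- F] = (z == c) * size F.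
Proof.
by rewrite /count_type count_map; elim: F => [|p G IH] /=; rewrite ?muln0 // IH mulnS.
Qed.

(** * Paths between two terminals in different copies *)

Section Prism.

Variable n : nat.
Hypothesis n3 : 2 < n.

Implicit Types (g h s t x y z : 'S_n.+1) (i j k a b : 'I_n.+1).
Implicit Types (T : seq 'S_n.+1) (js : seq 'I_n.+1).

Local Notation e := (CW n.+1).

Lemma cross_rim_path b u q : path (@rim n) u q ->
  path (@rim n) (cross b u) (map (cross b) q).
Proof.
elim: q u => //= v q IH u /andP[uv /IH->]; by rewrite cross_rim.
Qed.

(* The two copies form a prism: one path of the first copy is used on both layers,
   the other ones switch layers right after leaving x. *)
Lemma prism x y : x ord0 != y ord0 ->
  exists F : seq (seq 'S_n.+1), [/\ size F = n.+1,
    uniq F, uniq (flatten F), forall p, p \in F -> path e x (rcons p y) &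
    {in flatten F, forall v : 'S_n.+1, v != x /\ v != y /\ (v ord0 = x ord0 \/ v ord0 = y ord0)}].
Proof.
move=> xy0; set a := x ord0; set b := y ord0.
have ba : b != a by rewrite eq_sym.
have crossbe (u : 'S_n.+1) : u ord0 = a -> e u (cross b u).
  by move=> ua; apply: (CW_cross n3); rewrite ua.
pose y1 := cross a y; have y1y : cross b y1 = y by apply: crossK.
have y1a : y1 ord0 = a by apply: cross_copy.
have binj (u v : 'S_n.+1) : u ord0 = a -> v ord0 = a -> cross b u = cross b v -> u = v.
  by move=> ua va; apply: cross_inj; rewrite ua va.
have nab (v : 'S_n.+1) : v ord0 = a -> v ord0 = b -> False.
  by move=> va vb; rewrite -va -vb eqxx in ba.
(* If y is matched with x, the paths are the edge x y and, for each of the n rim neighbours u of x,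
   the three other sides of the square over the edge x u. *)
have [xy1|xy1] := eqVneq x y1.
  have xy : e x y by rewrite -y1y -xy1; apply: crossbe.
  pose f u := [:: u; cross b u].
  have Na (u : 'S_n.+1) : u \in enum (rimN x) -> u ord0 = a /\ rim x u.
    by rewrite mem_enum in_rimN => xu; split=> //; rewrite (rim_copy n3 xu).
  have uf : uniq (flatten [seq f u | u <- enum (rimN x)]).
    apply: uniq_flatten_map; first exact: enum_uniq.
      move=> u /Na[ua _]; rewrite /= inE andbT; apply/eqP=> E.
      by apply: (nab u); rewrite // E cross_copy.
    move=> u v w /Na[ua _] /Na[va _]; rewrite !inE => /orP[]/eqP-> /orP[]/eqP.
    - by [].
    - by move=> E; case: (nab u); rewrite // E cross_copy.
    - by move=> E; case: (nab v); rewrite // -E cross_copy.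
    - exact: binj.
  exists ([::] :: [seq f u | u <- enum (rimN x)]); split=> //=.
  - by rewrite size_map size_enum_set (rim_degree n3).
  - rewrite (uniq_nonempty uf) ?andbT; last by move=> p /mapP[u _ ->].
    by apply/negP=> /mapP[].
  - move=> p; rewrite inE => /predU1P[->|/mapP[u /Na[ua xu] ->]] /=; first by rewrite xy.
    rewrite (CW_rim n3 xu) crossbe //= andbT CW_rim // -y1y -xy1.
    by apply: cross_rim; rewrite // rim_sym.
  - move=> v /flattenP[_ /mapP[u /Na[ua xu] ->]]; rewrite !inE => /orP[]/eqP->.
      split; first by apply: contraTneq xu => ->; rewrite (rim_irr n3).
      split; last by left.
      by apply/eqP=> uy; apply: (nab u) => //; rewrite uy.
    rewrite cross_copy; split; last split; last by right.
      by apply/eqP=> E; apply: (nab x) => //; rewrite -E cross_copy.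
    apply: contraTneq xu; rewrite -y1y => /binj -> //; rewrite -xy1 (rim_irr n3) //.
have [I [F [sF uIF pI FP IF]]] := fan_pair n3 xy1 (esym y1a).
have {}IF (v : 'S_n.+1) : v \in I ++ flatten F -> [/\ v ord0 = a, v != x & v != y1].
  by move=> /IF[+ vx vy]; rewrite inE => /eqP va.
have [uI dIF uF] : [/\ uniq I, {in I, forall v, v \notin flatten F} & uniq (flatten F)].
  move: uIF; rewrite cat_uniq => /and3P[-> /hasPn d ->]; split=> // v vI.
  by apply/negP=> /d; rewrite /= vI.
have Ia (v : 'S_n.+1) : v \in I -> [/\ v ord0 = a, v != x & v != y1] by move=> vI; apply: IF; rewrite mem_cat vI.
have Fa (v : 'S_n.+1) : v \in flatten F -> [/\ v ord0 = a, v != x & v != y1].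
  by move=> vF; apply: IF; rewrite mem_cat vF orbT.
have inF p v : p \in F -> v \in p -> v \in flatten F.
  by move=> pF vp; apply/flattenP; exists p.
(* Only the head of p is visited on the first layer. [P1] and [P2] are the two uses of I, switching
   layers at the very end and at the very start. *)
pose f p := head x p :: map (cross b) p.
pose P1 := rcons I y1; pose P2 := cross b x :: map (cross b) I.
have P1v (v : 'S_n.+1) : v \in P1 -> [/\ v ord0 = a, v != x & v \notin flatten F].
  rewrite mem_rcons inE => /predU1P[->|vI].
    split; rewrite // 1?eq_sym //; apply/negP=> /Fa[_ _]; by rewrite eqxx.
  by have [va vx _] := Ia v vI; split=> //; apply: dIF.
have P2v (v : 'S_n.+1) : v \in P2 -> exists w : 'S_n.+1, [/\ v = cross b w, w ord0 = a, w != y1 &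
    w \notin flatten F].
  rewrite inE => /predU1P[->|/mapP[w wI ->]].
    exists x; split=> //; apply/negP=> /Fa[_]; by rewrite eqxx.
  by have [wa _ wy] := Ia w wI; exists w; split=> //; apply: dIF.
have fv (p : seq 'S_n.+1) (v : 'S_n.+1) : p \in F -> v \in f p ->
    (v ord0 = a /\ v \in p) \/ exists w : 'S_n.+1, v = cross b w /\ w \in p.
  move=> pF; rewrite inE => /predU1P[->|/mapP[w wp ->]]; last by right; exists w.
  have [np _] := FP p pF; have hp : head x p \in p by case: p np {pF} => //= c p _; rewrite mem_head.
  by left; split=> //; have [] := Fa _ (inF _ _ pF hp).
have uF0 : uniq F by apply: uniq_nonempty => // p /FP[].
have uf : uniq (flatten (map f F)).
  apply: uniq_flatten_map => // [p pF|p q v pF qF vp vq].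
    rewrite /= map_inj_in_uniq ?(uniq_flatten_mem uF pF) ?andbT.
      apply/negP=> /mapP[w wp hw]; have [np _] := FP p pF.
      have hp : head x p \in p by case: p np {pF wp hw} => //= c p _; rewrite mem_head.
      have [ha _ _] := Fa _ (inF _ _ pF hp).
      by apply: (nab (head x p)); rewrite // hw cross_copy.
    move=> u v up vp; apply: binj; [have [] := Fa u (inF _ _ pF up)|have [] := Fa v (inF _ _ pF vp)]; done.
  case: (fv p v pF vp) (fv q v qF vq) => [[va vp']|[w [vw wp]]] [[va' vq']|[w' [vw' wq]]].
  - exact: (uniq_flatten_inj uF pF qF vp' vq').
  - by case: (nab v); rewrite // vw' cross_copy.
  - by case: (nab v); rewrite // vw cross_copy.
  - have [wa _ _] := Fa w (inF _ _ pF wp); have [wa' _ _] := Fa w' (inF _ _ qF wq).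
    apply: (uniq_flatten_inj uF pF qF wp); rewrite (binj w w') // -vw -vw' //.
exists (P1 :: P2 :: map f F).
have uall : uniq (flatten (P1 :: P2 :: map f F)).
  change (uniq (P1 ++ P2 ++ flatten (map f F))).
  rewrite cat_uniq; apply/and3P; split.
  - rewrite rcons_uniq uI andbT; apply/negP=> /Ia[_ _]; by rewrite eqxx.
  - apply/hasPn=> v; rewrite mem_cat => vv; apply/negP=> /P1v[va vx vF].
    case/orP: vv => [/P2v[w [vw _ _ _]]|/flattenP[_ /mapP[p pF ->]] /(fv p v pF)].
      by apply: (nab v); rewrite // vw cross_copy.
    case=> [[_ vp]|[w [vw _]]]; first by case/negP: vF; apply: inF vp.
    by apply: (nab v); rewrite // vw cross_copy.
  rewrite cat_uniq uf andbT; apply/andP; split.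
    rewrite -[P2]/(map (cross b) (x :: I)) map_inj_in_uniq /= ?uI ?andbT.
      by apply/negP=> /Ia[_]; rewrite eqxx.
    have Xa (u : 'S_n.+1) : u \in x :: I -> u ord0 = a by rewrite inE => /predU1P[->//|/Ia[]].
    by move=> u v /Xa ua /Xa va; apply: binj.
  apply/hasPn=> v /flattenP[_ /mapP[p pF ->]] /(fv p v pF) vv.
  apply/negP=> /P2v[w [vw wa wy wF]].
  case: vv => [[va _]|[w' [vw' w'p]]]; first by apply: (nab v); rewrite // vw cross_copy.
  have w'F := inF _ _ pF w'p; have [wa' _ _] := Fa _ w'F.
  by case/negP: wF; rewrite (binj w w') // -vw -vw'.
split=> //.
- by rewrite /= size_map sF prednK //; case: (n) n3.
- apply: (uniq_nonempty uall) => p; rewrite !inE => /or3P[/eqP->|/eqP->|/mapP[q _ ->]] //.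
  by rewrite /nilp size_rcons.
- move=> p; rewrite !inE => /or3P[/eqP->|/eqP->|/mapP[q qF ->]].
  + rewrite rcons_path (rim_path_CW n3 pI) last_rcons /= -y1y; exact: crossbe.
  + rewrite /= crossbe //= -y1y -map_rcons rim_path_CW //; exact: cross_rim_path.
  + have [nq pq] := FP q qF; case: q nq pq qF => //= u q _ /andP[xu uq] qF.
    rewrite (CW_rim n3 xu) /= crossbe ?(rim_copy n3 xu) //= -y1y -map_rcons rim_path_CW //.
    exact: cross_rim_path.
- have na (u : 'S_n.+1) : u ord0 = a -> u != y.
    by move=> ua; apply/eqP=> uy; apply: (nab u) => //; rewrite uy.
  have nb (u : 'S_n.+1) : cross b u != x.
    by apply/eqP=> E; apply: (nab x) => //; rewrite -E cross_copy.
  have nby (u : 'S_n.+1) : u ord0 = a -> u != y1 -> cross b u != y.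
    by move=> ua; apply: contra_neq; rewrite -[in X in X -> _]y1y; apply: binj.
  move=> v vv; have : [|| v \in P1, v \in P2 | v \in flatten (map f F)].
    by rewrite -!mem_cat.
  case/or3P=> [/P1v[va vx _]|/P2v[w [-> wa wy _]]|].
  + by split=> //; split; [apply: na | left].
  + by split=> //; split; [apply: nby | right; rewrite cross_copy].
  case/flattenP=> _ /mapP[p pF ->] /(fv p v pF)[[va vp]|[w [-> wp]]].
    have [_ vx vy1] := Fa _ (inF _ _ pF vp).
    by split=> //; split; [apply: na | left].
  have [wa _ wy1] := Fa _ (inF _ _ pF wp).
  by split=> //; split; [apply: nby | right; rewrite cross_copy].
Qed.

End Prism.

(** F may contain the empty path, whose footprint is c. Hence c must avoid the other paths, and F
    must be duplicate-free, which disjointness alone does not ensure for empty paths. *)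
Lemma tsystem_const (V : finType) (e : rel V) (T : seq V) (c : V) (F : seq (seq V)) :
  uniq F -> uniq (flatten F) -> c \notin flatten F ->
  {in F, forall p, is_item e T (c, p)} ->
  tsystem e T (c |: [set v in flatten F]) [seq (c, p) | p <- F].
Proof.
move=> uF uFF cF FP; have inF p v : p \in F -> v \in p -> v \in flatten F.
  by move=> pF vp; apply/flattenP; exists p.
have fP p v : v \in footprint (c, p) -> (p = [::] /\ v = c) \/ v \in p.
  by case: p => [|a p]; [rewrite inE => /eqP->; left | right].
split.
- by move=> it /mapP[p /FP ip ->].
- rewrite -map_comp; apply: uniq_flatten_map => // [p pF|p q v pF qF].
    by have := uniq_flatten_mem uFF pF; case: (p).
  case/fP=> [[p0 vc]|vp] /fP[[q0 vc']|vq].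
  + by rewrite p0 q0.
  + by case/negP: cF; rewrite -vc; apply: inF vq.
  + by case/negP: cF; rewrite -vc'; apply: inF vp.
  + exact: (uniq_flatten_inj uFF pF qF vp vq).
move=> v /flattenP[_ /mapP[_ /mapP[p pF ->] ->]] /fP[[_ ->]|vp].
  exact: setU11.
by apply: setU1r; rewrite inE; apply: inF vp.
Qed.

(** * Links through the copy of a terminal *)

Section InnerLinks.

Variable n : nat.
Hypothesis n3 : 2 < n.

Implicit Types (g h s t u w x y z : 'S_n.+1) (i j k : 'I_n.+1).
Implicit Types (T : seq 'S_n.+1) (js : seq 'I_n.+1).

Local Notation e := (CW n.+1).

Lemma inner_item T z u w a q : perm_eq [:: z; u; w] T ->
  u ord0 != z ord0 -> w ord0 != z ord0 -> rim z a -> path (@rim n) a q ->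
  last a q = cross (z ord0) u ->
  {in a :: q, forall v, (v \in copy (z ord0)) && (v \notin [set z])} ->
  is_item e T (w, a :: q).
Proof.
move=> pT uz wz za aq lq IP; apply: (item_rim_path pT).
  rewrite rcons_cons /= (CW_rim n3 za) rcons_path rim_path_CW //= lq.
  by rewrite CW_sym (CW_cross n3) // eq_sym.
move=> v /IP; rewrite !inE => /andP[/eqP v0 vz].
rewrite -(perm_mem pT) !inE (negbTE vz) /= negb_or.
by apply/andP; split; apply/eqP=> E; [move: uz | move: wz]; rewrite -E v0 eqxx.
Qed.

(** Links within this region spend only the rim neighbours of z in H; the others stay available as
    exits. *)
Definition inner_region z (H : {set 'S_n.+1}) : {set 'S_n.+1} :=
  copy (z ord0) :\: (z |: (rimN z :\: H)).

Lemma one_inner_link T z u w : perm_eq [:: z; u; w] T ->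
  u ord0 != z ord0 -> w ord0 != z ord0 -> uniq T ->
  exists h L, tsystem e T (w |: inner_region z [set h]) L /\
    forall c, count_type c L = (w == c).
Proof.
move=> pT uz wz uT; have [Euz|nuz] := eqVneq (cross (z ord0) u) z.
  (* The link is the edge z u. As z is not its own rim neighbour, this choice of h spends no
     exit. *)
  exists z, [:: (w, [::])]; split; last by move=> c; rewrite /count_type /= addn0.
  apply: (@tsystem_sub _ _ _ [set w]); first by apply/subsetP=> v /set1P->; apply: setU11.
  apply: (tsystem_edge (a := z) (b := u)).
    by apply: perm_trans pT; have /permPl := perm_catC [:: w] [:: z; u].
  by rewrite CW_sym -{1}Euz (CW_cross n3) // eq_sym.
have uN : #|rimN z| = n by apply: rim_degree.
have [|||||||F [sF uF FP]] :=
  @link n n3 (z ord0) [set z] (rimN z) [set cross (z ord0) u] 1.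
- by apply/subsetP=> v; rewrite in_rimN => zv; rewrite inE (rim_copy n3 zv).
- by apply/subsetP=> v /set1P->; rewrite inE cross_copy.
- by rewrite disjoint_sym disjoints1 in_rimN (rim_irr n3).
- by rewrite disjoints1 in_set1.
- by rewrite uN; apply: ltnW (ltnW n3).
- by rewrite cards1.
- by rewrite cards1 ltnW.
case: F sF uF FP => [|p [|p' F]] //= _; rewrite cats0 => up /(_ _ (mem_head _ _)).
case=> a [q [Ep aN aq /set1P lq [nA _ pP]]]; subst p.
exists a, [:: (w, a :: q)]; split; last by move=> c; rewrite /count_type /= addn0.
have za : rim z a by rewrite -in_rimN.
apply: tsystem1 => //; first exact: (inner_item pT uz wz za aq lq pP).
move=> v vq; apply: setU1r; have /andP[vc vz] := pP v vq.
rewrite in_setD vc andbT in_setU negb_or vz in_setD /= negb_and negbK.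
by move: vq; rewrite inE => /predU1P[->|/nA ->]; rewrite ?set11 ?orbT.
Qed.

(** The second inner link compensates for a copy where x and y have the same entry. If z itself is
    the entry of x or y, one link is a direct edge and a single rim neighbour is spent, so h1 =
    h2. *)
Lemma two_inner_links x y z : uniq [:: x; y; z] -> x ord0 != z ord0 -> y ord0 != z ord0 ->
  cross (z ord0) x != cross (z ord0) y ->
  exists h1 h2 L, tsystem e [:: x; y; z] ([set x; y] :|: inner_region z [set h1; h2]) L /\
    forall c, count_type c L = (x == c) + (y == c).
Proof.
move=> uT xz yz xy3.
have xy : x != y by move: uT; rewrite /= !inE negb_or -andbA => /and3P[].
have pTx : perm_eq [:: z; x; y] [:: x; y; z].
  by have /permPl := perm_catC [:: z] [:: x; y].
have pTy : perm_eq [:: z; y; x] [:: x; y; z].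
  by rewrite -[[:: z; y; x]]/(rev [:: x; y; z]) perm_rev.
have xin (H : {set 'S_n.+1}) : x \notin inner_region z H by rewrite !inE (negbTE xz) andbF.
have yin (H : {set 'S_n.+1}) : y \notin inner_region z H by rewrite !inE (negbTE yz) andbF.
have edge u w : perm_eq [:: z; u; w] [:: x; y; z] -> u ord0 != z ord0 ->
    cross (z ord0) u = z -> tsystem e [:: x; y; z] [set w] [:: (w, [::])].
  move=> pT uz Eu; apply: (tsystem_edge (a := z) (b := u)).
    by apply: perm_trans pT; have /permPl := perm_catC [:: w] [:: z; u].
  by rewrite CW_sym -{1}Eu (CW_cross n3) // eq_sym.
have combine u w (h : 'S_n.+1) L : [set u; w] = [set x; y] -> u != w ->
    w \notin inner_region z [set h] ->
    tsystem e [:: x; y; z] (u |: inner_region z [set h]) L ->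
    tsystem e [:: x; y; z] [set w] [:: (w, [::])] ->
    tsystem e [:: x; y; z] ([set x; y] :|: inner_region z [set h; h]) (L ++ [:: (w, [::])]).
  move=> Euw uw wi sL sw; apply: tsystem_sub (tsystem_cat _ sL sw).
    by rewrite setUid -Euw setUAC.
  by rewrite disjoint_sym disjoints1 in_setU1 negb_or eq_sym uw.
have [Ex|nx] := eqVneq (cross (z ord0) x) z.
  have [h [L [sL cL]]] := one_inner_link pTy yz xz uT; exists h, h, (L ++ [:: (y, [::])]); split.
    by apply: combine (yin _) sL (edge _ _ pTx xz Ex).
  by move=> c; rewrite count_type_cat cL /count_type /= addn0.
have [Ey|ny] := eqVneq (cross (z ord0) y) z.
  have [h [L [sL cL]]] := one_inner_link pTx xz yz uT; exists h, h, (L ++ [:: (x, [::])]); split.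
    by apply: combine (xin _) sL (edge _ _ pTy yz Ey); rewrite 1?setUC // eq_sym.
  by move=> c; rewrite count_type_cat cL /count_type /= addn0 addnC.
have uN : #|rimN z| = n by apply: rim_degree.
have [|||||||F [sF uF FP]] :=
  @link n n3 (z ord0) [set z] (rimN z) [set cross (z ord0) x; cross (z ord0) y] 2.
- by apply/subsetP=> v; rewrite in_rimN => zv; rewrite inE (rim_copy n3 zv).
- by apply/subsetP=> v /set2P[]->; rewrite inE cross_copy.
- by rewrite disjoint_sym disjoints1 in_rimN (rim_irr n3).
- by rewrite disjoint_sym disjoints1 in_set2 ![z == _]eq_sym negb_or nx.
- by rewrite uN ltnW.
- by rewrite cards2 xy3.
- by rewrite cards1.
case: F sF uF FP => [|p1 [|p2 [|p3 F]]] //= _; rewrite cats0 => uF FP.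
have [a1 [q1 [E1 aN1 aq1 lB1 [nA1 _ pP1]]]] := FP p1 (mem_head _ _).
have [|a2 [q2 [E2 aN2 aq2 lB2 [nA2 _ pP2]]]] := FP p2; first by rewrite !inE eqxx orbT.
subst p1 p2; rewrite in_rimN in aN1; rewrite in_rimN in aN2.
have ll : last a1 q1 != last a2 q2.
  apply/eqP=> l12; move: uF; rewrite cat_uniq => /and3P[_ /hasPn/(_ (last a2 q2)) + _].
  by rewrite mem_last /= -l12 mem_last => /(_ isT).
have subi a q : {in q, forall v, v \notin rimN z} ->
    {in a :: q, forall v, (v \in copy (z ord0)) && (v \notin [set z])} ->
    forall v (H : {set 'S_n.+1}), v \in a :: q -> a \in H -> v \in inner_region z H.
  move=> nA pP v H vq aH; have /andP[vc vz] := pP v vq.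
  rewrite in_setD vc andbT in_setU negb_or vz in_setD /= negb_and negbK.
  by move: vq; rewrite inE => /predU1P[->|/nA ->]; rewrite ?aH ?orbT.
exists a1, a2.
have sys w1 w2 : is_item e [:: x; y; z] (w1, a1 :: q1) ->
    is_item e [:: x; y; z] (w2, a2 :: q2) ->
    tsystem e [:: x; y; z] ([set x; y] :|: inner_region z [set a1; a2])
      [:: (w1, a1 :: q1); (w2, a2 :: q2)].
  move=> i1 i2; split.
  - by move=> it; rewrite !inE => /orP[]/eqP->.
  - by rewrite /= cats0.
  move=> v; rewrite /= cats0 => vq; apply/setUP; right.
  have : (v \in a1 :: q1) || (v \in a2 :: q2) by rewrite -mem_cat.
  by case/orP=> [/(subi _ _ nA1 pP1)|/(subi _ _ nA2 pP2)]; apply; rewrite !inE eqxx ?orbT.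
case/set2P: lB1 lB2 ll => l1 /set2P[l2|l2]; rewrite l1 l2 ?eqxx // => _.
  exists [:: (y, a1 :: q1); (x, a2 :: q2)]; split.
    by apply: sys; [apply: (inner_item pTx) | apply: (inner_item pTy)].
  by move=> c; rewrite /count_type /= addn0 addnC.
exists [:: (x, a1 :: q1); (y, a2 :: q2)]; split; last by move=> c; rewrite /count_type /= addn0.
by apply: sys; [apply: (inner_item pTy) | apply: (inner_item pTx)].
Qed.

(* When cross j x = cross j y, this vertex is a common neighbour of x and y. *)
Lemma cross_collision x y j j' : x ord0 != y ord0 ->
  j != y ord0 -> j' != y ord0 ->
  cross j x = cross j y -> cross j' x = cross j' y -> j = j'.
Proof.
move=> xy0 jb jb' E E'.
have : (x^-1 * y)%g = (tperm (x ord0) j * tperm (y ord0) j)%g.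
  by rewrite -[in LHS](mulgK (tperm (y ord0) j) y) -/(cross j y) -E /cross !mulgA mulVg mul1g tpermV.
have -> : (x^-1 * y)%g = (tperm (x ord0) j' * tperm (y ord0) j')%g.
  by rewrite -[in LHS](mulgK (tperm (y ord0) j') y) -/(cross j' y) -E' /cross !mulgA mulVg mul1g tpermV.
(* The collision determines the copy: [(x^-1 * y)%g] maps [y ord0] to j. *)
move/(congr1 (fun s : 'S_n.+1 => s (y ord0))).
by rewrite !permM (tpermD xy0 jb) (tpermD xy0 jb') !tpermL.
Qed.

End InnerLinks.

Lemma subn_shifts (n : nat) : 2 < n ->
  [/\ 1 + (n - 2) = n - 1, (n - 2).-1 = n - 3, 1 + (n - 3) = n - 2 &
      1 + (n - 3 + 1) = n - 1].
Proof. by split; lia. Qed.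

(** * Three terminals in three copies *)

Section ThreeCopies.

Variable n : nat.
Hypothesis n3 : 2 < n.

Implicit Types (g h s t u w x y z : 'S_n.+1) (i j k : 'I_n.+1).
Implicit Types (T : seq 'S_n.+1) (js : seq 'I_n.+1).

Local Notation e := (CW n.+1).

(** The prism over the copies of x and y gives n + 1 items of type z. A copy in [js1], entered by an
    exit of z, gives links z-x and z-y; a copy in [js2] gives only a link x-z. *)
Lemma three_copies_glue x y z (H : {set 'S_n.+1}) LI es js1 js2 :
  uniq [:: x; y; z] -> x ord0 != y ord0 -> x ord0 != z ord0 -> y ord0 != z ord0 ->
  tsystem e [:: x; y; z] ([set x; y] :|: inner_region z H) LI ->
  uniq es -> {in es, forall s, rim z s && (s \notin H)} ->
  uniq (js1 ++ js2) -> {in js1 ++ js2, forall j, [/\ j != x ord0, j != y ord0 & j != z ord0]} ->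
  size es = size js1 -> {in js1, forall j, cross j x != cross j y} ->
  exists R L, [/\ tsystem e [:: x; y; z] R L,
    count_type z L = count_type z LI + n.+1,
    count_type y L = count_type y LI + size (js1 ++ js2) &
    count_type x L = count_type x LI + size js1].
Proof.
move=> uT xy0 xz0 yz0 sysI ues esP ujs jsP ses noc.
have [xy xz yz] : [/\ x != y, x != z & y != z].
  by move: uT; rewrite /= !inE negb_or andbT => /andP[/andP[-> ->] ->].
have [yx zx zy] : [/\ y != x, z != x & z != y] by split; rewrite eq_sym.
have neq := (negbTE xy, negbTE xz, negbTE yz, negbTE yx, negbTE zx, negbTE zy).
have [F [sF uF uFF FP Fv]] := prism n3 xy0.
have Fz v : v \in flatten F -> v ord0 != z ord0.
  by move=> /Fv[_ [_ []]] ->.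
have Fjs v : v \in flatten F -> v ord0 \notin js1 ++ js2.
  by move=> /Fv[_ [_ []]] ->; apply/negP=> /jsP[]; rewrite eqxx.
have sysP : tsystem e [:: x; y; z] (z |: [set v in flatten F]) [seq (z, p) | p <- F].
  apply: tsystem_const => //; first by apply/negP=> /Fz; rewrite eqxx.
  move=> p pF; apply: item_rim_path (perm_refl _) (FP p pF) _ => v vp.
  have vF : v \in flatten F by apply/flattenP; exists p.
  have [vx [vy _]] := Fv v vF; rewrite !inE (negbTE vx) (negbTE vy) /=.
  by apply: contraNneq (Fz v vF) => ->.
have es0 s : s \in es -> s ord0 = z ord0 by move=> /esP/andP[/(rim_copy n3)].
have nrx s : s \in es -> ~~ rim x s.
  by move=> /es0 s0; apply/negP=> /(rim_copy n3); rewrite s0 => E; rewrite E eqxx in xz0.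
move: (ujs); rewrite cat_uniq => /and3P[ujs1 /hasPn djs ujs2].
have fr js : {subset js <= js1 ++ js2} -> fresh js [:: x; y; z].
  move=> sub j t /sub/jsP[jx jy jz]; rewrite !inE => /or3P[]/eqP->; done.
have sub1 : {subset js1 <= js1 ++ js2} by move=> j jjs; rewrite mem_cat jjs.
have sub2 : {subset js2 <= js1 ++ js2} by move=> j jjs; rewrite mem_cat jjs orbT.
have [|||L1 [sys1 c1]] := exits_through_copies n3 uT ujs1 (fr _ sub1) ues ses.
- move=> s ss; have /andP[zs _] := esP s ss; rewrite zs orbT; split=> //.
  rewrite !inE !negb_or; apply/and3P; split; apply/eqP=> E.
  + by rewrite -(es0 s ss) E eqxx in xz0.
  + by rewrite -(es0 s ss) E eqxx in yz0.
  + by move: zs; rewrite E (rim_irr n3).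
- by move=> s j /nrx/negP.
- by move=> s j _ jjs _; apply: noc.
have [L2 [sys2 c2]] := links_through_copies n3 uT ujs2 (fr _ sub2).
have nx : count (rim x) es = 0.
  by apply/eqP; rewrite -leqn0 leqNgt -has_count; apply/hasPn.
have npx : count (predC (rim x)) es = size js1.
  by rewrite -ses -(count_predC (rim x) es) nx.
have d12 : [disjoint [set s in es] :|: copies js1 & copies js2].
  rewrite disjoint_subset; apply/subsetP=> v; rewrite !inE => /orP[/es0 ->|v1].
    by apply/negP=> /sub2/jsP[]; rewrite eqxx.
  by apply/negP=> /djs; rewrite /= v1.
have sys12 := tsystem_cat d12 sys1 sys2.
have dP : [disjoint [set x; y] :|: inner_region z H & z |: [set v in flatten F]].
  rewrite disjoint_subset; apply/subsetP=> v vI; rewrite inE /= !inE negb_or.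
  case/setUP: vI => [/set2P vxy|].
    apply/andP; split; first by case: vxy => ->.
    by apply/negP=> /Fv[vx [vy _]]; case: vxy => E; rewrite E eqxx in vx vy.
  rewrite !inE !negb_or => /andP[/andP[-> _] /eqP v0] /=.
  by apply/negP=> /Fz; rewrite v0 eqxx.
have sysIP := tsystem_cat dP sysI sysP.
eexists _, ((LI ++ [seq (z, p) | p <- F]) ++ (L1 ++ L2)); split.
- apply: tsystem_cat sysIP sys12; rewrite disjoint_subset; apply/subsetP=> v vIP.
  rewrite inE /= in_setU negb_or in_setU negb_or ![v \in copies _]inE [v \in [set _ in es]]inE.
  rewrite -andbA -negb_or -mem_cat; case/setUP: vIP => [/setUP[/set2P vxy|]|/setU1P[->|]].
  + apply/andP; split.
      by apply/negP=> /es0; case: vxy => -> E; move: xz0 yz0; rewrite E eqxx.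
    by apply/negP=> /jsP[vx vy _]; case: vxy => E; rewrite E eqxx in vx vy.
  + rewrite !inE !negb_or negb_and negbK => /andP[/andP[_ vH] /eqP v0].
    apply/andP; split; last by rewrite v0; apply/negP=> /jsP[]; rewrite eqxx.
    apply/negP=> ves; have /andP[zv vH'] := esP v ves.
    by move: vH; rewrite zv (negbTE vH').
  + apply/andP; split; last by apply/negP=> /jsP[]; rewrite eqxx.
    by apply/negP=> /esP/andP[]; rewrite (rim_irr n3).
  + rewrite inE => vF; rewrite Fjs // andbT.
    by apply/negP=> /es0 v0; have := Fz v vF; rewrite v0 eqxx.
- rewrite !count_type_cat count_family c1 c2 nx sF !eqxx !neq.
  by rewrite !mul0n mul1n muln0 !addn0.
- rewrite !count_type_cat count_family c1 c2 !eqxx !neq size_cat.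
  by rewrite !mul0n !mul1n !add0n addn0.
- rewrite !count_type_cat count_family c1 c2 npx !eqxx !neq.
  by rewrite !mul0n !mul1n !addn0.
Qed.

(** There are n - 2 copies without terminals. If x and y have distinct entries in all of them, these
    copies give n - 2 items of each of the types x and y, and one inner link adds one of type y. If
    the entries collide in j0, that copy loses its item of type x, and two inner links restore the
    same totals. *)
Lemma system_three_copies x y z : x ord0 != y ord0 -> x ord0 != z ord0 -> y ord0 != z ord0 ->
  exists R L, [/\ tsystem e [:: x; y; z] R L, count_type z L = n.+1,
    count_type y L = n - 1 & count_type x L = n - 2].
Proof.
move=> xy0 xz0 yz0.
have uT : uniq [:: x; y; z].
  rewrite /= !inE negb_or andbT; apply/andP; split; [apply/andP; split|];
    by apply/eqP=> E; rewrite E eqxx in xy0 xz0 yz0.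
have [xy xz yz] : [/\ x != y, x != z & y != z].
  by move: uT; rewrite /= !inE negb_or andbT => /andP[/andP[-> ->] ->].
have [yx zx zy] : [/\ y != x, z != x & z != y] by split; rewrite eq_sym.
have neq := (negbTE xy, negbTE xz, negbTE yz, negbTE yx, negbTE zx, negbTE zy).
have uN : #|rimN z| = n by apply: rim_degree.
have [ar1 ar2 ar3 ar4] := subn_shifts n3.
pose js := enum (~: [set x ord0; y ord0; z ord0]).
have ujs : uniq js by apply: enum_uniq.
have jsP j : j \in js -> [/\ j != x ord0, j != y ord0 & j != z ord0].
  by rewrite mem_enum !inE !negb_or -andbA => /and3P.
have sjs : size js = n - 2.
  rewrite size_enum_set cardsCs setCK card_ord -setUA cardsU1 cards2 !inE negb_or.
  by rewrite xy0 xz0 yz0 subSS.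
have [j0 /andP[j0js /eqP col]|nocol] :=
  pickP (fun j => (j \in js) && (cross j x == cross j y)); last first.
  have pTx : perm_eq [:: z; x; y] [:: x; y; z].
    by have /permPl := perm_catC [:: z] [:: x; y].
  have [h [LI [sysI cI]]] := one_inner_link n3 pTx xz0 yz0 uT.
  have {}sysI : tsystem e [:: x; y; z] ([set x; y] :|: inner_region z [set h]) LI.
    apply: tsystem_sub sysI; apply/subsetP=> v; rewrite !in_setU !in_set1.
    by case/orP=> ->; rewrite ?orbT.
  pose es := take (n - 2) (enum (rimN z :\ h)).
  have ses : size es = n - 2.
    rewrite size_takel // size_enum_set; have := cardsD1 h (rimN z); rewrite uN.
    by move: #|_ :\ _| => c E; rewrite leq_subLR E leq_add // (leq_trans (leq_b1 _)).
  have [||||||R [L [sL cz cy cx]]] :=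
    @three_copies_glue x y z [set h] LI es js [::] uT xy0 xz0 yz0 sysI.
  - by rewrite take_uniq ?enum_uniq.
  - by move=> s /mem_take; rewrite mem_enum !inE => /andP[-> ->].
  - by rewrite cats0.
  - by rewrite cats0.
  - by rewrite ses sjs.
  - by move=> j jjs; have := nocol j; rewrite jjs => /negbT.
  exists R, L; split=> //.
  - by rewrite cz cI neq.
  - by rewrite cy cI eqxx cats0 sjs.
  - by rewrite cx cI neq sjs.
have [j0x j0y j0z] := jsP j0 j0js.
have noc j : j != y ord0 -> j != j0 -> cross j x != cross j y.
  by move=> jy; apply: contra_neq => E; apply: (cross_collision xy0 jy j0y E col).
(* The collision in j0 is the only one, so the copy of z is free of it. *)
have nocz : cross (z ord0) x != cross (z ord0) y by apply: noc; rewrite eq_sym.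
have [h1 [h2 [LI [sysI cI]]]] := two_inner_links n3 uT xz0 yz0 nocz.
pose es := take (n - 3) (enum (rimN z :\: [set h1; h2])).
have ses : size es = n - 3.
  rewrite size_takel // size_enum_set; have := cardsID [set h1; h2] (rimN z); rewrite uN.
  have : #|rimN z :&: [set h1; h2]| <= 2.
    by apply: leq_trans (subset_leq_card (subsetIr _ _)) _; rewrite cards2; case: (_ != _).
  by move: #|_ :&: _| #|_ :\: _| => c1 c2 H1 H2; rewrite leq_subLR -H2 leq_add2r (leq_trans H1).
have [||||||R [L [sL cz cy cx]]] :=
  @three_copies_glue x y z [set h1; h2] LI es (rem j0 js) [:: j0] uT xy0 xz0 yz0 sysI.
- by rewrite take_uniq ?enum_uniq.
- by move=> s /mem_take; rewrite mem_enum in_setD in_rimN => /andP[-> ->].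
- by rewrite uniq_catC /= mem_rem_uniq // !inE eqxx rem_uniq.
- by move=> j; rewrite mem_cat => /orP[/mem_rem/jsP //|]; rewrite inE => /eqP->.
- by rewrite ses size_rem // sjs.
- by move=> j; rewrite mem_rem_uniq // inE => /andP[jj /jsP[_ jy _]]; apply: noc.
have srem : size (rem j0 js) = n - 3 by rewrite size_rem // sjs.
exists R, L; split=> //.
- by rewrite cz cI !neq.
- by rewrite cy cI eqxx !neq size_cat srem.
- by rewrite cx cI eqxx !neq addn0 srem.
Qed.

End ThreeCopies.

(** * Upper bound *)

Section UpperBound.

Variables (V : finType) (e : rel V).
Hypothesis e_sym : symmetric e.
Hypothesis e_irr : irreflexive e.

Implicit Types (P : seq V) (Om : {set V}) (t u v w : V).

Lemma pedges_mem s1 u v s2 : [set u; v] \in pedges (s1 ++ u :: v :: s2).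
Proof.
elim: s1 => [|a s1 IH]; first by rewrite pedges_cons eqxx.
by case: s1 IH => [|b s1] IH; rewrite /= pedges_cons; apply/orP; right.
Qed.

Lemma set2_inj u v u' : u != v -> [set u; v] = [set u'; v] -> u = u'.
Proof.
move=> uv E; have : u \in [set u'; v] by rewrite -E set21.
by rewrite !inE (negbTE uv) orbF => /eqP.
Qed.

Lemma pedges_arc P t v : sorted e P -> [set t; v] \in pedges P -> e t v.
Proof.
case: P => [|a s]; first by move=> _ /imsetP[].
elim: s a => [|b s IH] a; first by move=> _ /imsetP[].
move=> /= /andP[ab bs]; rewrite pedges_cons => /predU1P[E|]; last exact: IH.
have anb : a != b by apply: contraTneq ab => ->; rewrite e_irr.
have tab : t \in [set a; b] by rewrite -E set21.
have vab : v \in [set a; b] by rewrite -E set22.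
have tv : t != v.
  apply/eqP=> tv; case/eqP: anb; have : a \in [set t; v] by rewrite E set21.
  have : b \in [set t; v] by rewrite E set22.
  by rewrite tv !inE !orbb => /eqP-> /eqP->.
case/set2P: tab vab tv => -> /set2P[]->; rewrite ?eqxx ?ab // => _.
by rewrite e_sym.
Qed.

Lemma pedges_nbr s1 w s2 u : uniq (s1 ++ w :: s2) -> u != w ->
  [set u; w] \in pedges (s1 ++ w :: s2) ->
  (exists s, s2 = u :: s) \/ (exists s, s1 = rcons s u).
Proof.
move=> + uw; elim: s1 => [|a s1 IH] /=.
  case: s2 => [|v s2] /=; first by move=> _ /imsetP[].
  case/andP=> wvs _; rewrite pedges_cons => /predU1P[E|].
    left; exists s2; rewrite [[set w; v]]setUC in E.
    by rewrite (set2_inj uw E).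
  move/pedges_sub/subsetP/(_ w); rewrite set22 => /(_ isT).
  by rewrite inE (negbTE wvs).
case/andP=> aw us; have anw : w != a.
  by apply: contraNneq aw => <-; rewrite mem_cat mem_head orbT.
case: s1 IH aw us => [|b s1] IH aw us /=; rewrite pedges_cons => /predU1P[E|].
- by right; exists [::]; rewrite (set2_inj uw E).
- by case/(IH us) => [|[s]]; [left | case: s].
- have : w \in [set a; b] by rewrite -E set22.
  rewrite !inE (negbTE anw) /= => /eqP wb; move: us => /=.
  by rewrite -wb mem_cat mem_head orbT.
by case/(IH us) => [|[s ->]]; [left | right; exists (a :: s)].
Qed.

(** The edge ends of P at terminals; an edge inside Om counts at both of its ends. *)
Definition incid Om P : {set V * V} :=
  [set tv | (tv.1 \in Om) && ([set tv.1; tv.2] \in pedges P)].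

(** If a, b, c are the terminals in their order on P, there is an edge end after a, one on each side
    of b, and one before c. *)
Lemma card_incid Om P : #|Om| = 3 -> omega_path e Om P -> 3 < #|incid Om P|.
Proof.
move=> cOm /andP[/andP[_ uP] /subsetP OP].
have split_at (s : seq V) (A : {set V}) : A != set0 -> {subset A <= s} ->
    exists b s1 s2, [/\ s = s1 ++ b :: s2, b \in A & {in s1, forall v, v \notin A}].
  move=> A0 As; have hA : has (mem A) s.
    by have [b bA] := set0Pn _ A0; apply/hasP; exists b => //; apply: As.
  elim: s hA {As} => //= c s IH; case: (boolP (c \in A)) => [cA _|cA /= /IH].
    by exists c, [::], s.
  move=> [b [s1 [s2 [-> bA nA]]]]; exists b, (c :: s1), s2; split=> // v.
  by rewrite inE => /predU1P[->|/nA].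
have [||a [p0 [r [EP aO n0]]]] := split_at P Om.
- by rewrite -card_gt0 cOm.
- by move=> v /OP; rewrite inE.
have sub1 : {subset Om :\ a <= r}.
  move=> v /setD1P[va vO]; have := OP v vO; rewrite inE EP mem_cat inE (negbTE va) /=.
  by case/orP=> // /n0; rewrite vO.
have [|b [p1 [r' [Er bO n1]]]] := split_at r (Om :\ a) _ sub1.
- by rewrite -card_gt0; have := cardsD1 a Om; rewrite cOm aO add1n => -[<-].
have sub2 : {subset Om :\ a :\ b <= r'}.
  move=> v vO; have := vO; move=> /setD1P[vb vO1]; have := sub1 v vO1.
  by rewrite Er mem_cat inE (negbTE vb) /= => /orP[/n1|//]; rewrite vO1.
have [|c [p2 [p3 [Er' cO n2]]]] := split_at r' (Om :\ a :\ b) _ sub2.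
- rewrite -card_gt0; have := cardsD1 a Om; rewrite cOm aO add1n => -[].
  by rewrite (cardsD1 b (Om :\ a)) bO add1n => -[<-].
have {cO} [cb ca cO] : [/\ c != b, c != a & c \in Om] by move: cO => /setD1P[-> /setD1P[]].
have {bO} [ba bO] : b != a /\ b \in Om by case/setD1P: bO.
have [v [s Ev]] : exists v s, p1 ++ b :: r' = v :: s.
  by case: (p1) => [|v s]; [exists b, r' | exists v, (s ++ b :: r')].
have [s' [u Eu]] : exists s' u, a :: p1 = rcons s' u.
  by exists (belast a p1), (last a p1); apply: lastI.
have [v' [s'' Ev']] : exists v' s'', p2 ++ c :: p3 = v' :: s''.
  by case: (p2) => [|v' s'']; [exists c, p3 | exists v', (s'' ++ c :: p3)].
have [s3 [u' Eu']] : exists s3 u', b :: p2 = rcons s3 u'.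
  by exists (belast b p2), (last b p2); apply: lastI.
have uv' : u != v'.
  apply/eqP=> uv'; move: uP; rewrite EP Er Er' Ev' -cat_cons Eu cat_uniq.
  case/and3P=> _ _; rewrite cat_uniq => /and3P[_ /hasPn/(_ v') + _].
  by rewrite -uv' !inE eqxx orbT /= mem_rcons mem_head => /(_ isT).
pose l := [:: (a, v); (b, u); (b, v'); (c, u')].
have ul : uniq l.
  by rewrite /= !inE !xpair_eqE ![a == _]eq_sym ![b == c]eq_sym
    (negbTE ba) (negbTE cb) (negbTE ca) (negbTE uv') !andbF.
rewrite -[3.+1]/(size l) -(card_uniqP ul); apply: subset_leq_card.
have seg1 : [set a; v] \in pedges P by rewrite EP Er Ev; apply: pedges_mem.
have seg2 : [set b; u] \in pedges P.
  have -> : P = (p0 ++ s') ++ u :: b :: r' by rewrite EP Er -cat_cons Eu cat_rcons catA.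
  by rewrite setUC; apply: pedges_mem.
have seg3 : [set b; v'] \in pedges P.
  have -> : P = (p0 ++ a :: p1) ++ b :: v' :: s'' by rewrite EP Er Er' Ev' -catA.
  exact: pedges_mem.
have seg4 : [set c; u'] \in pedges P.
  have -> : P = (p0 ++ a :: (p1 ++ s3)) ++ u' :: c :: p3.
    by rewrite EP Er Er' -(cat_cons b) Eu' cat_rcons -[RHS]catA cat_cons -catA.
  by rewrite setUC; apply: pedges_mem.
apply/subsetP=> tv; rewrite !inE.
by case/or4P=> /eqP-> /=; apply/andP; split.
Qed.

(* A common neighbour lies on at most one path and has at most two edges on it. *)
Lemma omega_family_bound Om (W : {set V}) D (F : {set #|V|.-bseq V}) :
  #|Om| = 3 -> {in Om, forall t, #|[set v | e t v]| <= D} ->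
  {in W, forall w, w \notin Om /\ {in Om, forall t, e t w}} ->
  omega_family e Om F -> 4 * #|F| + #|W| <= 3 * D.
Proof.
move=> cOm deg WP /andP[/forallP Fo /forallP Fd].
have oF (P : #|V|.-bseq V) : P \in F -> omega_path e Om P by move=> PF; have := implyP (Fo P) PF.
have dF (P Q : #|V|.-bseq V) : P \in F -> Q \in F -> P != Q -> int_disjoint Om P Q.
  by move=> PF QF; have := forallP (implyP (Fd P) PF) Q => /implyP/(_ QF)/implyP.
pose I := [set tv : V * V | (tv.1 \in Om) && e tv.1 tv.2].
have cI : #|I| <= 3 * D.
  have -> : #|I| = \sum_(t in Om) #|[set v | e t v]|.
    rewrite -sum1_card (eq_bigr (fun t => \sum_(v in [set v | e t v]) 1)); last first.
      by move=> t _; rewrite sum1_card.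
    rewrite pair_big_dep /=; apply: eq_bigl => -[t v]; by rewrite !inE.
  by rewrite -cOm -sum_nat_const; apply: leq_sum.
pose used tv := [exists P : #|V|.-bseq V in F, tv \in incid Om P].
have incidI (P : #|V|.-bseq V) : P \in F -> incid Om P \subset I.
  move=> /oF /andP[/andP[sP _] _]; apply/subsetP=> -[t v]; rewrite !inE /=.
  by case/andP=> -> /(pedges_arc sP).
have one tv (P Q : #|V|.-bseq V) : P \in F -> Q \in F -> tv \in incid Om P -> tv \in incid Om Q -> P = Q.
  move=> PF QF; rewrite !inE => /andP[_ EP] /andP[_ EQ]; apply/eqP/negPn/negP=> PQ.
  have /andP[_ dPQ] := dF P Q PF QF PQ.
  by have := disjointFr dPQ EP; rewrite EQ.
(* Each path uses four edge ends, and by edge-disjointness no end is used by two paths. *)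
have cU : 4 * #|F| <= #|[set tv in I | used tv]|.
  apply: (@leq_trans (\sum_(P in F) #|incid Om P|)).
    by rewrite mulnC -sum_nat_const; apply: leq_sum => P /oF; apply: card_incid.
  rewrite (eq_bigr (fun P : #|V|.-bseq V => \sum_(tv in I) (tv \in incid Om P : nat))); last first.
    move=> P PF; rewrite -sum1_card [RHS]big_mkcond [LHS]big_mkcond /=; apply: eq_bigr => tv _.
    have := subsetP (incidI P PF) tv; case: (tv \in incid Om P) => [-> //|_].
    by case: ifP.
  rewrite exchange_big /= -[X in _ <= X]sum1_card [X in _ <= X]big_mkcond [X in X <= _]big_mkcond /=.
  apply: leq_sum => tv _.
  have -> : (tv \in [set tv in I | used tv]) = (tv \in I) && used tv by apply: in_set.
  case: (tv \in I) => //=.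
  case: (boolP (used tv)) => [/existsP[P /andP[PF tvP]]|nu].
    rewrite (bigD1 P) //= tvP big1 // => Q /andP[QF QP].
    case: (boolP (tv \in incid Om Q)) => // tvQ.
    by rewrite (one tv Q P QF PF tvQ tvP) eqxx in QP.
  rewrite big1 // => P PF; case: (boolP (tv \in incid Om P)) => // tvP.
  by case/negP: nu; apply/existsP; exists P; rewrite PF.
have miss w : w \in W -> exists2 t, t \in Om & ~~ used (t, w).
  move=> wW; have [wO _] := WP w wW.
  case: (boolP [forall t in Om, used (t, w)]) => [/forallP all_used|]; last first.
    by rewrite negb_forall => /existsP[t]; rewrite negb_imply => /andP[tO nu]; exists t.
  exfalso; have uw t : t \in Om -> exists2 P : #|V|.-bseq V, P \in F & [set t; w] \in pedges P.
    move=> tO; have /existsP[P /andP[PF]] := implyP (all_used t) tO.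
    by rewrite inE => /andP[_ tP]; exists P.
  have [t0 t0O] : exists t0, t0 \in Om by apply/set0Pn; rewrite -card_gt0 cOm.
  have [P PF tP] := uw t0 t0O.
  have wv Q t : [set t; w] \in pedges Q -> w \in pverts Q.
    by move/pedges_sub/subsetP; apply; rewrite set22.
  have uwP t : t \in Om -> [set t; w] \in pedges P.
    move=> tO; have [Q QF tQ] := uw t tO; have [EPQ|PQ] := eqVneq P Q; first by rewrite EPQ.
    have /andP[/eqP iPQ _] := dF P Q PF QF PQ.
    by case/negP: wO; rewrite -iPQ inE (wv _ _ tP) (wv _ _ tQ).
  have /andP[/andP[_ uP] _] := oF P PF.
  have wP : w \in (P : seq V) by have := wv _ _ tP; rewrite inE.
  case/splitPr: wP uP uwP => s1 s2 uP uwP.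
  have sub : Om \subset [set head t0 s2; last t0 s1].
    apply/subsetP=> t tO; have tw : t != w by apply: contraNneq wO => <-.
    have [[s ->]|[s ->]] := pedges_nbr uP tw (uwP t tO); first by rewrite set21.
    by rewrite last_rcons set22.
  have := subset_leq_card sub; rewrite cOm cards2; by case: (_ != _).
pose M := [set tv in I | ~~ used tv].
have cM : #|W| <= #|M|.
  apply: leq_trans (leq_imset_card snd M); apply: subset_leq_card.
  apply/subsetP=> w wW; have [t tO nu] := miss w wW; apply/imsetP; exists (t, w) => //.
  by rewrite !inE /= tO nu andbT; case: (WP w wW) => _; apply.
apply: leq_trans cI; rewrite -(cardsID [set tv | used tv] I); apply: leq_add.
  by apply: leq_trans cU _; apply: subset_leq_card; apply/subsetP=> tv; rewrite !inE.
apply: leq_trans cM _; apply: subset_leq_card; apply/subsetP=> tv; rewrite !inE.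
by rewrite andbC.
Qed.

End UpperBound.

(** * Counting in the wheel graph and the two bounds *)

Section Bounds.

Variable n : nat.
Hypothesis n3 : 2 < n.

Implicit Types (g h s t u w x y z : 'S_n.+1) (i j k p : 'I_n.+1).

Local Notation e := (CW n.+1).

(** This helps to recover the factors from the product: both ends of the edge i are moved, so they
    must occur in every other factorization into two rim transpositions. *)
Lemma tperm_rho_moved i k : i != ord0 -> k != ord0 -> i != k ->
  (tperm k (rho k) * tperm i (rho i))%g i != i /\
  (tperm k (rho k) * tperm i (rho i))%g (rho i) != rho i.
Proof.
move=> i0 k0 ik; have ri := rho_neq n3 i0; have r2i := rho2_neq n3 i0.
have r2k := rho2_neq n3 k0; have rr := inj_eq (rho_inj n3).
split; rewrite permM; apply/eqP=> /(congr1 (tperm i (rho i))); rewrite tpermK.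
  rewrite tpermL; case: tpermP => [E|E E'|_ _ /esym/eqP]; first by rewrite E eqxx in ik.
    by rewrite -E -E' eqxx in r2k.
  by rewrite (negbTE ri).
rewrite tpermR; case: tpermP => [E E'|/(rho_inj n3) E|_ _ /eqP].
- by rewrite E E' eqxx in r2i.
- by rewrite E eqxx in ik.
- by rewrite (negbTE ri).
Qed.

(* False for n = 3, where the rim is a triangle. *)
Lemma tperm_rho_mul i k i' k' : 3 < n ->
  i != ord0 -> k != ord0 -> i' != ord0 -> k' != ord0 -> i != k -> i' != k' ->
  (tperm k (rho k) * tperm i (rho i) = tperm k' (rho k') * tperm i' (rho i'))%g ->
  (i' == i) || (i' == k).
Proof.
move=> n4 i0 k0 i'0 k'0 ik ik' E; apply: contraT; rewrite negb_or => /andP[i'i i'k].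
have [m1 m2] := tperm_rho_moved i'0 k'0 ik'.
have fix_ p : p != i -> p != rho i -> p != k -> p != rho k ->
    (tperm k (rho k) * tperm i (rho i))%g p = p.
  by move=> p1 p2 p3 p4; rewrite permM !tpermD // eq_sym.
have rr := inj_eq (rho_inj n3).
have i'r : (i' == rho i) || (i' == rho k).
  apply: contraT; rewrite negb_or => /andP[a b].
  by move: m1; rewrite -E fix_ // eqxx.
have ri' : (rho i' == i) || (rho i' == k).
  apply: contraT; rewrite negb_or => /andP[a b].
  by move: m2; rewrite -E fix_ ?eqxx // rr.
have [r2i r2k] := (rho2_neq n3 i0, rho2_neq n3 k0).
have [r3i r3k] := (rho3_neq n3 n4 i0, rho3_neq n3 n4 k0).
have [r1i r1k] := (rho_neq n3 i0, rho_neq n3 k0).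
pose f := (tperm k (rho k) * tperm i (rho i))%g.
have swap q : i' != q -> rho i' != q -> f q = i' -> f i' = q -> False.
  move=> i'q ri'q; rewrite /f E !permM => fq /(congr1 (tperm i' (rho i'))).
  rewrite tpermK [RHS]tpermD //; case: tpermP => [E1|E1 E2|_ _ E1].
  - by rewrite E1 eqxx in ik'.
  - move: fq; rewrite -E2 tpermL -E1 tpermL => E3.
    by have := rho_neq n3 i'0; rewrite E3 eqxx.
  - by rewrite E1 eqxx in i'q.
(* If the edge i' is neither i nor k, it must lie between these two, which are disjoint as the rim
   has more than three vertices. The product then exchanges i' with a point off the edge i', which
   [swap] excludes. *)
exfalso; case/orP: i'r => /eqP Ei'; case/orP: ri' => /eqP Eri'.
- by rewrite -Ei' Eri' eqxx in r2i.
- have Ek : k = rho (rho i) by rewrite -Eri' Ei'.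
  apply: (swap i); rewrite ?Ei' // /f permM.
    by rewrite [tperm k _ _]tpermD ?tpermL ?Ek.
  by rewrite [tperm k _ _]tpermD ?tpermR // Ek ?rr // eq_sym.
- have Ek : i = rho (rho k) by rewrite -Eri' Ei'.
  apply: (swap k); rewrite ?Ei' // /f permM.
    by rewrite tpermL tpermD // Ek ?rr // eq_sym.
  by rewrite tpermR tpermD // Ek.
- by rewrite -Ei' Eri' eqxx in r2k.
Qed.

(** A common neighbour writes [(z * x^-1)%g] as a product of two rim transpositions, and by
    [tperm_rho_mul] only two choices remain for the edge that leads from x to it. *)
Lemma common_rim x z : 3 < n -> x != z -> #|rimN x :&: rimN z| <= 2.
Proof.
move=> n4 xz; have [->|[w]] := set_0Vmem (rimN x :&: rimN z); first by rewrite cards0.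
rewrite in_setI !in_rimN => /andP[/rimP[i i0 Ei] /rimP[k k0 Ek]].
have key i' k' w' : w' = (tperm i' (rho i') * x)%g -> w' = (tperm k' (rho k') * z)%g ->
    (z * x^-1 = tperm k' (rho k') * tperm i' (rho i'))%g.
  move=> E1 E2; rewrite -[z](mulKg (tperm k' (rho k'))) tpermV -E2 E1 mulgA mulgK.
  by [].
have ne i' k' w' : w' = (tperm i' (rho i') * x)%g -> w' = (tperm k' (rho k') * z)%g -> i' != k'.
  by move=> E1 E2; apply: contra_neq xz => ik; apply: (mulgI (tperm i' (rho i'))); rewrite -E1 E2 ik.
apply: (@leq_trans #|[set (tperm i (rho i) * x)%g; (tperm k (rho k) * x)%g]|); last first.
  by rewrite cards2; case: (_ != _).
apply: subset_leq_card; apply/subsetP=> w'; rewrite in_setI !in_rimN.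
case/andP=> /rimP[i' i'0 Ei'] /rimP[k' k'0 Ek'].
have := tperm_rho_mul n4 i0 k0 i'0 k'0 (ne _ _ _ Ei Ek) (ne _ _ _ Ei' Ek').
rewrite -(key _ _ _ Ei Ek) -(key _ _ _ Ei' Ek') => /(_ erefl).
by rewrite Ei' !inE => /orP[]/eqP->; rewrite eqxx ?orbT.
Qed.

Lemma wheel_degree g : #|[set h | CW n.+1 g h]| <= 2 * n.
Proof.
apply: (@leq_trans #|rimN g :|: [set (tperm ord0 i * g)%g | i in [set~ ord0]]|).
  apply: subset_leq_card; apply/subsetP=> h; rewrite in_set => /(CW_inv n3)[gh|[i i0 ->]].
    by rewrite in_setU in_rimN gh.
  by apply/setUP; right; apply: imset_f; rewrite !inE.
apply: leq_trans (leq_card_setU _ _) _; rewrite mul2n -addnn leq_add //.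
  by rewrite (rim_degree n3).
by apply: leq_trans (leq_imset_card _ _) _; rewrite cardsC1 card_ord.
Qed.

Lemma terminals_lower x y z : uniq [:: x; y; z] ->
  (6 * n.+1 - 9) %/ 4 <= pi_omega e [set x; y; z].
Proof.
set m := _ %/ 4.
have from u v w R L : uniq [:: u; v; w] -> tsystem e [:: u; v; w] R L ->
    2 * m <= count_type u L + count_type v L + count_type w L ->
    m <= count_type u L + count_type v L -> m <= count_type u L + count_type w L ->
    m <= count_type v L + count_type w L -> m <= pi_omega e [set u; v; w].
  by apply: tsystem_pi_omega; apply: CW_sym.
(* 3n - 2 is the number of items in the systems, and 2n - 3 = (n - 1) + (n - 2) is the smallest sum
   of two types, reached with three copies. *)
have [m3 m2] : 2 * m <= 3 * n - 2 /\ m <= 2 * n - 3 by rewrite /m; split; lia.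
have pair (u v w : 'S_n.+1) : uniq [:: u; v; w] -> u ord0 = v ord0 -> w ord0 != v ord0 ->
    m <= pi_omega e [set u; v; w].
  move=> uT uv wv; have [R [L [sL cw cv cu]]] := system_two_copies n3 uT uv wv.
  by apply: (from _ _ _ R L uT sL); rewrite ?cw ?cv ?cu;
    move: (m) m3 m2 n3; clear; lia.
have same (u v w : 'S_n.+1) : uniq [:: u; v; w] -> u ord0 = v ord0 -> w ord0 = v ord0 ->
    ~~ rim u w -> m <= pi_omega e [set u; v; w].
  move=> uT uv wv nuw; have [R [L [sL cw cv cu]]] := system_one_copy n3 uT uv wv nuw.
  have uw : u != w by move: uT; rewrite /= !inE negb_or -andbA => /and3P[].
  have {}cu : (n <= 3 \/ n - 2 <= count_type u L).
    case: (ltnP 3 n) => n4; [right | by left].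
    by apply: leq_trans cu; apply: leq_sub2l; apply: common_rim.
  (* On a triangular rim type u may be empty, but the other two types have three items each, enough
     for three Omega-paths. *)
  have m_3 : n <= 3 -> m <= 3 by rewrite /m; clear; lia.
  by apply: (from _ _ _ R L uT sL); rewrite ?cw ?cv;
    move: (count_type u L) cu (m) m3 m2 m_3 n3; clear; lia.
have distinct (u v w : 'S_n.+1) : u ord0 != v ord0 -> u ord0 != w ord0 -> v ord0 != w ord0 ->
    m <= pi_omega e [set u; v; w].
  move=> uv uw vw; have [R [L [sL cw cv cu]]] := system_three_copies n3 uv uw vw.
  have uT : uniq [:: u; v; w].
    rewrite /= !inE negb_or andbT; apply/andP; split; [apply/andP; split|];
      by apply/eqP=> E; rewrite E eqxx in uv uw vw.
  by apply: (from _ _ _ R L uT sL); rewrite ?cw ?cv ?cu;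
    move: (m) m3 m2 n3; clear; lia.
move=> uT; have [xy xz yz] : [/\ x != y, x != z & y != z].
  by move: uT; rewrite /= !inE negb_or andbT => /andP[/andP[-> ->] ->].
have perm3 (u v w : 'S_n.+1) : u \in [:: x; y; z] -> v \in [:: x; y; z] ->
    w \in [:: x; y; z] -> uniq [:: u; v; w] -> [set x; y; z] = [set u; v; w].
  move=> uX vX wX uU; apply/setP=> p; rewrite !inE -!orbA.
  have sub : {subset [:: u; v; w] <= [:: x; y; z]}.
    by move=> t; rewrite [t \in [:: u; v; w]]inE => /predU1P[->|/predU1P[->|/predU1P[->|]]].
  have [_ E] := uniq_min_size uU sub (leqnn 3).
  by have := E p; rewrite !inE => ->.
have [yx zx zy] : [/\ y != x, z != x & z != y] by split; rewrite eq_sym.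
have neq := (xy, xz, yz, yx, zx, zy).
have inx : x \in [:: x; y; z] by rewrite !inE eqxx.
have iny : y \in [:: x; y; z] by rewrite !inE eqxx orbT.
have inz : z \in [:: x; y; z] by rewrite !inE eqxx !orbT.
have uxzy : uniq [:: x; z; y] by rewrite /= !inE negb_or !neq.
have uyxz : uniq [:: y; x; z] by rewrite /= !inE negb_or !neq.
have uyzx : uniq [:: y; z; x] by rewrite /= !inE negb_or !neq.
have [xy0|xy0] := eqVneq (x ord0) (y ord0).
  have [zy0|zy0] := eqVneq (z ord0) (y ord0); last exact: pair.
  case: (boolP (rim x z)) => [rxz|]; last exact: same.
  case: (boolP (rim x y)) => [rxy|nxy]; last first.
    by rewrite (perm3 x z y) //; apply: same; rewrite // zy0.
  (* Here x is adjacent to both y and z, so y and z have the same parity and are not adjacent; x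
     becomes the source of the fan. *)
  rewrite (perm3 y x z) //; apply: same; rewrite ?xy0 //.
  apply/negP=> ryz; have := rim_odd n3 ryz.
  by rewrite (rim_odd n3 rxz) (rim_odd n3 rxy); case: (odd_perm x).
have [xz0|xz0] := eqVneq (x ord0) (z ord0).
  by rewrite (perm3 x z y) //; apply: pair; rewrite // -xz0 eq_sym.
have [yz0|yz0] := eqVneq (y ord0) (z ord0); last exact: distinct.
by rewrite (perm3 y z x) //; apply: pair; rewrite // -yz0.
Qed.

Lemma terminals_upper : exists2 Om : {set 'S_n.+1}, #|Om| = 3 &
  pi_omega e Om <= (6 * n.+1 - 9) %/ 4.
Proof.
pose b : 'I_n.+1 := inord 1; pose c : 'I_n.+1 := inord 2.
have [bE cE] : b = 1 :> nat /\ c = 2 :> nat by split; rewrite inordK // ltnS ltnW // ltnW.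
have [b0 c0 bc] : [/\ b != ord0, c != ord0 & b != c].
  by split; rewrite -(inj_eq val_inj) /= ?bE ?cE.
have rb : rho b = c by apply: ord_inj; rewrite (rhoE n3) bE cE /=; case: eqP n3 => // <-.
pose t1 := tperm ord0 b; pose t2 := tperm ord0 c; pose t3 := tperm b c.
have [ob oc cb] : [/\ ord0 != b, ord0 != c & c != b] by split; rewrite eq_sym.
(* Each 3-cycle on the three positions is a product of two of these transpositions in three ways,
   with each of them once as left factor. This makes every transposition adjacent to every member of
   [Om]. *)
have E12 : (t1 * t2 = t2 * t3)%g.
  apply/permP=> p; rewrite !permM.
  have [->|p0] := eqVneq p ord0; first by rewrite !tpermL tpermR tpermD.
  have [->|pb] := eqVneq p b; first by rewrite tpermR !tpermL (tpermD ob) ?tpermL.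
  have [->|pc] := eqVneq p c; first by rewrite (tpermD oc bc) !tpermR tpermD.
  by rewrite !tpermD // eq_sym.
have E13 : (t1 * t2 = t3 * t1)%g.
  apply/permP=> p; rewrite !permM.
  have [->|p0] := eqVneq p ord0; first by rewrite !tpermL (tpermD b0) // ?tpermL tpermD.
  have [->|pb] := eqVneq p b; first by rewrite tpermR !tpermL tpermD.
  have [->|pc] := eqVneq p c; first by rewrite (tpermD oc bc) !tpermR.
  by rewrite !tpermD // eq_sym.
have E21 : [/\ (t2 * t1 = t3 * t2)%g & (t2 * t1 = t1 * t3)%g].
  by split; apply: invg_inj; rewrite !invMg !tpermV -/t1 -/t2 -/t3 ?E12 -?E13 -?E12.
have spoke i g : i != ord0 -> e g (tperm ord0 i * g)%g.
  by move=> i0; rewrite -spokeE; apply: (CW_cross n3); rewrite (inj_eq perm_inj).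
have adj t g : t \in [set t1; t2; t3] -> e g (t * g)%g.
  rewrite !inE -orbA => /or3P[]/eqP->; [exact: spoke | exact: spoke |].
  by apply: (CW_rim n3); apply/rimP; exists b; rewrite // rb.
have [T1 T2 T3] : [/\ t1 \in [set t1; t2; t3], t2 \in [set t1; t2; t3] &
    t3 \in [set t1; t2; t3]] by rewrite !inE !eqxx ?orbT.
have inv2 (i k : 'I_n.+1) g : (tperm i k * (tperm i k * g))%g = g.
  by rewrite mulgA tperm2 mul1g.
pose Om := [set 1%g; (t1 * t2)%g; (t2 * t1)%g].
have cOm : #|Om| = 3.
  have at0 (g h : 'S_n.+1) : g ord0 != h ord0 -> g != h by apply: contra_neq => ->.
  have [v1 v2 v3] : [/\ (1%g : 'S_n.+1) ord0 = ord0, (t1 * t2)%g ord0 = b &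
      (t2 * t1)%g ord0 = c].
    by rewrite perm1 !permM !tpermL !tpermD.
  rewrite /Om -setUA cardsU1 cards2 !inE negb_or.
  by rewrite !at0 // ?v1 ?v2 ?v3.
have cW : #|[set t1; t2; t3]| = 3.
  have at0 (g h : 'S_n.+1) : g ord0 != h ord0 -> g != h by apply: contra_neq => ->.
  have [v1 v2 v3] : [/\ t1 ord0 = b, t2 ord0 = c & t3 ord0 = ord0].
    by rewrite !tpermL tpermD.
  rewrite -setUA cardsU1 cards2 !inE negb_or.
  by rewrite !at0 // ?v1 ?v2 ?v3.
exists Om => //; apply/bigmax_leqP => F oF.
(* Three terminals of degree at most 2n, less three wasted ends, leave 6n - 3 = 6(n + 1) - 9 edge
   ends, four per path. *)
suff : 4 * #|F| + 3 <= 3 * (2 * n) by move: #|F|; clear; lia.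
have H := @omega_family_bound _ e (@CW_sym n.+1) (CW_irr (leqW n3)) Om [set t1; t2; t3] (2 * n) F.
rewrite cW in H; apply: H => //.
- by move=> t _; apply: wheel_degree.
move=> w wW; split.
  have ow : odd_perm w.
    by move: wW; rewrite !inE -orbA => /or3P[]/eqP->; rewrite odd_tperm.
  apply: contraL ow; rewrite !inE -orbA => /or3P[]/eqP->.
  - by rewrite odd_perm1.
  - by rewrite odd_permM !odd_tperm ob oc.
  - by rewrite odd_permM !odd_tperm ob oc.
have [E21a E21b] := E21.
have adj' t u v : t \in [set t1; t2; t3] -> v = (t * u)%g -> e u v.
  by move=> tT ->; apply: adj.
move: wW; rewrite !inE -orbA => /or3P[]/eqP-> t; rewrite !inE -orbA => /or3P[]/eqP->.
- by apply: (adj' t1); rewrite ?mulg1.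
- by apply: (adj' t3); rewrite // E13 inv2.
- by apply: (adj' t2); rewrite // inv2.
- by apply: (adj' t2); rewrite ?mulg1.
- by apply: (adj' t1); rewrite // inv2.
- by apply: (adj' t3); rewrite // E21a inv2.
- by apply: (adj' t3); rewrite ?mulg1.
- by apply: (adj' t2); rewrite // E12 inv2.
- by apply: (adj' t1); rewrite // E21b inv2.
Qed.

End Bounds.

Theorem theorem4p1 (n : nat) (hn : 4 <= n) :
  pi_conn (CW n) 3 = (6 * n - 9) %/ 4.
Proof.
case: n hn => // n n3.
have [Om0 cOm0 ub] := terminals_upper n3.
apply/pi_connP; first by rewrite -cOm0 max_card.
have lower (Om : {set 'S_n.+1}) : #|Om| = 3 -> (6 * n.+1 - 9) %/ 4 <= pi_omega (CW n.+1) Om.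
  rewrite cardE => sOm; have := enum_uniq Om; have := mem_enum Om.
  case: (enum Om) sOm => [|x [|y [|z []]]] // _ memE uT.
  have -> : Om = [set x; y; z] by apply/setP=> v; rewrite -memE !inE orbA.
  exact: terminals_lower.
split=> //; exists Om0 => //.
by apply/eqP; rewrite eqn_leq ub lower.
Qed.
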